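(* Let $P\in\mathcal{O}\setminus\{0\}$, $P(0)=0$. Let $\mathcal{L}$, $H_{\mathcal L}$ and the set $\mathcal{Z}_{\mathcal L}\subset\mathbb{P}^1_{\mathbb C}$ of zeros of $H_{\mathcal L}$ be as defined in the context. Put $\mathcal{Z}=\mathcal{Z}_{\mathcal L}$ if $H_{\mathcal L}$ is not constant, and $\mathcal{Z}=\{\xi\}$ with an arbitrary $\xi\in\mathbb{P}^1_{\mathbb C}$ otherwise. Let $\hat f\in\hat{\mathcal{O}}$ be such that $\hat f\circ b_\xi$ is a $P\circ b_\xi$-asymptotic series for every $\xi\in\mathcal{Z}$. Then $\hat f$ is a $P$-asymptotic series.
   Context: Fix an integer $d\ge2$. $D(0;r)=\{x\in\mathbb{C}^d:|x_j|<r\ \forall j\}$. $\mathcal{O}=\mathbb{C}\{x_1,\dots,x_d\}$, $\hat{\mathcal{O}}=\mathbb{C}[[x_1,\dots,x_d]]$ with maximal ideal $\mathfrak{m}$; $\mathcal{O}_b(U)$ = bounded holomorphic functions on $U$; $J(f)$ = power series of $f$ at $0$. For $v\in\mathbb{C}^d$ write $v''=(v_3,\dots,v_d)$. For a germ $Q\in\mathcal{O}\setminus\{0\}$ with $Q(0)=0$: $\hat f\in\hat{\mathcal{O}}$ is a $Q$-asymptotic series if there are $\rho>0$ and a sequence $\{f_n\}$ in $\mathcal{O}_b(D(0;\rho))$ such that $J(f_n)\to\hat f$ in the $\mathfrak{m}$-adic topology and $J(f_n)\equiv\hat f\bmod Q^n\hat{\mathcal{O}}$ for all $n$. Blow-up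 charts: $\mathbb{P}^1_{\mathbb C}=\mathbb{C}\cup\{\infty\}$ with $\xi\in\mathbb{C}$ identified with $[1,\xi]$ and $\infty$ with $[0,1]$; $b_\xi(v)=(v_2,(\xi+v_1)v_2,v'')$ for $\xi\in\mathbb{C}$ and $b_\infty(v)=(v_1v_2,v_2,v'')$. Definition of $H_{\mathcal L}$: if $d=2$, put $\mathcal{L}=\emptyset$ and let $H_{\mathcal L}(x_1,x_2)$ be the homogeneous component of lowest degree of $P$. If $d>2$, let $\mathcal{L}:\mathbb{N}^{d-2}\to\mathbb{R}_+$ be an injective linear form; among all exponents $m=(m_3,\dots,m_d)$ such that some term $c\,x_1^{m_1}x_2^{m_2}x_3^{m_3}\cdots x_d^{m_d}$, $c\ne0$, occurs in $P$, let $\mathbf{a}$ be the one with $\mathcal{L}(m)$ minimal; let $P_{\mathcal L}(x_1,x_2)$ be the series in $x_1,x_2$ which is the coefficient of $(x'')^{\mathbf a}$ in $P$, and let $H_{\mathcal L}(x_1,x_2)$ be its homogeneous component of lowest degree. $\mathcal{Z}_{\mathcal L}$ is the set of zeros of $H_{\mathcal L}$ in $\mathbb{P}^1_{\mathbb C}$, where $H_{\mathcal L}(\xi)=H_{\mathcal L}(1,\xi)$ for $\xi\in\mathbb{C}$ and $H_{\mathcal L}(\infty)=H_{\mathcal L}(0,1)$. *)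

(* Defs.v *)
From HB Require Import structures.
From mathcomp Require Import all_boot all_order all_algebra complex.
From mathcomp Require Import all_classical all_reals all_analysis.

Set Implicit Arguments.
Unset Strict Implicit.
Unset Printing Implicit Defensive.
Import Order.TTheory GRing.Theory Num.Theory.
Import numFieldNormedType.Exports.
Local Open Scope classical_set_scope.
Local Open Scope ring_scope.
Local Open Scope complex_scope.

(* The normed-module structure of a closed field on itself is attached to the
   sort of a [numClosedFieldType], not to [R[i]]; hence this packaged copy. *)
Definition cplx (R : realType) : numClosedFieldType := R[i].

(* Multi-indices form an additive monoid for the pointwise operations. *)
Notation mindex d := {ffun 'I_d -> nat}.

Definition mdeg (d : nat) (m : mindex d) : nat := (\sum_(i < d) m i)%N.

(* A formal power series is its family of coefficients: [F m] is the
   coefficient of [x^m]. *)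
Definition fpseries (R : realType) (d : nat) := mindex d -> cplx R.

Section PowerSeries.
Variables (R : realType) (d : nat).
Local Notation C := (cplx R).
Implicit Types (F G Q : fpseries R d) (m k : mindex d).

Definition mszero : fpseries R d := fun=> 0.

Definition msconst (c : C) : fpseries R d := fun m => if m == 0 then c else 0.

Definition msvar (i : 'I_d) : fpseries R d :=
  fun m => if m == [ffun j => nat_of_bool (j == i)] then 1 else 0.

Definition msadd F G : fpseries R d := fun m => F m + G m.

Definition mssub F G : fpseries R d := fun m => F m - G m.

(* The index set is finite. *)
Definition msmul F G : fpseries R d :=
  fun m => \sum_(kl \in [set kl : mindex d * mindex d | kl.1 + kl.2 = m])
             F kl.1 * G kl.2.

Definition msexp F (e : nat) : fpseries R d := iter e (msmul F) (msconst 1).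

(* C{x_1, ..., x_d}: absolute convergence on some polydisc. *)
Definition ms_convergent F : Prop :=
  exists2 r : R, 0 < r &
    summable [set: mindex d] (fun m => (Normc.normc (F m) * r ^+ mdeg m)%:E).

(* A sequence tends to [F] for the topology of the maximal ideal; the N-th
   power of that ideal is the set of series without terms of degree < N. *)
Definition madic_cvg (Fs : nat -> fpseries R d) F : Prop :=
  forall N : nat, \forall k \near \oo,
    forall m, (mdeg m < N)%N -> mssub (Fs k) F m = 0.

Definition ms_congr Q F G : Prop :=
  exists H : fpseries R d, mssub F G = msmul Q H.

End PowerSeries.
Arguments mszero {R d}.
Arguments msconst {R d} c.
Arguments msvar {R d} i.

(* Substitution [F o b].  It is meaningful when every [b i] has zero constant
   term: [b^k] then has no terms of degree < |k|, so for each [m] only finitely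
   many [k] contribute ([\sum_(k \in A)] ranges over the nonzero terms). *)
Definition mscomp (R : realType) (d : nat) (F : fpseries R d)
    (b : 'I_d -> fpseries R d) : fpseries R d :=
  fun m => \sum_(k \in [set: mindex d])
    F k * (\big[@msmul R d/msconst 1]_(i < d) msexp (b i) (k i)) m.

Section Holomorphic.
Variables (R : realType) (d : nat).
Local Notation C := (cplx R).

Definition polydisc (r : R) : set 'rV[C]_d :=
  [set x | forall j, `|x 0 j| < (r%:C : C)].

(* Differentiability is over the field [C].  Functions are total; values
   outside the open set [U] are irrelevant. *)
Definition bounded_holomorphic (U : set 'rV[C]_d) (f : 'rV[C]_d -> C) : Prop :=
  (forall x, U x -> differentiable f x) /\ [bounded f x | x in U].

Definition mpartial (m : mindex d) (f : 'rV[C]_d -> C) : 'rV[C]_d -> C :=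
  foldr (fun i g => iter (m i) (fun h x => 'D_(delta_mx 0 i) h x) g)
        f (enum 'I_d).

Definition taylor (f : 'rV[C]_d -> C) : fpseries R d :=
  fun m => (\prod_(i < d) (m i)`!%:R)^-1 * mpartial m f 0.

Definition asymptotic_series (Q F : fpseries R d) : Prop :=
  exists rho : R, 0 < rho /\
  exists f : nat -> 'rV[C]_d -> C,
    [/\ forall k, bounded_holomorphic (polydisc rho) (f k),
        madic_cvg (fun k => taylor (f k)) F
      & forall k, ms_congr (msexp Q k) (taylor (f k)) F].

End Holomorphic.

Inductive proj_line (R : realType) : Type :=
| PFin of cplx R
| PInf.
Arguments PInf {R}.

(* From here on the dimension is [n.+2], convertible to [2 + n]. *)
Section BlowUp.
Variables (R : realType) (n : nat).
Local Notation C := (cplx R).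

Definition blowup (xi : proj_line R) : 'I_n.+2 -> fpseries R n.+2 :=
  let i1 : 'I_n.+2 := ord0 in
  let i2 : 'I_n.+2 := lift ord0 ord0 in
  match xi with
  | PFin c => fun j =>
      if j == i1 then msvar i2
      else if j == i2 then
        msmul (msadd (msconst c) (msvar i1)) (msvar i2)
      else msvar j
  | PInf => fun j =>
      if j == i1 then msmul (msvar i1) (msvar i2) else msvar j
  end.

End BlowUp.
Arguments blowup {R} n xi.

Section InitialForm.
Variables (R : realType) (n : nat).
Local Notation C := (cplx R).

Definition mtail (m : mindex n.+2) : mindex n :=
  [ffun j : 'I_n => m (@rshift 2 n j)].

Definition mcat (p : mindex 2) (a : mindex n) : mindex n.+2 :=
  [ffun k : 'I_(2 + n) =>
     match fintype.split k with inl i => p i | inr j => a j end].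

Variable P : fpseries R n.+2.

(* The exponent of x'' occurring in [P] at which [L] is minimal; it is unique
   when [L] is injective.  If n = 0 the only exponent is the empty one, so that
   [PL] below is [P] itself. *)
Definition min_exponent (L : mindex n -> R) : mindex n :=
  xget 0 [set a | (exists2 m, P m != 0 & mtail m = a) /\
                  (forall m, P m != 0 -> L a <= L (mtail m))].

Definition PL (L : mindex n -> R) : fpseries R 2 :=
  fun p => P (mcat p (min_exponent L)).

End InitialForm.

Section LowestForm.
Variables (R : realType).
Local Notation C := (cplx R).
Implicit Types F H : fpseries R 2.

Definition lowest_degree F : nat :=
  xget 0%N [set e | (exists2 p, F p != 0 & mdeg p = e) /\
                    (forall p, F p != 0 -> (e <= mdeg p)%N)].

Definition lowest_form F : fpseries R 2 :=
  fun p => if mdeg p == lowest_degree F then F p else 0.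

Definition is_constant H : Prop := exists c : C, H = msconst c.

(* Value of a polynomial; the sum ranges over the nonzero terms. *)
Definition eval2 H (z w : C) : C :=
  \sum_(p \in [set: mindex 2]) H p * z ^+ p ord0 * w ^+ p ord_max.

Definition projective_zeros H : set (proj_line R) :=
  [set xi | match xi with
            | PFin c => eval2 H 1 c = 0
            | PInf => eval2 H 0 1 = 0
            end].

End LowestForm.

Definition HL (R : realType) (n : nat) (P : fpseries R n.+2)
    (L : mindex n -> R) : fpseries R 2 := lowest_form (PL P L).

(* Main.v *)
Require Import Defs.
From HB Require Import structures.
From mathcomp Require Import all_boot all_order all_algebra complex.
From mathcomp Require Import all_classical all_reals all_analysis.
From mathcomp Require Import ring lra.

Set Implicit Arguments.
Unset Strict Implicit.
Unset Printing Implicit Defensive.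
Import Order.TTheory GRing.Theory Num.Theory.
Import numFieldNormedType.Exports.
Local Open Scope classical_set_scope.
Local Open Scope ring_scope.

(** Division by [P], carried out on the base of the blow-up, is controlled in the
    charts at the points of [Z].  Fix [k].  By hypothesis the pull-back of [f] in
    the chart at each [xi] of [Z] is [F xi + (P o b_xi) ^ k * K xi], with [F xi]
    convergent and [K xi] only formal.  The point is to find a single series [q]
    on the base such that all [K xi - q o b_xi] converge, on polydiscs whose radii
    do not depend on [k].  Then the pull-backs of [g := f - P ^ k q] converge
    there, hence [g] itself converges on a polydisc independent of [k]
    ([chart_coef_bounded]), and these series [g] are the functions to be found;
    they tend to [f] because [P] has no constant term.

    The series [q] is obtained by dividing [f] by [P], one factor at a time.
    Everything rests on the division by a linear form vanishing at a point [xi]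
    of [Z] ([divisor_lform]).  The remainder of [f] is its restriction to [xi],
    and the linear form vanishes at [xi], so in the chart at [xi] the remainder
    is a part of [F xi] and is bounded; the quotients are then compared in each
    chart, where the linear form is [v_2] times [u + w v_1] with either [u = 0]
    or no zero near [v_1 = 0].  Since the form [HL P L] splits into linear forms
    with zeros in [Z], this gives the division by the initial part of [P], which
    is that form times a monomial in [x''] ([divisor_bihomogeneous]).

    The other terms of [P] are a perturbation.  Giving [x_1] and [x_2] the small
    weight [eps], and the other variables the weights prescribed by [L], makes the
    initial part the part of least weight, with a gap ([weight_gap]).  The norms
    weight a coefficient of weight [t] by [exp (- T t)].  For large [T],
    multiplication by the perturbation therefore gains more than division by the
    initial part loses, and the division by [P] follows by iteration
    ([quot_bound]).  As [K xi] is not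
    known to converge, all estimates are first made for the coefficients of
    bounded weight.  In [power_remainder] the division is repeated [k] times, with
    the same [T].

    Functions enter through two facts on power series: Taylor coefficients of a
    bounded holomorphic function are geometrically bounded ([taylor_coef_bounded])
    and conversely ([taylor_psum]).  The first is Cauchy's formula.  The integral
    over a circle is replaced by limits of averages over [2 ^ n] equidistant
    points; Goursat's argument applies to the corresponding Riemann sums on
    rectangles in logarithmic coordinates, because they are exactly additive under
    subdivision and exactly zero for affine functions ([goursat]). *)

(** * Moduli of complex numbers and limits along an ultrafilter *)

Section Modulus.
Variable R : realType.
Local Notation C := (cplx R).
Implicit Types x y : C.

(** The norm of [cplx R] takes complex values; estimates are made with this real one. *)
Definition cmod (x : C) : R := Normc.normc x.

Lemma cmod_ge0 x : 0 <= cmod x.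
Proof. by case: x => a b; exact: sqrtr_ge0. Qed.

Lemma cmod0 : cmod 0 = 0.
Proof. exact: Normc.normc0. Qed.

Lemma cmod1 : cmod 1 = 1.
Proof. exact: Normc.normc1. Qed.

Lemma cmodM x y : cmod (x * y) = cmod x * cmod y.
Proof. exact: Normc.normcM. Qed.

Lemma cmodV x : cmod x^-1 = (cmod x)^-1.
Proof. exact: Normc.normcV. Qed.

Lemma cmodN x : cmod (- x) = cmod x.
Proof. exact: normcN. Qed.

Lemma cmodD x y : cmod (x + y) <= cmod x + cmod y.
Proof. exact: le_normcD. Qed.

Lemma cmodB x y : cmod (x - y) <= cmod x + cmod y.
Proof. by rewrite -(cmodN y) cmodD. Qed.

Lemma cmodBC x y : cmod (x - y) = cmod (y - x).
Proof. by rewrite -cmodN opprB. Qed.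

Lemma cmod_eq0 x : (cmod x == 0) = (x == 0).
Proof.
by apply/eqP/eqP => [/Normc.eq0_normc//|->]; exact: cmod0.
Qed.

Lemma cmod_gt0 x : (0 < cmod x) = (x != 0).
Proof. by rewrite lt_def cmod_ge0 cmod_eq0 andbT. Qed.

Lemma cmodX x n : cmod (x ^+ n) = cmod x ^+ n.
Proof. by elim: n => [|n IH]; rewrite ?expr0 ?cmod1// !exprS cmodM IH. Qed.

Definition rc (r : R) : C := (r%:C)%C.

Lemma normr_cmod x : `|x| = rc (cmod x).
Proof. by []. Qed.

Lemma rc_additive : additive rc.
Proof. exact: (rmorphB (real_complex R)). Qed.

Lemma rc_multiplicative : multiplicative rc.
Proof. exact: real_complex_is_multiplicative. Qed.

HB.instance Definition _ := GRing.isAdditive.Build R C rc rc_additive.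
HB.instance Definition _ := GRing.isMultiplicative.Build R C rc rc_multiplicative.

Definition im : C := (0 +i* 1)%C.

Lemma complex_decomp (x : C) : x = rc (complex.Re x) + im * rc (complex.Im x).
Proof. exact: complexE. Qed.

Lemma sqr_im : im * im = -1.
Proof. by have := sqr_i R; rewrite expr2. Qed.

Lemma cmod_im : cmod im = 1.
Proof. by rewrite /cmod /= expr0n expr1n add0r sqrtr1. Qed.

Lemma cmod_real (r : R) : cmod (rc r) = `|r|.
Proof. by rewrite /cmod /= expr0n /= addr0 sqrtr_sqr. Qed.

Lemma cmod_nat n : cmod n%:R = n%:R.
Proof.
by rewrite -(rmorph_nat rc) cmod_real ger0_norm.
Qed.

Lemma cmod_prod (I : Type) (s : seq I) (P : pred I) (F : I -> C) :
  cmod (\prod_(i <- s | P i) F i) = \prod_(i <- s | P i) cmod (F i).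
Proof. by apply: (big_morph cmod cmodM cmod1). Qed.

Lemma cmod_sum (I : Type) (s : seq I) (P : pred I) (F : I -> C) :
  cmod (\sum_(i <- s | P i) F i) <= \sum_(i <- s | P i) cmod (F i).
Proof.
elim/big_rec2: _ => [|i y x Pi xy]; first by rewrite cmod0.
by rewrite (le_trans (cmodD _ _))// lerD2l.
Qed.

Lemma cmod_sum_le (I : Type) (s : seq I) (P : pred I) (F : I -> C) (G : I -> R) :
  (forall i, P i -> cmod (F i) <= G i) ->
  cmod (\sum_(i <- s | P i) F i) <= \sum_(i <- s | P i) G i.
Proof. by move=> FG; rewrite (le_trans (cmod_sum _ _ _))// ler_sum. Qed.

Lemma cmod_triangle y x z : cmod (x - z) <= cmod (x - y) + cmod (y - z).
Proof. by rewrite -[x - z](subrKA y) cmodD. Qed.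

Lemma cmod_lb x y : cmod x - cmod y <= cmod (x - y).
Proof. by rewrite lerBlDr -{1}[x](subrK y) cmodD. Qed.

Lemma Re_le_cmod x : `|complex.Re x| <= cmod x.
Proof.
case: x => a b; rewrite /cmod /= -[leLHS]sqrtr_sqr ler_wsqrtr//.
by rewrite lerDl sqr_ge0.
Qed.

Lemma Im_le_cmod x : `|complex.Im x| <= cmod x.
Proof.
case: x => a b; rewrite /cmod /= -[leLHS]sqrtr_sqr ler_wsqrtr//.
by rewrite lerDr sqr_ge0.
Qed.

End Modulus.

Section UltraLimit.
Variable R : realType.
Local Notation C := (cplx R).

(** Contour integrals and sums of series are limits, along one fixed ultrafilter,
    of bounded sequences.  Such a limit exists for every bounded sequence, is
    linear and preserves bounds, so identities and estimates are proved for the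
    finite sums and then pass to the limit. *)
Definition ultra : set_system nat :=
  projT1 (cid (ultraFilterLemma (@eventually_filter))).

Lemma ultraP : UltraFilter ultra /\ \oo `<=` ultra.
Proof. exact: (projT2 (cid (ultraFilterLemma (@eventually_filter)))). Qed.

#[global] Instance ultra_proper_filter : ProperFilter ultra.
Proof. by have [/@ultra_proper] := ultraP. Qed.

Lemma ultra_near (P : set nat) : (\forall n \near \oo, P n) -> ultra P.
Proof. by have [_] := ultraP; apply. Qed.

Definition ulimR (u : nat -> R) : R := lim (u @ ultra).

Definition ulim (u : nat -> C) : C :=
  (ulimR (fun n => complex.Re (u n)) +i* ulimR (fun n => complex.Im (u n)))%C.

Definition ubounded (u : nat -> C) := exists M : R, forall n, cmod (u n) <= M.

Lemma ulimR_cvg (u : nat -> R) (M : R) :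
  (forall n, `|u n| <= M) -> u @ ultra --> ulimR u.
Proof.
move=> uM; have [U _] := ultraP.
have K : compact `[-M, M] by exact: segment_compact.
have [p [_ up]] : `[-M, M] `&` [set p | u @ ultra --> p] !=set0.
  have PF : ProperFilter (u @ ultra) by apply: fmap_proper_filter.
  have UF : UltraFilter (u @ ultra).
    split=> // G PG sG; apply/seteqP; split=> // A GA.
    have [//|uAC] := in_ultra_setVsetC (u @^-1` A) U.
    have : G (~` A) by apply: sG.
    by move=> /(filterI GA); rewrite setICr => /filter_not_empty.
  move: K; rewrite compact_ultra; apply => //.
  suff : ultra (u @^-1` `[-M, M]) by [].
  by apply: filterE => n; rewrite /= in_itv/= -ler_norml.
by rewrite /ulimR; apply/cvg_ex; exists p.
Qed.

Lemma ubounded_Re u : ubounded u -> exists M : R,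
  forall n, `|complex.Re (u n)| <= M.
Proof. by case=> M uM; exists M => n; rewrite (le_trans (Re_le_cmod _)). Qed.

Lemma ubounded_Im u : ubounded u -> exists M : R,
  forall n, `|complex.Im (u n)| <= M.
Proof. by case=> M uM; exists M => n; rewrite (le_trans (Im_le_cmod _)). Qed.

Lemma ulim_Re u : ubounded u ->
  (fun n => complex.Re (u n)) @ ultra --> complex.Re (ulim u).
Proof. by move=> /ubounded_Re[M uM]; exact: ulimR_cvg uM. Qed.

Lemma ulim_Im u : ubounded u ->
  (fun n => complex.Im (u n)) @ ultra --> complex.Im (ulim u).
Proof. by move=> /ubounded_Im[M uM]; exact: ulimR_cvg uM. Qed.

Lemma uboundedD u v : ubounded u -> ubounded v -> ubounded (fun n => u n + v n).
Proof.
move=> [M uM] [N vN]; exists (M + N) => n.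
by rewrite (le_trans (cmodD _ _))// lerD.
Qed.

Lemma uboundedM u v : ubounded u -> ubounded v -> ubounded (fun n => u n * v n).
Proof.
move=> [M uM] [N vN]; exists (M * N) => n.
by rewrite cmodM ler_pM ?cmod_ge0.
Qed.

Lemma ubounded_cst c : ubounded (fun=> c).
Proof. by exists (cmod c). Qed.

Lemma ulim_unique u (a b : R) : (fun n => complex.Re (u n)) @ ultra --> a ->
  (fun n => complex.Im (u n)) @ ultra --> b -> ulim u = (a +i* b)%C.
Proof. by move=> ua ub; rewrite /ulim /ulimR (cvg_lim _ ua)// (cvg_lim _ ub). Qed.

Lemma ulimD u v : ubounded u -> ubounded v ->
  ulim (fun n => u n + v n) = ulim u + ulim v.
Proof.
move=> bu bv.
rewrite (@ulim_unique _ (complex.Re (ulim u) + complex.Re (ulim v))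
  (complex.Im (ulim u) + complex.Im (ulim v))); first by case: ulim; case: ulim.
- have -> : (fun n => complex.Re (u n + v n)) =
    (fun n => complex.Re (u n)) \+ (fun n => complex.Re (v n)).
    by apply/funext => n /=; case: (u n); case: (v n).
  by apply: cvgD; exact: ulim_Re.
- have -> : (fun n => complex.Im (u n + v n)) =
    (fun n => complex.Im (u n)) \+ (fun n => complex.Im (v n)).
    by apply/funext => n /=; case: (u n); case: (v n).
  by apply: cvgD; exact: ulim_Im.
Qed.

Lemma ulim_cst c : ulim (fun=> c) = c.
Proof.
by case: c => a b; rewrite (@ulim_unique _ a b)//=; exact: cvg_cst.
Qed.

Lemma ulimZ c u : ubounded u -> ulim (fun n => c * u n) = c * ulim u.
Proof.
move=> bu; case: c => a b.
rewrite (@ulim_unique _ (a * complex.Re (ulim u) - b * complex.Im (ulim u))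
  (a * complex.Im (ulim u) + b * complex.Re (ulim u))).
- by case: (ulim u) => x y; rewrite /GRing.mul /= /mulc.
- have -> : (fun n => complex.Re ((a +i* b)%C * u n)) =
    (fun n => a * complex.Re (u n)) \- (fun n => b * complex.Im (u n)).
    by apply/funext => n /=; case: (u n).
  by apply: cvgB; (apply: cvgM; first exact: cvg_cst);
    [exact: ulim_Re|exact: ulim_Im].
- have -> : (fun n => complex.Im ((a +i* b)%C * u n)) =
    (fun n => a * complex.Im (u n)) \+ (fun n => b * complex.Re (u n)).
    by apply/funext => n /=; case: (u n).
  by apply: cvgD; (apply: cvgM; first exact: cvg_cst);
    [exact: ulim_Im|exact: ulim_Re].
Qed.

Lemma ulim_le u (M : R) : ubounded u ->
  (\forall n \near \oo, cmod (u n) <= M) -> cmod (ulim u) <= M.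
Proof.
move=> bu uM; have M0 : 0 <= M.
  by case: uM => N _ /(_ N (leqnn N)); apply: le_trans (cmod_ge0 _).
have cv : (fun n => complex.Re (u n) ^+ 2 + complex.Im (u n) ^+ 2) @ ultra -->
    complex.Re (ulim u) ^+ 2 + complex.Im (ulim u) ^+ 2.
  have [cr ci] := (ulim_Re bu, ulim_Im bu).
  by apply: cvgD; rewrite expr2; apply: cvgM.
have : complex.Re (ulim u) ^+ 2 + complex.Im (ulim u) ^+ 2 <= M ^+ 2.
  apply: (cvgr_to_le cv).
  apply: ultra_near; apply: filterS uM => n; case: (u n) => a b /= uM.
  by rewrite -[leLHS]sqr_sqrtr ?addr_ge0 ?sqr_ge0// ler_pXn2r// nnegrE sqrtr_ge0.
case: (ulim u) => a b /= h; rewrite /cmod /=.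
by rewrite -[leRHS]ger0_norm// -sqrtr_sqr ler_wsqrtr.
Qed.

Lemma uboundedN u : ubounded u -> ubounded (fun n => - u n).
Proof. by case=> M uM; exists M => n; rewrite cmodN. Qed.

Lemma ulimN u : ubounded u -> ulim (fun n => - u n) = - ulim u.
Proof.
move=> bu; rewrite -mulN1r -ulimZ//; congr ulim.
by apply/funext => n; rewrite mulN1r.
Qed.

Lemma ulimB u v : ubounded u -> ubounded v ->
  ulim (fun n => u n - v n) = ulim u - ulim v.
Proof.
by move=> bu bv; rewrite ulimD ?ulimN//; exact: uboundedN.
Qed.

Lemma ulim_eq u v : ubounded u -> ubounded v ->
  (forall e : R, 0 < e -> \forall n \near \oo, cmod (u n - v n) <= e) ->
  ulim u = ulim v.
Proof.
move=> bu bv uv; apply/eqP; rewrite -subr_eq0 -cmod_eq0 eq_le cmod_ge0 andbT.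
apply/ler_addgt0Pr => e e0; rewrite add0r -ulimB//.
by apply: ulim_le; [apply: uboundedD => //; exact: uboundedN|exact: uv].
Qed.

Lemma ulim_sum (I : eqType) (s : seq I) (F : I -> nat -> C) :
  {in s, forall i, ubounded (F i)} ->
  ubounded (fun n => \sum_(i <- s) F i n) /\
  ulim (fun n => \sum_(i <- s) F i n) = \sum_(i <- s) ulim (F i).
Proof.
elim: s => [|i s IH] bF.
  rewrite big_nil (_ : (fun _ => _) = fun=> 0).
    by split; [exact: ubounded_cst|exact: ulim_cst].
  by apply/funext => n; rewrite big_nil.
have [|b e] := IH; first by move=> j js; apply: bF; rewrite in_cons js orbT.
have bi : ubounded (F i) by apply: bF; rewrite mem_head.
rewrite big_cons -e -ulimD// (_ : (fun _ => _) =
  (fun n => F i n + \sum_(j <- s) F j n)); first by split => //; exact: uboundedD.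
by apply/funext => n; rewrite big_cons.
Qed.

End UltraLimit.

(** * Goursat's theorem for Riemann sums *)

Section Goursat.
Variable R : realType.
Local Notation C := (cplx R).
Implicit Types (g h : R -> C) (x y X Y t s : R).

(** Left Riemann sum of [g] from [t] to [t + X], with [2 ^ n] sample points. *)
Definition rsum (n : nat) t X g : C :=
  rc (X / 2 ^+ n) * \sum_(0 <= k < 2 ^ n) g (t + k%:R * (X / 2 ^+ n)).

Lemma rsum_split n t X g :
  rsum n.+1 t X g = rsum n t (X / 2) g + rsum n (t + X / 2) (X / 2) g.
Proof.
rewrite /rsum; have -> : X / 2 / 2 ^+ n = X / 2 ^+ n.+1.
  by rewrite exprS invfM mulrA.
rewrite -mulrDr; congr (_ * _).
rewrite (@big_cat_nat _ _ _ (2 ^ n))//=; last by rewrite leq_exp2l.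
congr (_ + _); rewrite -{1}(add0n (2 ^ n)%N) big_addn expnS mul2n -addnn addnK.
apply: eq_bigr => k _; congr g.
have h : (2 ^ n)%:R * (X / 2 ^+ n.+1) = X / 2 :> R.
  by rewrite natrX exprS; field; rewrite expf_neq0//= pnatr_eq0.
by rewrite natrD mulrDl h addrAC addrA.
Qed.

Lemma rsum_const n t X (c : C) : rsum n t X (fun=> c) = rc X * c.
Proof.
rewrite /rsum big_const_nat subn0 iter_addr_0 -[c *+ _]mulr_natl mulrA; congr (_ * _).
rewrite -(rmorph_nat (@rc R)) -rmorphM natrX; congr (rc _).
by rewrite divfK// expf_neq0// pnatr_eq0.
Qed.

Lemma rsumB n t X g h :
  rsum n t X (fun s => g s - h s) = rsum n t X g - rsum n t X h.
Proof. by rewrite /rsum sumrB mulrBr. Qed.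

Lemma rsum_le n t X g (e : R) : 0 <= X ->
  (forall s, t <= s <= t + X -> cmod (g s) <= e) ->
  cmod (rsum n t X g) <= X * e.
Proof.
move=> X0 ge; rewrite /rsum cmodM cmod_real.
have p2 : 0 < 2 ^+ n :> R by rewrite exprn_gt0.
have q0 : 0 <= X / 2 ^+ n by rewrite divr_ge0// ltW.
rewrite ger0_norm//.
have : cmod (\sum_(0 <= k < 2 ^ n) g (t + k%:R * (X / 2 ^+ n))) <=
    \sum_(0 <= k < 2 ^ n) e.
  rewrite !big_nat; apply: cmod_sum_le => k /andP[_ kn]; apply: ge.
  have k2 : k%:R <= 2 ^+ n :> R by rewrite -natrX ler_nat ltnW.
  rewrite lerDl mulr_ge0//= lerD2l mulrCA ler_piMr//.
  by rewrite ler_pdivrMr ?mul1r.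
rewrite big_const_nat subn0 iter_addr_0 -[e *+ _]mulr_natl natrX => sle.
have -> : X * e = X / 2 ^+ n * (2 ^+ n * e).
  by rewrite mulrA divfK ?gt_eqF.
by rewrite ler_wpM2l.
Qed.

Variable G : R -> R -> C.

(** Left Riemann sum, with [2 ^ n] sample points on each side, of the contour
    integral of [G] along the boundary of a rectangle.  Opposite sides are
    sampled at facing points, and halving the rectangle matches doubling the
    number of points: the sums are exactly additive under quartering and
    exactly zero for affine functions, hence the limits of these sums play the
    role of the integrals. *)
Definition bsum n x y X Y : C :=
  rsum n x X (G^~ y) - rsum n x X (G^~ (y + Y)) +
  (im R) * (rsum n y Y (G (x + X)) - rsum n y Y (G x)).

Lemma bsum_split n x y X Y :
  bsum n.+1 x y X Y =
    bsum n x y (X / 2) (Y / 2) + bsum n (x + X / 2) y (X / 2) (Y / 2) +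
    (bsum n x (y + Y / 2) (X / 2) (Y / 2) +
     bsum n (x + X / 2) (y + Y / 2) (X / 2) (Y / 2)).
Proof.
have h (u v : R) : u + v / 2 + v / 2 = u + v by lra.
by rewrite /bsum !rsum_split !h; ring.
Qed.

(** The boundary sum of an affine function of [s + i t] vanishes exactly, as
    its values at facing points of opposite sides differ by a constant. *)
Lemma bsum_affine_le n x y X Y (a l : C) s t (e : R) : 0 <= X -> 0 <= Y ->
  (forall s' t', x <= s' <= x + X -> y <= t' <= y + Y ->
    cmod (G s' t' - a - l * (rc (s' - s) + (im R) * rc (t' - t))) <= e) ->
  cmod (bsum n x y X Y) <= 2 * (X + Y) * e.
Proof.
move=> X0 Y0 Ge.
pose A s' t' := a + l * (rc (s' - s) + (im R) * rc (t' - t)).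
pose D s' t' := G s' t' - A s' t'.
have De s' t' : x <= s' <= x + X -> y <= t' <= y + Y -> cmod (D s' t') <= e.
  by move=> hs ht; rewrite /D /A opprD addrA Ge.
have -> : bsum n x y X Y =
    rsum n x X (D^~ y) - rsum n x X (D^~ (y + Y)) +
    (im R) * (rsum n y Y (D (x + X)) - rsum n y Y (D x)).
  have E1 : rsum n x X (A^~ y) - rsum n x X (A^~ (y + Y)) =
      rc X * (- (l * ((im R) * rc Y))).
    rewrite -rsumB -(rsum_const n x); congr rsum; apply/funext => u.
    rewrite /A -(mulrN l) [in RHS](_ : Y = y + Y - t - (y - t)); last by ring.
    by rewrite rmorphB /=; ring.
  have E2 : rsum n y Y (A (x + X)) - rsum n y Y (A x) = rc Y * (l * rc X).
    rewrite -rsumB -(rsum_const n y); congr rsum; apply/funext => u.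
    rewrite /A [in RHS](_ : X = x + X - s - (x - s)); last by ring.
    by rewrite rmorphB /=; ring.
  rewrite /bsum /D !rsumB.
  set u1 := rsum n x X (G^~ y); set u2 := rsum _ _ _ (G^~ _).
  set u3 := rsum _ _ _ (G (x + X)); set u4 := rsum _ _ _ (G x).
  have -> : forall p q r v : C, u1 - p - (u2 - q) + (im R) * (u3 - r - (u4 - v)) =
      u1 - u2 + (im R) * (u3 - u4) - ((p - q) + (im R) * (r - v)).
    by move=> p q r v; ring.
  by rewrite E1 E2; ring.
apply: (le_trans (cmodD _ _)); rewrite cmodM cmod_im mul1r.
apply: (@le_trans _ _ ((X * e + X * e) + (Y * e + Y * e))); last by lra.
have [xX yY] : (x <= x <= x + X /\ x <= x + X <= x + X) /\
    (y <= y <= y + Y /\ y <= y + Y <= y + Y) by split; split; lra.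
by apply: lerD; apply: (le_trans (cmodB _ _)); apply: lerD;
  apply: rsum_le => // u hu; apply: De => //; case: xX; case: yY.
Qed.

Section Limit.
Variables (x0 y0 X0 Y0 : R).
Hypotheses (X0_gt0 : 0 < X0) (Y0_gt0 : 0 < Y0).

Local Notation XX k := (X0 / 2 ^+ k).
Local Notation YY k := (Y0 / 2 ^+ k).
Local Notation good c k p :=
  (\forall n \near \oo, cmod (bsum n p.1 p.2 (XX k) (YY k)) <= c * XX k * YY k).

Lemma pow2_half (Z : R) k : Z / 2 ^+ k / 2 = Z / 2 ^+ k.+1.
Proof. by rewrite exprS invfM mulrAC mulrA. Qed.

(** The boundary sums of the four quarters add up to that of the rectangle, and
    each quarter has a quarter of its area. *)
Lemma bad_quadrant (c : R) k (p : R * R) : exists p' : R * R,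
  ((p'.1 = p.1 \/ p'.1 = p.1 + XX k.+1) /\ (p'.2 = p.2 \/ p'.2 = p.2 + YY k.+1))
  /\ (~ good c k p -> ~ good c k.+1 p').
Proof.
have [gk|/contrapT bad] := pselect (~ (~ good c k p)); first by exists p; split; [split; left|].
apply/not_existsP => noq.
have gq (p' : R * R) : (p'.1 = p.1 \/ p'.1 = p.1 + XX k.+1) ->
    (p'.2 = p.2 \/ p'.2 = p.2 + YY k.+1) -> good c k.+1 p'.
  move=> h1 h2; apply: contrapT => np'; apply: (noq p'); split => //.
apply: bad.
have g1 := gq (p.1, p.2) (or_introl erefl) (or_introl erefl).
have g2 := gq (p.1 + XX k.+1, p.2) (or_intror erefl) (or_introl erefl).
have g3 := gq (p.1, p.2 + YY k.+1) (or_introl erefl) (or_intror erefl).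
have g4 := gq (p.1 + XX k.+1, p.2 + YY k.+1) (or_intror erefl) (or_intror erefl).
suff : \forall n \near \oo,
    cmod (bsum n.+1 p.1 p.2 (XX k) (YY k)) <= c * XX k * YY k.
  move=> [N _ hN]; exists N.+1 => // -[//|n] /= Nn; exact: hN.
near=> n.
have h1 : cmod (bsum n p.1 p.2 (XX k.+1) (YY k.+1)) <= c * XX k.+1 * YY k.+1 by near: n.
have h2 : cmod (bsum n (p.1 + XX k.+1) p.2 (XX k.+1) (YY k.+1)) <= c * XX k.+1 * YY k.+1 by near: n.
have h3 : cmod (bsum n p.1 (p.2 + YY k.+1) (XX k.+1) (YY k.+1)) <= c * XX k.+1 * YY k.+1 by near: n.
have h4 : cmod (bsum n (p.1 + XX k.+1) (p.2 + YY k.+1) (XX k.+1) (YY k.+1)) <= c * XX k.+1 * YY k.+1 by near: n.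
rewrite bsum_split !pow2_half.
have -> : c * XX k * YY k = (c * XX k.+1 * YY k.+1 + c * XX k.+1 * YY k.+1) +
    (c * XX k.+1 * YY k.+1 + c * XX k.+1 * YY k.+1).
  by rewrite -!pow2_half; field; rewrite expf_neq0//= pnatr_eq0.
apply: (le_trans (cmodD _ _)); apply: lerD; apply: (le_trans (cmodD _ _)); exact: lerD.
Unshelve. all: by end_near.
Qed.

Lemma nested_limit (Z : R) (u : nat -> R) : 0 < Z ->
  (forall k, u k.+1 = u k \/ u k.+1 = u k + Z / 2 ^+ k.+1) ->
  exists s, forall k, u k <= s <= u k + Z / 2 ^+ k.
Proof.
move=> Z0 hu.
have p2 k : 0 < Z / 2 ^+ k by rewrite divr_gt0// exprn_gt0.
have half k : Z / 2 ^+ k = Z / 2 ^+ k.+1 + Z / 2 ^+ k.+1.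
  by rewrite -pow2_half; lra.
have mono : {homo u : m n / (m <= n)%N >-> m <= n}.
  apply: homo_leq => [//|y x z|k]; first exact: le_trans.
  by case: (hu k) => ->//; rewrite lerDl ltW.
have anti : {homo (fun k => u k + Z / 2 ^+ k) : m n / (m <= n)%N >-> m >= n}.
  apply: homo_leq => [//|y x z a b|k]; first exact: le_trans b a.
  by have := p2 k.+1; have := half k; case: (hu k) => ->; lra.
have cross j k : u j <= u k + Z / 2 ^+ k.
  apply: (le_trans (mono _ _ (leq_maxl j k))).
  by rewrite (le_trans _ (anti _ _ (leq_maxr j k)))// lerDl ltW.
exists (sup (range u)) => k; apply/andP; split.
  by apply: ub_le_sup; [exists (u 0%N + Z / 2 ^+ 0) => _ [j _ <-]|exists k].
by apply: ge_sup; [exists (u 0%N); exists 0%N|move=> _ [j _ <-]].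
Qed.

(** Goursat's theorem.  If the boundary sums did not tend to zero, some quarter
    of the rectangle would be just as bad relative to its area, and so on; at
    the common point of the nested rectangles the affine approximation of [G]
    contributes nothing and the error is negligible relative to the area. *)
Lemma goursat :
  (forall s t, x0 <= s <= x0 + X0 -> y0 <= t <= y0 + Y0 ->
    exists l : C, forall eta : R, 0 < eta -> exists2 delta : R, 0 < delta &
    forall s' t', x0 <= s' <= x0 + X0 -> y0 <= t' <= y0 + Y0 ->
      `|s' - s| < delta -> `|t' - t| < delta ->
      cmod (G s' t' - G s t - l * (rc (s' - s) + (im R) * rc (t' - t))) <=
        eta * (`|s' - s| + `|t' - t|)) ->
  forall e : R, 0 < e -> \forall n \near \oo, cmod (bsum n x0 y0 X0 Y0) <= e.
Proof.
move=> dG e e0.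
pose c := e / (X0 * Y0).
have c0 : 0 < c by rewrite divr_gt0 ?mulr_gt0.
suff gd : good c 0 (x0, y0).
  have ce : c * (X0 / 2 ^+ 0) * (Y0 / 2 ^+ 0) = e.
    by rewrite /c expr0 !divr1; field; rewrite !gt_eqF.
  by move: gd; rewrite ce /= expr0 !divr1.
apply: contrapT => bad0.
have /choice[next nextP] : forall kp : nat * (R * R), exists p',
  ((p'.1 = kp.2.1 \/ p'.1 = kp.2.1 + XX kp.1.+1) /\
   (p'.2 = kp.2.2 \/ p'.2 = kp.2.2 + YY kp.1.+1))
  /\ (~ good c kp.1 kp.2 -> ~ good c kp.1.+1 p').
  by move=> [k p]; exact: bad_quadrant.
pose st := fix st k := if k is k'.+1 then next (k', st k') else (x0, y0).
have st_bad k : ~ good c k (st k).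
  elim: k => // k IH; have [_] := nextP (k, st k).
  by move/(_ IH).
have st1 k : (st k.+1).1 = (st k).1 \/ (st k.+1).1 = (st k).1 + XX k.+1.
  by have [[]] := nextP (k, st k).
have st2 k : (st k.+1).2 = (st k).2 \/ (st k.+1).2 = (st k).2 + YY k.+1.
  by have [[]] := nextP (k, st k).
have [s sP] := nested_limit X0_gt0 st1.
have [t tP] := nested_limit Y0_gt0 st2.
have st1_in k : x0 <= (st k).1 /\ (st k).1 + XX k <= x0 + X0.
  elim: k => [|k [IH1 IH2]]; first by rewrite /= expr0 divr1.
  have : XX k = XX k.+1 + XX k.+1 by rewrite -pow2_half; lra.
  have : 0 < XX k.+1 by rewrite divr_gt0// exprn_gt0.
  by case: (st1 k) => ->; lra.
have st2_in k : y0 <= (st k).2 /\ (st k).2 + YY k <= y0 + Y0.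
  elim: k => [|k [IH1 IH2]]; first by rewrite /= expr0 divr1.
  have : YY k = YY k.+1 + YY k.+1 by rewrite -pow2_half; lra.
  have : 0 < YY k.+1 by rewrite divr_gt0// exprn_gt0.
  by case: (st2 k) => ->; lra.
have [||l dGst] := dG s t.
- by have := sP 0%N; rewrite /= expr0 divr1.
- by have := tP 0%N; rewrite /= expr0 divr1.
pose eta := c * X0 * Y0 / (2 * (X0 + Y0) ^+ 2).
have XY0 : 0 < X0 + Y0 by rewrite addr_gt0.
have eta0 : 0 < eta by apply: divr_gt0; repeat apply: mulr_gt0 => //; exact: exprn_gt0.
have [delta delta0 small] := dGst eta eta0.
have [k kP] : exists k, (X0 + Y0) / 2 ^+ k < delta.
  have : (X0 + Y0) * (2^-1 ^+ k) @[k --> \oo] --> (X0 + Y0) * 0.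
    apply: cvgM; first exact: cvg_cst.
    by apply: cvg_expr; rewrite ger0_norm ?invr_ge0// invf_lt1// ltr1n.
  rewrite mulr0 => /cvgr_lt /(_ delta delta0) [N _ hN].
  by exists N; have := hN N (leqnn N); rewrite /= exprVn.
apply: (st_bad k); apply: nearW => n.
have pX : 0 < XX k by rewrite divr_gt0// exprn_gt0.
have pY : 0 < YY k by rewrite divr_gt0// exprn_gt0.
have := st1_in k; have := st2_in k; have := sP k; have := tP k.
have XYk : XX k + YY k < delta by rewrite -mulrDl.
move=> tk sk [ty1 ty2] [sx1 sx2].
apply: (@le_trans _ _ (2 * (XX k + YY k) * (eta * (XX k + YY k)))).
  apply: (@bsum_affine_le n _ _ _ _ (G s t) l s t); rewrite ?ltW//.
  move=> s' t' hs' ht'.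
  have ds : `|s' - s| <= XX k by rewrite ler_norml; lra.
  have dt : `|t' - t| <= YY k by rewrite ler_norml; lra.
  apply: (le_trans (small s' t' _ _ _ _)); [lra|lra|lra|lra|].
  by rewrite (ler_wpM2l (ltW eta0))// lerD.
rewrite le_eqVlt; apply/orP; left; apply/eqP.
by rewrite /eta; field; rewrite !gt_eqF// exprn_gt0.
Qed.

End Limit.
End Goursat.

(** * Averages over circles *)

Section Near.
Variable R : realType.
Local Notation C := (cplx R).

Lemma rc_lt (a b : R) : (rc a < rc b) = (a < b).
Proof. exact: ltcR. Qed.

Lemma rc_le (a b : R) : (rc a <= rc b) = (a <= b).
Proof. exact: lecR. Qed.

Lemma rcM (a b : R) : rc (a * b) = rc a * rc b.
Proof. exact: (rmorphM (@rc R)). Qed.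

Lemma rcD (a b : R) : rc (a + b) = rc a + rc b.
Proof. exact: (rmorphD (@rc R)). Qed.

Lemma rcB (a b : R) : rc (a - b) = rc a - rc b.
Proof. exact: (rmorphB (@rc R)). Qed.

Lemma rc0 : rc 0 = 0 :> C.
Proof. exact: (rmorph0 (@rc R)). Qed.

Lemma gt0_rc (e : C) : 0 < e -> exists2 r : R, 0 < r & e = rc r.
Proof. by case: e => a b; rewrite ltcE /= => /andP[/eqP -> a0]; exists a. Qed.

Lemma near_cmodP (a : C) (P : set C) : (\forall z \near a, P z) <->
  exists2 d : R, 0 < d & forall z, cmod (z - a) < d -> P z.
Proof.
split=> [/nbhs_normP[e /= /gt0_rc[d d0 ->] eP]|[d d0 dP]].
  exists d => // z zd; apply: eP => /=.
  by rewrite distrC normr_cmod rc_lt.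
apply/nbhs_normP; exists (rc d); first by rewrite /= -(rmorph0 (@rc R)) rc_lt.
by move=> z /=; rewrite distrC normr_cmod rc_lt => /dP.
Qed.

Lemma derivable_near (K : numFieldType) (V W : normedModType K) (f : V -> W) a v :
  derivable f a v -> forall e : K, 0 < e -> \forall h \near (0 : K),
    `|f (a + h *: v) - f a - h *: 'D_v f a| <= e * `|h|.
Proof.
move=> /derivable_nbhs/eqaddoP h e e0.
have := h e e0; apply: filterS => k.
have -> : (((fun h0 => (f \o shift a) (h0 *: v)) : K -> W) -
    (cst (f a) + *:%R^~ ('D_v f a))) k =
    f (k *: v + a) - (f a + k *: 'D_v f a) by [].
by rewrite opprD addrA (addrC (k *: v)).
Qed.

Lemma derivable_near_real (f : R -> R) (a df : R) :
  is_derive a 1 f df ->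
  forall e : R, 0 < e -> exists2 d : R, 0 < d &
    forall h, `|h| < d -> `|f (a + h) - f a - h * df| <= e * `|h|.
Proof.
move=> [df1 <-] e e0; have /nbhs_normP[d d0 dP] := derivable_near df1 e0.
exists d => // h hd; have := dP h; rewrite /= sub0r normrN => /(_ hd).
by rewrite -[h *: 1]/(h * 1) mulr1.
Qed.

Lemma derivable_near_cplx (f : C -> C) (a : C) : derivable f a 1 ->
  exists l : C, forall e : R, 0 < e -> exists2 d : R, 0 < d &
    forall z, cmod (z - a) < d -> cmod (f z - f a - l * (z - a)) <= e * cmod (z - a).
Proof.
move=> df1; exists ('D_1 f a) => e e0.
have e0' : 0 < rc e by rewrite -(rmorph0 (@rc R)) rc_lt.
have /near_cmodP[d d0 dP] := derivable_near df1 e0'.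
exists d => // z zd; have := dP (z - a); rewrite subr0 => /(_ zd).
rewrite -[(z - a) *: 1]/((z - a) * 1) mulr1 (addrC a) subrK [_ *: _]mulrC.
by rewrite 2!normr_cmod -rcM rc_le.
Qed.

Lemma derivable_cts (f : C -> C) (a : C) : derivable f a 1 ->
  forall e : R, 0 < e -> exists2 d : R, 0 < d &
    forall z, cmod (z - a) < d -> cmod (f z - f a) <= e.
Proof.
move=> /derivable_near_cplx[l lP] e e0; have [d d0 dP] := lP 1 ltr01.
exists (Num.min d (e / (1 + cmod l))).
  by rewrite lt_min d0 divr_gt0// ltr_wpDr ?cmod_ge0.
move=> z; rewrite lt_min => /andP[/dP zd].
rewrite ltr_pdivlMr ?ltr_wpDr ?cmod_ge0// => ze.
rewrite -(subrK (l * (z - a)) (f z - f a)) (le_trans (cmodD _ _))//.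
rewrite cmodM; rewrite mulrDr mulr1 in ze; rewrite mul1r in zd.
by rewrite (mulrC (cmod l)) (le_trans (lerD zd (lexx _)))// ltW.
Qed.

End Near.

Section PolarCoordinates.
Variable R : realType.
Local Notation C := (cplx R).

Definition cis (t : R) : C := rc (cos t) + im R * rc (sin t).

(** The complex exponential of [x + i y]. *)
Definition polar (x y : R) : C := rc (expR x) * cis y.

Lemma cisD s t : cis (s + t) = cis s * cis t.
Proof.
rewrite /cis cosD sinD rcB rcD !rcM.
have -> : forall a b : C, a - b = a + im R * im R * b.
  by move=> a b; rewrite sqr_im mulN1r.
ring.
Qed.

Lemma cis_period : cis (pi *+ 2) = 1.
Proof. by rewrite /cis cos2pi sin2pi rmorph0 mulr0 addr0 rmorph1. Qed.

Lemma cis0 : cis 0 = 1.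
Proof. by rewrite /cis cos0 sin0 rmorph0 mulr0 addr0 rmorph1. Qed.

Lemma cmod_cis t : cmod (cis t) = 1.
Proof.
have -> : cis t = (cos t +i* sin t)%C.
  by rewrite [RHS]complex_decomp.
by rewrite /cmod /= cos2Dsin2 sqrtr1.
Qed.

Lemma polarD x y s t : polar (x + s) (y + t) = polar x y * polar s t.
Proof. by rewrite /polar expRD rcM cisD; ring. Qed.

Lemma cmod_polar x y : cmod (polar x y) = expR x.
Proof. by rewrite cmodM cmod_cis mulr1 cmod_real ger0_norm ?expR_ge0. Qed.

Lemma polar_near0 (e : R) : 0 < e -> exists2 d : R, 0 < d & forall h k,
  `|h| < d -> `|k| < d ->
  cmod (polar h k - 1 - (rc h + im R * rc k)) <= e * (`|h| + `|k|).
Proof.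
move=> e0; pose u := Num.min 1 (e / 6%:R).
have u0 : 0 < u by rewrite lt_min ltr01 divr_gt0.
have u1 : u <= 1 by rewrite ge_min lexx.
have ue : u * 6 <= e by rewrite -ler_pdivlMr// ge_min lexx orbT.
have [de de0 he] := derivable_near_real (is_derive_expR 0) u0.
have [dc dc0 hc] := derivable_near_real (is_derive_cos 0) u0.
have [ds ds0 hs] := derivable_near_real (is_derive_sin 0) u0.
exists (Num.min (Num.min de (u / 2)) (Num.min dc ds)).
  by rewrite !lt_min de0 dc0 ds0 divr_gt0.
move=> h k; rewrite !lt_min => /andP[/andP[hde hu] _] /andP[_ /andP[kdc kds]].
have := he h hde; have := hc k kdc; have := hs k kds.
rewrite !add0r cos0 expR0 !sin0 !subr0 oppr0 mulr0 !subr0 !mulr1 => Hs Hc He.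
have hh : `|h| >= 0 by []. have kk : `|k| >= 0 by [].
have E1 : `|expR h - 1| <= 2 * `|h|.
  have -> : expR h - 1 = expR h - 1 - h + h by ring.
  by rewrite (le_trans (ler_normD _ _))//; nra.
have E2 : `|expR h - 1| <= u by lra.
have E3 : `|expR h| <= 2.
  have -> : expR h = expR h - 1 + 1 by ring.
  by rewrite (le_trans (ler_normD _ _))// normr1; lra.
have -> : polar h k - 1 - (rc h + im R * rc k) = rc (expR h - 1 - h) +
   (rc (expR h) * rc (cos k - 1) +
    im R * (rc (expR h) * rc (sin k - k) + rc (expR h - 1) * rc k)).
  by rewrite /polar /cis !rmorphB rmorph1; ring.
apply: (le_trans (cmodD _ _)); apply: (@le_trans _ _ (u * `|h| + (2 * (u * `|k|) + (2 * (u * `|k|) + u * `|k|)))); last by nra.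
apply: lerD; first by rewrite cmod_real.
apply: (le_trans (cmodD _ _)); apply: lerD.
  by rewrite cmodM !cmod_real ler_pM.
rewrite cmodM cmod_im mul1r (le_trans (cmodD _ _))//.
by rewrite 2!cmodM !cmod_real; apply: lerD; apply: ler_pM.
Qed.

End PolarCoordinates.

Section CircleAverage.
Variable R : realType.
Local Notation C := (cplx R).
Implicit Types (g h : C -> C) (r : R).

(** Mean value over the points of the circle of radius [r] whose arguments are
    the multiples of [2 pi / 2 ^ n]; the circle is the image under [polar] of a
    vertical side of a rectangle. *)
Definition avg (n : nat) r g : C :=
  (rc (pi *+ 2))^-1 * rsum n 0 (pi *+ 2) (fun t => g (rc r * cis t)).

Definition circ_avg r g : C := ulim (fun n => avg n r g).

Definition circ_bounded r g := exists M : R, forall z, cmod z = r -> cmod (g z) <= M.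

Let twopi_gt0 : 0 < pi *+ 2 :> R.
Proof. by rewrite mulrn_wgt0// pi_gt0. Qed.

Let twopi_neq0 : rc (pi *+ 2) != 0 :> C.
Proof. by rewrite -cmod_gt0 cmod_real ger0_norm// ltW. Qed.

Lemma cmod_circle r t : 0 <= r -> cmod (rc r * cis t) = r.
Proof. by move=> r0; rewrite cmodM cmod_cis mulr1 cmod_real ger0_norm. Qed.

Lemma avg_le_on n r g (M : R) :
  (forall t, 0 <= t <= pi *+ 2 -> cmod (g (rc r * cis t)) <= M) ->
  cmod (avg n r g) <= M.
Proof.
move=> gM; rewrite /avg cmodM cmodV cmod_real (ger0_norm (ltW twopi_gt0)).
rewrite ler_pdivrMl//; apply: rsum_le; first exact: ltW.
by move=> t; rewrite add0r; exact: gM.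
Qed.

Lemma avg_le n r g (M : R) : 0 <= r ->
  (forall z, cmod z = r -> cmod (g z) <= M) -> cmod (avg n r g) <= M.
Proof. by move=> r0 gM; apply: avg_le_on => t _; rewrite gM// cmod_circle. Qed.

Lemma avg_bounded r g : 0 <= r -> circ_bounded r g ->
  ubounded (fun n => avg n r g).
Proof. by move=> r0 [M gM]; exists M => n; exact: avg_le. Qed.

Lemma circ_avg_le r g (M : R) : 0 <= r ->
  (forall z, cmod z = r -> cmod (g z) <= M) -> cmod (circ_avg r g) <= M.
Proof.
move=> r0 gM; apply: ulim_le; first by apply: avg_bounded => //; exists M.
by apply: nearW => n; exact: avg_le.
Qed.

Lemma avgD n r g h : avg n r (fun z => g z + h z) = avg n r g + avg n r h.
Proof. by rewrite /avg /rsum -mulrDr -mulrDr big_split. Qed.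

Lemma avgZ n r c g : avg n r (fun z => c * g z) = c * avg n r g.
Proof. by rewrite /avg /rsum -mulr_sumr; ring. Qed.

Lemma avgB n r g h : avg n r (fun z => g z - h z) = avg n r g - avg n r h.
Proof. by rewrite /avg rsumB mulrBr. Qed.

Lemma avg_cst n r c : avg n r (fun=> c) = c.
Proof. by rewrite /avg rsum_const mulKf. Qed.

Lemma circ_avgD r g h : 0 <= r -> circ_bounded r g -> circ_bounded r h ->
  circ_avg r (fun z => g z + h z) = circ_avg r g + circ_avg r h.
Proof.
move=> r0 bg bh; rewrite /circ_avg -ulimD; try exact: avg_bounded.
by congr ulim; apply/funext => n; rewrite avgD.
Qed.

Lemma circ_avgB r g h : 0 <= r -> circ_bounded r g -> circ_bounded r h ->
  circ_avg r (fun z => g z - h z) = circ_avg r g - circ_avg r h.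
Proof.
move=> r0 bg bh; rewrite /circ_avg -ulimB; try exact: avg_bounded.
by congr ulim; apply/funext => n; rewrite avgB.
Qed.

Lemma circ_avgZ r c g : 0 <= r -> circ_bounded r g ->
  circ_avg r (fun z => c * g z) = c * circ_avg r g.
Proof.
move=> r0 bg; rewrite /circ_avg -ulimZ; last exact: avg_bounded.
by congr ulim; apply/funext => n; rewrite avgZ.
Qed.

Lemma circ_avg_cst r c : circ_avg r (fun=> c) = c.
Proof.
rewrite /circ_avg (_ : (fun _ => _) = fun=> c) ?ulim_cst//.
by apply/funext => n; rewrite avg_cst.
Qed.

Lemma eq_circ_avg r g h : 0 <= r -> (forall z, cmod z = r -> g z = h z) ->
  circ_avg r g = circ_avg r h.
Proof.
move=> r0 gh; rewrite /circ_avg; congr ulim; apply/funext => n.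
rewrite /avg /rsum; congr (_ * (_ * _)); apply: eq_bigr => k _.
by rewrite gh// cmod_circle.
Qed.

(** In logarithmic coordinates an annulus is a rectangle whose horizontal sides
    carry the same values by periodicity; its vertical sides are the averages. *)
Lemma circ_avg_radius g r1 r2 : 0 < r1 -> r1 < r2 ->
  (forall z, r1 <= cmod z <= r2 -> derivable g z 1) ->
  circ_bounded r1 g -> circ_bounded r2 g -> circ_avg r1 g = circ_avg r2 g.
Proof.
move=> r1_gt0 r12 dg b1 b2.
have r2_gt0 : 0 < r2 by exact: lt_trans r12.
pose x0 := ln r1; pose X := ln r2 - ln r1.
have X0 : 0 < X by rewrite subr_gt0 ltr_ln.
have x0X : x0 + X = ln r2 by rewrite /x0 /X addrC subrK.
pose G x y := g (polar x y).
have e0 : expR x0 = r1 by rewrite lnK.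
have eX : expR (x0 + X) = r2 by rewrite x0X lnK.
have bs n : bsum G n x0 0 X (pi *+ 2) =
    im R * rc (pi *+ 2) * (avg n r2 g - avg n r1 g).
  rewrite /bsum add0r; have -> : G^~ (pi *+ 2) = G^~ 0.
    by apply/funext => x; rewrite /G /polar cis_period cis0.
  by rewrite subrr add0r /avg /G /polar e0 eX -[in RHS]mulrBr -mulrA mulVKf.
apply: ulim_eq; [exact: (avg_bounded (ltW r1_gt0) b1)|
  exact: (avg_bounded (ltW r2_gt0) b2)|].
move=> e e_gt0.
have := @goursat R G x0 0 X (pi *+ 2) X0 twopi_gt0 _ (e * (pi *+ 2)) (mulr_gt0 e_gt0 twopi_gt0).
move=> /(_ _)/wrap[|]; last first.
  apply: filterS => n; rewrite bs 2!cmodM cmod_im mul1r cmod_real.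
  by rewrite (ger0_norm (ltW twopi_gt0)) mulrC (ler_pM2r twopi_gt0) cmodBC.
move=> s t hs _; rewrite x0X in hs.
have zin : r1 <= cmod (polar s t) <= r2.
  rewrite cmod_polar -e0 -eX !ler_expR x0X; exact: hs.
have [l lP] := derivable_near_cplx (dg _ zin).
exists (l * polar s t) => eta eta0.
pose rho := expR s; have rho0 : 0 < rho := expR_gt0 s.
pose e1 := Num.min 1 (eta / (2 * rho * (cmod l + 1))).
have cl : 0 < cmod l + 1 by rewrite ltr_wpDl ?cmod_ge0.
have e1_gt0 : 0 < e1.
  by rewrite lt_min ltr01 divr_gt0// !mulr_gt0.
pose e2 := eta / (4 * rho).
have e2_gt0 : 0 < e2 by rewrite divr_gt0// mulr_gt0.
have [d1 d1_gt0 dP1] := polar_near0 e1_gt0.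
have [d2 d2_gt0 dP2] := lP _ e2_gt0.
exists (Num.min d1 (d2 / (8 * rho))).
  by rewrite lt_min d1_gt0 divr_gt0// mulr_gt0.
move=> s' t' _ _; rewrite !lt_min => /andP[sd1 sd2] /andP[td1 td2].
have := dP1 _ _ sd1 td1; set h := s' - s; set k := t' - t.
set w := rc h + im R * rc k; set q := polar h k - 1 => qw.
have hk0 : 0 <= `|h| + `|k| by rewrite addr_ge0.
have w_le : cmod w <= `|h| + `|k|.
  by rewrite (le_trans (cmodD _ _))// cmodM cmod_im mul1r !cmod_real.
have e1_le1 : e1 <= 1 by rewrite ge_min lexx.
have q_le : cmod q <= 2 * (`|h| + `|k|).
  rewrite -(subrK w q) (le_trans (cmodD _ _))//.
  by have := ler_wpM2r hk0 e1_le1; lra.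
have pE : polar s' t' - polar s t = polar s t * q.
  by rewrite /q mulrBr mulr1 -polarD /h /k !(addrC _ (_ - _)) !subrK.
have pmod : cmod (polar s' t' - polar s t) = rho * cmod q.
  by rewrite pE cmodM cmod_polar.
have small : cmod (polar s' t' - polar s t) < d2.
  rewrite pmod (le_lt_trans (ler_wpM2l (ltW rho0) q_le))//.
  have : `|h| + `|k| < d2 / (8 * rho) + d2 / (8 * rho) by exact: ltrD.
  move=> hk; have : rho * (`|h| + `|k|) < rho * (d2 / (8 * rho) + d2 / (8 * rho)).
    by rewrite ltr_pM2l.
  have -> : rho * (d2 / (8 * rho) + d2 / (8 * rho)) = d2 / 4.
    by field; rewrite gt_eqF.
  lra.
have := dP2 _ small; rewrite pmod pE => gq.
have -> : G s' t' - G s t - l * polar s t * w =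
    (g (polar s' t') - g (polar s t) - l * (polar s t * q)) +
    l * polar s t * (q - w) by rewrite /G; ring.
apply: (le_trans (cmodD _ _)).
have A : e2 * (rho * cmod q) <= eta / 2 * (`|h| + `|k|).
  apply: (@le_trans _ _ (e2 * (rho * (2 * (`|h| + `|k|))))).
    by rewrite (ler_wpM2l (ltW e2_gt0))// (ler_wpM2l (ltW rho0)).
  rewrite le_eqVlt; apply/orP; left; apply/eqP; rewrite /e2.
  by field; rewrite gt_eqF.
have B : cmod (l * polar s t * (q - w)) <= eta / 2 * (`|h| + `|k|).
  rewrite 2!cmodM cmod_polar -/rho.
  apply: (@le_trans _ _ ((cmod l + 1) * rho * (e1 * (`|h| + `|k|)))).
    rewrite ler_pM ?mulr_ge0 ?cmod_ge0 ?(ltW rho0)//.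
    by rewrite ler_wpM2r ?(ltW rho0)// lerDl.
  rewrite mulrA ler_wpM2r//.
  have : e1 <= eta / (2 * rho * (cmod l + 1)) by rewrite ge_min lexx orbT.
  rewrite ler_pdivlMr ?mulr_gt0//; lra.
by have := le_trans gq A; lra.
Qed.

End CircleAverage.

(** * The Cauchy formula in one variable *)

Section CauchyFormula.
Variable R : realType.
Local Notation C := (cplx R).
Implicit Types (g h : C -> C) (r : R).

(** Heine-Cantor on a circle, comparing with nearby concentric circles. *)
Lemma circle_uniform g r (e : R) : 0 < r -> 0 < e ->
  (forall z, cmod z = r -> forall e : R, 0 < e -> exists2 d : R, 0 < d &
     forall z', cmod (z' - z) < d -> cmod (g z' - g z) <= e) ->
  exists2 d : R, 0 < d & forall r', `|r' - r| < d ->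
    forall t, 0 <= t <= pi *+ 2 ->
    cmod (g (rc r' * cis t) - g (rc r * cis t)) <= e.
Proof.
move=> r0 e0 cg.
have K : near_covering `[0, pi *+ 2 : R].
  by apply/compact_near_coveringP; exact: segment_compact.
pose P (r' t : R) : Prop := cmod (g (rc r' * cis t) - g (rc r * cis t)) <= e.
have : \near r, `[0, pi *+ 2] `<=` P r.
  apply: (K R (nbhs r) P) => t _.
  have [||d d0 dP] := cg (rc r * cis t) _ (e / 2); rewrite ?divr_gt0//.
    by rewrite cmod_circle// ltW.
  have d4 : 0 < d / 4 by rewrite divr_gt0.
  have d4r : 0 < d / (4 * r) by rewrite divr_gt0// mulr_gt0.
  have ct : \forall t' \near t, `|cos t - cos t'| < d / (4 * r).
    by have /cvgrPdist_lt /(_ _ d4r) := @continuous_cos R t.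
  have st : \forall t' \near t, `|sin t - sin t'| < d / (4 * r).
    by have /cvgrPdist_lt /(_ _ d4r) := @continuous_sin R t.
  have rr : \forall r' \near r, `|r - r'| < d / 4.
    have : (fun x : R => x) x @[x --> r] --> r by exact: cvg_id.
    by move/cvgrPdist_lt => /(_ _ d4).
  have tt : \forall t' \near t, `|cos t - cos t'| < d / (4 * r) /\
     `|sin t - sin t'| < d / (4 * r) by near do split.
  exists ([set t' | `|cos t - cos t'| < d / (4 * r) /\
     `|sin t - sin t'| < d / (4 * r)], [set r' | `|r - r'| < d / 4]) => //=.
  move=> [t' r'] /= [[c1 s1] r1].
  have D1 : cmod (rc r * cis t' - rc r * cis t) < d / 2.
    rewrite -mulrBr cmodM cmod_real ger0_norm ?(ltW r0)// mulrC -ltr_pdivlMr//.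
    have -> : cis t' - cis t = rc (cos t' - cos t) + im R * rc (sin t' - sin t).
      by rewrite /cis !rcB; ring.
    apply: (le_lt_trans (cmodD _ _)); rewrite cmodM cmod_im mul1r !cmod_real.
    rewrite distrC (distrC (sin t')).
    have -> : d / 2 / r = d / (4 * r) + d / (4 * r) by field; rewrite gt_eqF.
    exact: ltrD.
  have D2 : cmod (rc r' * cis t' - rc r * cis t) < d.
    have -> : rc r' * cis t' - rc r * cis t =
      rc (r' - r) * cis t' + (rc r * cis t' - rc r * cis t) by rewrite rcB; ring.
    apply: (le_lt_trans (cmodD _ _)); rewrite cmodM cmod_cis mulr1 cmod_real distrC.
    lra.
  have A1 := dP _ D2; have A2 : cmod (rc r * cis t' - rc r * cis t) < d by lra.
  rewrite /P (le_trans (cmod_triangle (g (rc r * cis t)) _ _))//.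
  by have := dP _ A2; rewrite cmodBC; lra.
move=> /nbhs_normP[d d0 dP]; exists d => // r' r'd t ht.
have r'd' : ball_ Num.norm r d r' by rewrite /ball_ /= distrC.
have := dP r' r'd' t; rewrite /P; apply.
by rewrite /= in_itv.
Unshelve. all: by end_near.
Qed.

Lemma inv_shift_derivable (x z : C) : z != x -> derivable (fun w => (w - x)^-1) z 1.
Proof.
move=> zx; apply: derivableV; first by rewrite subr_eq0.
by apply: derivableB; [exact: derivable_id|exact: derivable_cst].
Qed.

(** One has [z / (z - x) = 1 + x / (z - x)], and the average of [(z - x)^-1] does
    not depend on the radius, which can be taken large. *)
Lemma circ_avg_kernel r (x : C) : cmod x < r ->
  circ_avg r (fun z => z / (z - x)) = 1.
Proof.
move=> xr; have r0 : 0 < r by exact: le_lt_trans (cmod_ge0 x) xr.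
have inv_le s z : cmod x < s -> cmod z = s -> cmod (z - x)^-1 <= (s - cmod x)^-1.
  move=> xs zs; rewrite cmodV lef_pV2 ?posrE ?subr_gt0//.
    by rewrite -zs cmod_lb.
  by rewrite (lt_le_trans _ (cmod_lb _ _))// zs subr_gt0.
have bK s : cmod x < s -> circ_bounded s (fun z => (z - x)^-1).
  by move=> xs; exists (s - cmod x)^-1 => z; exact: inv_le.
have zero : circ_avg r (fun z => (z - x)^-1) = 0.
  apply/eqP; rewrite -cmod_eq0 eq_le cmod_ge0 andbT.
  apply/ler_addgt0Pr => e e0; rewrite add0r.
  pose s := r + e^-1.
  have rs : r < s by rewrite ltrDl invr_gt0.
  rewrite (@circ_avg_radius _ _ _ s)//; [| |exact: bK|exact/bK/(lt_trans xr)].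
    apply: (@le_trans _ _ (s - cmod x)^-1).
      apply: circ_avg_le; first exact/ltW/(lt_trans r0).
      by move=> z; apply: inv_le; exact: lt_trans rs.
    rewrite -[leRHS]invrK lef_pV2 ?posrE ?invr_gt0 ?subr_gt0//.
      by rewrite /s; lra.
    exact: lt_trans rs.
  move=> z /andP[rz _]; apply: inv_shift_derivable; apply/eqP => zx.
  by move: rz; rewrite zx leNgt xr.
rewrite (@eq_circ_avg _ _ _ (fun z => 1 + x * (z - x)^-1)) ?(ltW r0)//; last first.
  move=> z zr; have : z - x != 0.
    by apply/eqP => /eqP; rewrite subr_eq0 => /eqP zx; move: xr; rewrite -zx zr ltxx.
  by move=> zx; field.
rewrite circ_avgD ?(ltW r0)//; last 2 first.
- by exists 1 => z _; rewrite cmod1.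
- have [M bM] := bK _ xr; exists (cmod x * M) => z zr.
  by rewrite cmodM ler_wpM2l ?cmod_ge0// bM.
by rewrite circ_avg_cst circ_avgZ ?(ltW r0)//; [rewrite zero mulr0 addr0|exact: bK].
Qed.

(** The integrand [z * (f z - f x) / (z - x)] is holomorphic off [x] and
    continuous at [x], so its circular averages do not see [x]; they tend to
    zero with the radius. *)
Lemma circ_avg_difference_quotient (f : C -> C) (rho M r : R) x :
  (forall z, cmod z < rho -> derivable f z 1) ->
  (forall z, cmod z < rho -> cmod (f z) <= M) -> r < rho -> cmod x < r ->
  circ_avg r (fun z => z * ((f z - f x) * (z - x)^-1)) = 0.
Proof.
move=> df fM rrho xr; have r0 : 0 < r by exact: le_lt_trans (cmod_ge0 x) xr.
have xrho : cmod x < rho by exact: lt_trans rrho.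
have M0 : 0 <= M by rewrite (le_trans (cmod_ge0 _) (fM _ xrho)).
set g := fun z => _.
have dg z : cmod z < rho -> z != x -> derivable g z 1.
  move=> zr zx; apply: derivableM; first exact: derivable_id.
  apply: derivableM; last exact: inv_shift_derivable.
  by apply: derivableB; [exact: df|exact: derivable_cst].
have g_le s z : cmod z = s -> s < rho -> s != cmod x ->
    cmod (g z) <= s * (2 * M * `|s - cmod x|^-1).
  move=> zs srho sx; rewrite 2!cmodM zs ler_wpM2l -?zs ?cmod_ge0//.
  rewrite ler_pM ?cmod_ge0//.
    by rewrite (le_trans (cmodB _ _))// (_ : 2 * M = M + M); [rewrite lerD// fM// zs|ring].
  rewrite cmodV lef_pV2 ?posrE ?normr_gt0 ?subr_eq0 ?zs//.
    rewrite ler_norml -zs cmod_lb andbT lerNl opprB cmodBC; exact: cmod_lb.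
  rewrite cmod_gt0 subr_eq0; apply: contra_neq sx => zx; by rewrite -zs zx.
have bg s : s < rho -> s != cmod x -> circ_bounded s g.
  by move=> s1 s2; exists (s * (2 * M * `|s - cmod x|^-1)) => z zs; exact: g_le zs s1 s2.
apply/eqP; rewrite -cmod_eq0 eq_le cmod_ge0 andbT.
apply/ler_addgt0Pr => e e0; rewrite add0r.
have [x0|x0] := eqVneq x 0.
  have [d d0 dP] := derivable_cts (df _ xrho) e0.
  pose s := Num.min (r / 2) (d / 2).
  have s0 : 0 < s by rewrite lt_min !divr_gt0.
  have sr : s < r by rewrite gt_min ltr_pdivrMr// mulr2n mulrDr mulr1 ltrDl r0.
  have sd : s < d by rewrite gt_min orbC ltr_pdivrMr// mulr2n mulrDr mulr1 ltrDl d0.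
  have ne0 t : 0 < t -> t != cmod x by move=> t0; rewrite x0 cmod0 gt_eqF.
  rewrite -(@circ_avg_radius _ _ s r)//.
  - apply: circ_avg_le; rewrite ?(ltW s0)// => z zs.
    have z0 : z != 0 by rewrite -cmod_gt0 zs.
    rewrite /g x0 subr0 mulrCA mulfV// mulr1 -{1}x0.
    by rewrite dP// x0 subr0 zs.
  - move=> z /andP[sz zr]; apply: dg; first exact: le_lt_trans rrho.
    by rewrite x0 -cmod_gt0 (lt_le_trans s0).
  - by apply: bg; [exact: lt_trans rrho|exact: ne0].
  - by apply: bg => //; exact: ne0.
have cx0 : 0 < cmod x by rewrite cmod_gt0.
have inner s : 0 < s -> s < cmod x -> circ_avg s g = 0.
  move=> s0 sx; apply/eqP; rewrite -cmod_eq0 eq_le cmod_ge0 andbT.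
  apply/ler_addgt0Pr => u u0; rewrite add0r.
  pose B := 2 * M * (cmod x - s)^-1 + 1.
  have B0 : 0 < B by rewrite ltr_wpDl// mulr_ge0 ?mulr_ge0// invr_ge0 subr_ge0 ltW.
  pose s' := Num.min (s / 2) (u / B).
  have s'0 : 0 < s' by rewrite lt_min !divr_gt0.
  have s's : s' < s by rewrite gt_min ltr_pdivrMr// mulr2n mulrDr mulr1 ltrDl s0.
  have s'x := lt_trans s's sx.
  rewrite -(@circ_avg_radius _ _ s' s)//.
  - apply: circ_avg_le; rewrite ?(ltW s'0)// => z zs.
    apply: (le_trans (g_le _ _ zs (lt_trans s'x xrho) _)); first by rewrite lt_eqF.
    apply: (@le_trans _ _ (s' * B)).
      rewrite ler_wpM2l ?(ltW s'0)// /B ler_wpDr// ler_wpM2l ?mulr_ge0//.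
      rewrite ltr0_norm ?subr_lt0// opprB lef_pV2 ?posrE ?subr_gt0//.
      by rewrite lerB// ltW.
    by rewrite -ler_pdivlMr// ge_min lexx orbT.
  - move=> z /andP[_ zs]; have zx := le_lt_trans zs sx.
    apply: dg; first exact: lt_trans xrho.
    by apply: contraTneq zx => ->; rewrite ltxx.
  - by apply: bg; [exact: lt_trans xrho|rewrite lt_eqF].
  - by apply: bg; [exact: lt_trans xrho|rewrite lt_eqF].
(* Extended by continuity at [x], the integrand has nearly equal averages on the
   circles just inside and just outside the one through [x]. *)
have [l lP] := derivable_near_cplx (df _ xrho).
pose g' z := if z == x then x * l else g z.
have cg' z : cmod z = cmod x -> forall e : R, 0 < e -> exists2 d : R, 0 < d &
     forall z', cmod (z' - z) < d -> cmod (g' z' - g' z) <= e.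
  move=> zx u u0; have [->{z zx}|znx] := eqVneq z x.
    have u1 : 0 < u / (2 * (cmod x + 1)).
      by rewrite divr_gt0// mulr_gt0// addr_gt0.
    have [d d0 dP] := lP _ u1.
    pose d' := Num.min 1 (Num.min d (u / (2 * (cmod l + 1)))).
    have cl : 0 < cmod l + 1 by rewrite ltr_wpDl ?cmod_ge0.
    exists d'; first by rewrite !lt_min ltr01 d0 divr_gt0// mulr_gt0.
    move=> z; rewrite !lt_min => /and3P[z1 zd zu].
    rewrite /g' eqxx; case: eqVneq => [|zx]; first by rewrite subrr cmod0 ltW.
    have zx' : z - x != 0 by rewrite subr_eq0.
    have -> : g z - x * l = z * ((f z - f x - l * (z - x)) * (z - x)^-1) +
        (z - x) * l by rewrite /g; field.
    rewrite (le_trans (cmodD _ _))// 2!cmodM cmodM cmodV.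
    have czx : 0 < cmod (z - x) by rewrite cmod_gt0.
    have A : cmod (f z - f x - l * (z - x)) / cmod (z - x) <= u / (2 * (cmod x + 1)).
      by rewrite ler_pdivrMr// dP.
    have zle : cmod z <= cmod x + 1.
      by rewrite -(subrK x z) (le_trans (cmodD _ _))// addrC lerD2l ltW.
    have -> : u = (cmod x + 1) * (u / (2 * (cmod x + 1))) + u / (2 * (cmod l + 1)) * (cmod l + 1).
      by field; rewrite !gt_eqF// addr_gt0.
    apply: lerD; first by rewrite ler_pM ?cmod_ge0 ?divr_ge0 ?cmod_ge0.
    by rewrite ler_pM ?cmod_ge0 ?(ltW zu)// lerDl.
  have zrho : cmod z < rho by rewrite zx.
  have [d d0 dP] := derivable_cts (dg _ zrho znx) u0.
  have czx : 0 < cmod (z - x) by rewrite cmod_gt0 subr_eq0.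
  exists (Num.min d (cmod (z - x))); first by rewrite lt_min d0.
  move=> z'; rewrite lt_min => /andP[zd z'x].
  rewrite /g' (negPf znx); case: eqVneq => [z'E|_]; last exact: dP.
  by move: z'x; rewrite z'E cmodBC ltxx.
have e4 : 0 < e / 2 by rewrite divr_gt0.
have [d d0 dP] := circle_uniform cx0 e4 cg'.
pose s1 := Num.max (cmod x / 2) (cmod x - d / 2).
pose s2 := Num.min r (cmod x + d / 2).
have s1_gt0 : 0 < s1 by rewrite lt_max divr_gt0.
have s1x : s1 < cmod x by rewrite gt_max; apply/andP; split; lra.
have xs2 : cmod x < s2 by rewrite lt_min xr ltrDl divr_gt0.
have s2r : s2 <= r by rewrite ge_min lexx.
have s1d : `|s1 - cmod x| < d.
  rewrite ltr0_norm ?subr_lt0// opprB.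
  have : cmod x - d / 2 <= s1 by rewrite le_max lexx orbT.
  lra.
have s2d : `|s2 - cmod x| < d.
  rewrite gtr0_norm ?subr_gt0//.
  have : s2 <= cmod x + d / 2 by rewrite ge_min lexx orbT.
  lra.
have s2_gt0 : 0 < s2 by exact: lt_trans xs2.
have s2rho : s2 < rho by exact: le_lt_trans rrho.
have s1rho : s1 < rho by exact: lt_trans xrho.
have same n s : s != cmod x -> 0 <= s -> avg n s g = avg n s g'.
  move=> sx s0; rewrite /avg /rsum; congr (_ * (_ * _)); apply: eq_bigr => k _.
  rewrite /g'; case: eqVneq => // zx; move: sx.
  by rewrite -zx cmod_circle// eqxx.
have -> : circ_avg r g = circ_avg s2 g.
  move: s2r; rewrite le_eqVlt => /orP[/eqP -> //|s2r].
  rewrite -(@circ_avg_radius _ _ s2 r)//.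
  - move=> z /andP[sz zr]; apply: dg; first exact: le_lt_trans rrho.
    by apply: contraTneq sz => ->; rewrite -ltNge.
  - by apply: bg => //; rewrite gt_eqF.
  - by apply: bg => //; rewrite gt_eqF.
have -> : circ_avg s2 g = circ_avg s2 g - circ_avg s1 g by rewrite (inner s1)// subr0.
rewrite /circ_avg -ulimB; last 2 first.
- by apply: avg_bounded (ltW s2_gt0) (bg _ s2rho _); rewrite gt_eqF.
- by apply: avg_bounded (ltW s1_gt0) (bg _ s1rho _); rewrite lt_eqF.
apply: ulim_le.
  apply: uboundedD.
    by apply: avg_bounded (ltW s2_gt0) (bg _ s2rho _); rewrite gt_eqF.
  by apply/uboundedN/(avg_bounded (ltW s1_gt0) (bg _ s1rho _)); rewrite lt_eqF.
apply: nearW => n; rewrite (same n s2) ?gt_eqF ?(ltW s2_gt0)//.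
rewrite (same n s1) ?lt_eqF ?(ltW s1_gt0)//.
have -> : avg n s2 g' - avg n s1 g' =
   (avg n s2 g' - avg n (cmod x) g') - (avg n s1 g' - avg n (cmod x) g') by ring.
have cmp s : `|s - cmod x| < d -> cmod (avg n s g' - avg n (cmod x) g') <= e / 2.
  move=> sd; have -> : avg n s g' - avg n (cmod x) g' = avg n 1 (fun z =>
      g' (rc s * z) - g' (rc (cmod x) * z)).
    rewrite avgB /avg; congr (_ * _ - _ * _); congr rsum; apply/funext => t;
      by rewrite (_ : rc 1 = 1) ?mul1r//; exact: (rmorph1 (@rc R)).
  apply: avg_le_on => t ht; rewrite (_ : rc 1 = 1) ?mul1r; first exact: dP.
  exact: (rmorph1 (@rc R)).
by rewrite (le_trans (cmodB _ _))//; have := cmp _ s1d; have := cmp _ s2d; lra.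
Qed.

(** Split [f z] into [f x] and [f z - f x]: the first part gives the average of
    the kernel, the second that of a difference quotient. *)
Lemma cauchy_formula (f : C -> C) (rho M r : R) x :
  (forall z, cmod z < rho -> derivable f z 1) ->
  (forall z, cmod z < rho -> cmod (f z) <= M) -> r < rho -> cmod x < r ->
  circ_avg r (fun z => f z * (z / (z - x))) = f x.
Proof.
move=> df fM rrho xr; have r0 : 0 < r by exact: le_lt_trans (cmod_ge0 x) xr.
have Kle z : cmod z = r -> cmod (z / (z - x)) <= r * (r - cmod x)^-1.
  move=> zr; rewrite cmodM zr ler_wpM2l ?(ltW r0)// cmodV.
  rewrite lef_pV2 ?posrE ?subr_gt0//; first by rewrite -zr cmod_lb.
  by rewrite (lt_le_trans _ (cmod_lb _ _))// zr subr_gt0.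
have bK : circ_bounded r (fun z => z / (z - x)) by eexists; exact: Kle.
have bfK : circ_bounded r (fun z => f z * (z / (z - x))).
  exists (M * (r * (r - cmod x)^-1)) => z zr.
  by rewrite cmodM ler_pM ?cmod_ge0 ?Kle// fM// zr.
have bxK : circ_bounded r (fun z => f x * (z / (z - x))).
  exists (cmod (f x) * (r * (r - cmod x)^-1)) => z zr.
  by rewrite cmodM ler_wpM2l ?cmod_ge0// Kle.
have := circ_avg_difference_quotient df fM rrho xr.
rewrite (@eq_circ_avg _ _ _ (fun z => f z * (z / (z - x)) - f x * (z / (z - x))))
  ?(ltW r0)//; last by move=> z _; ring.
rewrite circ_avgB ?(ltW r0)// circ_avgZ ?(ltW r0)// circ_avg_kernel// mulr1.
by move/eqP; rewrite subr_eq0 => /eqP.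
Qed.

End CauchyFormula.

(** * Second-order expansions of monomials *)

Section ProductExpansion.
Variable R : realType.
Local Notation C := (cplx R).

(** By induction on the number of factors: in the expanded product, every term
    beyond first order contains two small factors.  [P] majorises the values and
    the derivatives. *)
Lemma prod_second_order (I : eqType) (l : seq I) (A B D h : I -> C) (P : I -> R)
    (eta : R) : uniq l -> 0 <= eta -> eta <= 1 ->
  (forall i, cmod (h i) <= eta) -> (forall i, cmod (B i) <= P i) ->
  (forall i, cmod (D i) <= P i) ->
  (forall i, cmod (A i - B i - h i * D i) <= eta ^+ 2 * P i) ->
  cmod (\prod_(i <- l) A i - \prod_(i <- l) B i -
        \sum_(i <- l) h i * (D i * \prod_(j <- l | j != i) B j)) <=
    4 ^+ size l * eta ^+ 2 * \prod_(i <- l) P i.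
Proof.
move=> + e0 e1 hh hB hD hA.
pose L s := \sum_(i <- s) h i * (D i * \prod_(j <- s | j != i) B j).
have P0 i : 0 <= P i by exact: le_trans (cmod_ge0 _) (hB i).
have PP0 s : 0 <= \prod_(i <- s) P i by rewrite prodr_ge0.
have p0 (c : R) k : 0 <= c -> 0 <= c ^+ k by move=> ?; rewrite exprn_ge0.
have Ale i : cmod (A i) <= 3 * P i.
  have -> : A i = (A i - B i - h i * D i) + (B i + h i * D i) by ring.
  apply: (le_trans (cmodD _ _)).
  have -> : 3 * P i = P i + (P i + P i) by ring.
  apply: lerD; first by rewrite (le_trans (hA i))// ler_piMl// exprn_ile1.
  apply: (le_trans (cmodD _ _)); rewrite lerD// cmodM -[leRHS]mul1r ler_pM ?cmod_ge0//.
  exact: le_trans (hh i) e1.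
have Bs s : cmod (\prod_(i <- s) B i) <= \prod_(i <- s) P i.
  by rewrite cmod_prod ler_prod// => i _; rewrite cmod_ge0 hB.
have As s : cmod (\prod_(i <- s) A i) <= 3 ^+ size s * \prod_(i <- s) P i.
  elim: s => [|i s IH]; first by rewrite !big_nil cmod1 mulr1.
  rewrite !big_cons cmodM /= exprS mulrACA ler_pM ?cmod_ge0//.
suff : uniq l -> cmod (L l) <= 2 ^+ size l * eta * \prod_(i <- l) P i /\
   cmod (\prod_(i <- l) A i - \prod_(i <- l) B i - L l) <=
    4 ^+ size l * eta ^+ 2 * \prod_(i <- l) P i by move=> H /H[].
elim: l => [_|i s IH /= /andP[is_ us]].
  rewrite /L !big_nil subrr subr0 cmod0.
  by split; rewrite !mulr_ge0// exprn_ge0.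
have [IH1 IH2] := IH us.
have LE : L (i :: s) = h i * (D i * \prod_(j <- s) B j) + B i * L s.
  rewrite /L big_cons big_cons eqxx /=; congr (_ * (_ * _) + _).
    rewrite big_seq_cond [RHS]big_seq; apply: eq_bigl => j.
    by case: (boolP (j \in s)) => //= js; apply: contraNneq is_ => <-.
  rewrite mulr_sumr big_seq [RHS]big_seq; apply: eq_bigr => k ks.
  rewrite big_cons ifT; first by ring.
  by apply: contraNneq is_ => ->.
rewrite !big_cons {}LE; set PA := \prod_(j <- s) A j; set PB := \prod_(j <- s) B j.
have := As s; have := Bs s; rewrite -/PA -/PB.
move: (PP0 s) IH1 IH2; rewrite -/PA -/PB.
set Q := \prod_(j <- s) P j; set Ls := L s => Q0 IH1 IH2 hPB hPA.
set n := size s in IH1 IH2 hPA *.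
have p2 : 1 <= 2 ^+ n :> R by rewrite exprn_ege1// ler1n.
have pe : 0 <= eta * (P i * Q) by rewrite !mulr_ge0.
have pe2 : 0 <= eta ^+ 2 * (P i * Q) by rewrite !mulr_ge0// exprn_ge0.
split.
  apply: (le_trans (cmodD _ _)).
  have -> : 2 ^+ n.+1 * eta * (P i * Q) = 2 ^+ n * (eta * (P i * Q)) +
      P i * (2 ^+ n * eta * Q) by rewrite exprS; ring.
  apply: lerD; last by rewrite cmodM ler_pM ?cmod_ge0.
  rewrite 2!cmodM; apply: (@le_trans _ _ (eta * (P i * Q))); last by rewrite ler_peMl.
  by rewrite ler_pM ?mulr_ge0 ?cmod_ge0// ler_pM ?cmod_ge0.
have -> : A i * PA - B i * PB - (h i * (D i * PB) + B i * Ls) =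
    (A i - B i - h i * D i) * PA + (B i * (PA - PB - Ls) +
    (h i * D i * (PA - PB - Ls) + h i * D i * Ls)) by ring.
have hD2 : cmod (h i * D i) <= eta * P i by rewrite cmodM ler_pM ?cmod_ge0.
have hD1 : cmod (h i * D i) <= P i by rewrite (le_trans hD2)// ler_piMl.
apply: (@le_trans _ _ (3 ^+ n * (eta ^+ 2 * (P i * Q)) + (4 ^+ n * (eta ^+ 2 * (P i * Q)) +
   (4 ^+ n * (eta ^+ 2 * (P i * Q)) + 2 ^+ n * (eta ^+ 2 * (P i * Q)))))); last first.
  rewrite -!mulrDl -[leRHS]mulrA ler_wpM2r// exprS.
  have h24 : 2 ^+ n <= 4 ^+ n :> R by rewrite lerXn2r ?nnegrE// ler_nat.
  have h34 : 3 ^+ n <= 4 ^+ n :> R by rewrite lerXn2r ?nnegrE// ler_nat.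
  lra.
apply: (le_trans (cmodD _ _)); apply: lerD.
  rewrite cmodM (_ : 3 ^+ n * _ = (eta ^+ 2 * P i) * (3 ^+ n * Q)); last by ring.
  by rewrite ler_pM ?cmod_ge0.
apply: (le_trans (cmodD _ _)); apply: lerD.
  rewrite cmodM (_ : 4 ^+ n * _ = P i * (4 ^+ n * eta ^+ 2 * Q)); last by ring.
  by rewrite ler_pM ?cmod_ge0.
apply: (le_trans (cmodD _ _)); apply: lerD; rewrite cmodM.
  rewrite (_ : 4 ^+ n * _ = P i * (4 ^+ n * eta ^+ 2 * Q)); last by ring.
  by rewrite ler_pM ?cmod_ge0.
rewrite (_ : 2 ^+ n * _ = eta * P i * (2 ^+ n * eta * Q)); last by ring.
by rewrite ler_pM ?cmod_ge0.
Qed.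

Lemma pow_second_order (t : R) (z h : C) n : cmod z <= t -> cmod (z + h) <= t ->
  cmod ((z + h) ^+ n - z ^+ n - h * (n%:R * z ^+ n.-1)) <=
    cmod h ^+ 2 * ((n ^_ 2)%:R * t ^+ (n - 2)).
Proof.
move=> zt zht; have t0 : 0 <= t by exact: le_trans (cmod_ge0 z) zt.
elim: n => [|n IH].
  by rewrite !expr0 subrr mul0r mulr0 subr0 cmod0 mul0r mulr0.
have -> : (z + h) ^+ n.+1 - z ^+ n.+1 - h * (n.+1%:R * z ^+ n) =
   (z + h) * ((z + h) ^+ n - z ^+ n - h * (n%:R * z ^+ n.-1)) +
   h ^+ 2 * (n%:R * z ^+ n.-1).
  case: n {IH} => [|n]; first by rewrite /= !expr0 expr1; ring.
  by rewrite /= !exprS -natr1; ring.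
apply: (le_trans (cmodD _ _)); rewrite !cmodM !cmodX cmod_nat.
have zn : cmod z ^+ n.-1 <= t ^+ n.-1 by rewrite lerXn2r// nnegrE cmod_ge0.
have h2 : 0 <= cmod h ^+ 2 by rewrite exprn_ge0 ?cmod_ge0.
apply: (@le_trans _ _ (t * (cmod h ^+ 2 * ((n ^_ 2)%:R * t ^+ (n - 2))) +
   cmod h ^+ 2 * (n%:R * t ^+ n.-1))).
  by apply: lerD; [rewrite ler_pM ?cmod_ge0|rewrite ler_wpM2l// ler_wpM2l].
case: n {IH zn} => [|[|n]]; rewrite ?mul0r ?mulr0 ?addr0 ?add0r//=.
  by rewrite ler_wpM2l// subnn expr0 !mulr1 ler1n.
rewrite !subSS !subn0 /= !ffactnS !ffactn0 /= !muln1 -subr_ge0.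
set u := (X in 0 <= X); have -> : u = cmod h ^+ 2 * (n.+2%:R * t ^+ n.+1).
  by rewrite /u (exprS t n) !natrM; ring.
by apply: mulr_ge0 => //; apply: mulr_ge0 => //; exact: exprn_ge0.
Qed.

(** The [k]-th derivative of the function [z ^+ n]. *)
Definition dpow (k n : nat) (z : C) : C := (n ^_ k)%:R * z ^+ (n - k).

Lemma ffact_bound k n : ((n ^_ k) <= k`! * 2 ^ n)%N.
Proof.
rewrite -bin_ffact mulnC leq_mul2l; apply/orP; right.
have [kn|nk] := leqP k n; last by rewrite bin_small// expn_gt0.
rewrite -[2%N]/(1 + 1)%N expnDn (bigD1 (Ordinal (kn : (k < n.+1)%N)))//=.
by rewrite !exp1n !muln1 leq_addr.
Qed.

Section DpowBounds.
Variable t : R.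
Hypotheses (t_gt0 : 0 < t) (t_le1 : t <= 1).

(** The [k]-th derivatives of all powers are bounded on the disc of radius [t] by
    this constant times a geometric sequence: as [n ^_ k <= k! 2 ^ n],
    differentiation doubles the ratio, whatever [k] is. *)
Definition dpow_const k : R := k`!%:R * (t ^+ k)^-1.

Lemma dpow_aux k n : (n ^_ k)%:R * t ^+ (n - k) <= dpow_const k * (2 * t) ^+ n.
Proof.
have [kn|nk] := leqP k n; last first.
  rewrite ffact_small// mul0r !mulr_ge0 ?invr_ge0 ?exprn_ge0 ?(ltW t_gt0)//.
  by rewrite mulr_ge0// ltW.
have -> : dpow_const k * (2 * t) ^+ n = (k`! * 2 ^ n)%:R * t ^+ (n - k).
  have -> : (2 * t) ^+ n = 2 ^+ n * (t ^+ (n - k) * t ^+ k).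
    by rewrite exprMn -exprD subnK.
  rewrite /dpow_const natrM natrX.
  by field; rewrite expf_neq0 ?gt_eqF.
by rewrite ler_wpM2r ?exprn_ge0 ?(ltW t_gt0)// ler_nat ffact_bound.
Qed.

Lemma dpow_const_le k l : (k <= l)%N -> dpow_const k <= dpow_const l.
Proof.
move=> kl; rewrite /dpow_const ler_pM ?invr_ge0 ?exprn_ge0 ?(ltW t_gt0)//.
  by rewrite ler_nat leq_fact.
rewrite lef_pV2 ?posrE ?exprn_gt0// -(subnK kl) exprD.
by rewrite ler_piMl ?exprn_ge0 ?(ltW t_gt0)// exprn_ile1// ltW.
Qed.

Lemma pow2t_ge0 n : 0 <= (2 * t) ^+ n.
Proof. by rewrite exprn_ge0// mulr_ge0// ltW. Qed.

Lemma dpow_le k l n (z : C) : (k <= l)%N -> cmod z <= t ->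
  cmod (dpow k n z) <= dpow_const l * (2 * t) ^+ n.
Proof.
move=> kl zt; rewrite /dpow cmodM cmod_nat cmodX.
apply: (@le_trans _ _ ((n ^_ k)%:R * t ^+ (n - k))).
  by rewrite ler_wpM2l// lerXn2r// nnegrE ?cmod_ge0 ?(ltW t_gt0).
by rewrite (le_trans (dpow_aux _ _))// ler_wpM2r ?pow2t_ge0// dpow_const_le.
Qed.

Lemma dpow_second_order k n (z h : C) (eta : R) : cmod z <= t -> cmod (z + h) <= t ->
  cmod h <= eta ->
  cmod (dpow k n (z + h) - dpow k n z - h * dpow k.+1 n z) <=
    eta ^+ 2 * (dpow_const k.+2 * (2 * t) ^+ n).
Proof.
move=> zt zht he.
have -> : dpow k n (z + h) - dpow k n z - h * dpow k.+1 n z =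
   (n ^_ k)%:R * ((z + h) ^+ (n - k) - z ^+ (n - k) -
      h * ((n - k)%:R * z ^+ (n - k).-1)).
  by rewrite /dpow ffactnSr natrM subnS; ring.
rewrite cmodM cmod_nat.
apply: (@le_trans _ _ ((n ^_ k)%:R * (cmod h ^+ 2 * (((n - k) ^_ 2)%:R * t ^+ (n - k - 2))))).
  by rewrite ler_wpM2l// pow_second_order.
have -> : (n ^_ k)%:R * (cmod h ^+ 2 * (((n - k) ^_ 2)%:R * t ^+ (n - k - 2))) =
   cmod h ^+ 2 * ((n ^_ k.+2)%:R * t ^+ (n - k.+2)).
  have -> : (n ^_ k.+2 = n ^_ k * (n - k) ^_ 2)%N.
    by rewrite !ffactnSr ffactn0 mul1n subn0 -subnDA addn1 mulnA.
  by rewrite natrM -subnDA addn2; ring.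
rewrite ler_pM ?mulr_ge0 ?exprn_ge0 ?cmod_ge0 ?(ltW t_gt0)//.
  by rewrite lerXn2r// nnegrE ?cmod_ge0// (le_trans (cmod_ge0 h)).
exact: dpow_aux.
Qed.

End DpowBounds.
End ProductExpansion.

(** * Sums of power series *)

Section PowerSeriesSum.
Variables (R : realType) (d : nat).
Local Notation C := (cplx R).
Implicit Types (a : fpseries R d) (k m : mindex d) (x h : 'rV[C]_d).

Definition mbasis (i : 'I_d) : mindex d := [ffun j => nat_of_bool (j == i)].

(** Sums over multi-indices are taken over boxes, which form finite types and
    exhaust all multi-indices. *)
Definition box (N : nat) := {ffun 'I_d -> 'I_N}.

Definition unbox N (b : box N) : mindex d := [ffun i => nat_of_ord (b i)].

Lemma unbox_inj N : injective (@unbox N).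
Proof.
move=> b c /ffunP bc; apply/ffunP => i; apply: val_inj.
by have := bc i; rewrite !ffunE.
Qed.

Lemma unbox_surj N m : (forall i, m i < N)%N -> exists b : box N, unbox b = m.
Proof.
move=> mN; exists [ffun i => Ordinal (mN i)].
by apply/ffunP => i; rewrite !ffunE.
Qed.

Lemma box_geometric N (q : 'I_d -> R) : (forall i, 0 <= q i <= 1 / 2) ->
  \sum_(b : box N) \prod_i q i ^+ b i <= 2 ^+ d.
Proof.
move=> q2.
rewrite -(bigA_distr_bigA (fun i (j : 'I_N) => q i ^+ j)) /=.
apply: (@le_trans _ _ (\prod_(i < d) 2)); last by rewrite prodr_const card_ord.
apply: ler_prod => i _; have /andP[q0 qh] := q2 i.
rewrite sumr_ge0 => [|j _]; last exact: exprn_ge0.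
have q1 : 0 < 1 - q i by lra.
have : (1 - q i) * (\sum_(j < N) q i ^+ j) <= 1.
  have -> : (1 - q i) * (\sum_(j < N) q i ^+ j) = 1 - q i ^+ N.
    by rewrite -opprB mulNr -subrX1 opprB.
  by rewrite lerBlDr lerDl exprn_ge0.
by rewrite mulrC -ler_pdivlMr// => /le_trans; apply; rewrite ler_pdivrMr//; lra.
Qed.

(** The [k]-th partial derivative of the monomial of exponent [m]. *)
Definition dmon k m x : C := \prod_(i <- enum 'I_d) dpow (k i) (m i) (x 0 i).

(** The [k]-th partial derivative of the sum of the series, differentiated term
    by term. *)
Definition psum_deriv a k x : C :=
  ulim (fun N => \sum_(b : box N) a (unbox b) * dmon k (unbox b) x).

Definition psum a := psum_deriv a 0.

Definition coef_bounded (s : R) a := exists M : R, forall m, cmod (a m) * s ^+ mdeg m <= M.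

Definition in_ball (t : R) x := forall i, cmod (x 0 i) <= t.

Section Estimates.
Variables (a : fpseries R d) (s M : R).
Hypotheses (s_gt0 : 0 < s) (aM : forall m, cmod (a m) * s ^+ mdeg m <= M).
Variable t : R.
Hypotheses (t_gt0 : 0 < t) (t_le1 : t <= 1) (ts : 4 * t <= s).

Let M_ge0 : 0 <= M.
Proof. by rewrite (le_trans _ (aM 0))// mulr_ge0 ?cmod_ge0 ?exprn_ge0 ?(ltW s_gt0). Qed.

Lemma box_sum_le N (F : mindex d -> C) (K : 'I_d -> R) (E : R) : 0 <= E ->
  (forall i, 0 <= K i) ->
  (forall m, cmod (F m) <= E * \prod_(i <- enum 'I_d) (K i * (2 * t) ^+ m i)) ->
  cmod (\sum_(b : box N) a (unbox b) * F (unbox b)) <=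
    E * M * \prod_i K i * 2 ^+ d.
Proof.
move=> E0 K0 FK.
apply: (@le_trans _ _ (\sum_(b : box N) E * M * \prod_i K i *
    \prod_i (2 * t / s) ^+ b i)); last first.
  rewrite -mulr_sumr ler_wpM2l//.
    by rewrite mulr_ge0 ?prodr_ge0// mulr_ge0.
  apply: (@box_geometric N (fun=> 2 * t / s)) => i.
  apply/andP; split; first by rewrite divr_ge0 ?(ltW s_gt0)// mulr_ge0// ltW.
  by rewrite ler_pdivrMr//; have := ts; lra.
apply: cmod_sum_le => b _; rewrite cmodM.
have := FK (unbox b); rewrite big_enum big_split /=.
have sn : 0 < s ^+ mdeg (unbox b) by rewrite exprn_gt0.
have : cmod (a (unbox b)) <= M / s ^+ mdeg (unbox b) by rewrite ler_pdivlMr.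
move=> am fm; apply: (le_trans (ler_pM (cmod_ge0 _) (cmod_ge0 _) am fm)).
rewrite le_eqVlt; apply/orP; left; apply/eqP.
have -> : \prod_i (2 * t / s) ^+ b i =
    \prod_i (2 * t) ^+ unbox b i / s ^+ mdeg (unbox b) :> R.
  rewrite /mdeg -prodrXr -prodf_div; apply: eq_bigr => i _.
  by rewrite expr_div_n ffunE.
by field; rewrite gt_eqF.
Qed.

Lemma dmon_le k m x : in_ball t x ->
  cmod (dmon k m x) <= 1 * \prod_(i <- enum 'I_d) (dpow_const t (k i) * (2 * t) ^+ m i).
Proof.
move=> xt; rewrite mul1r /dmon cmod_prod; apply: ler_prod => i _.
by rewrite cmod_ge0 dpow_le.
Qed.

Lemma dpow_const_ge0 n : 0 <= dpow_const t n.
Proof. by rewrite mulr_ge0// invr_ge0 exprn_ge0// ltW. Qed.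

Definition deriv_bound k := 1 * M * \prod_i dpow_const t (k i) * 2 ^+ d.

Lemma psum_partial_le k x N : in_ball t x ->
  cmod (\sum_(b : box N) a (unbox b) * dmon k (unbox b) x) <= deriv_bound k.
Proof.
move=> xt; apply: (@box_sum_le N (fun m => dmon k m x) (fun i => dpow_const t (k i)))
  => // [i|m]; first exact: dpow_const_ge0.
exact: dmon_le.
Qed.

Lemma psum_ubounded k x : in_ball t x ->
  ubounded (fun N => \sum_(b : box N) a (unbox b) * dmon k (unbox b) x).
Proof. by move=> xt; exists (deriv_bound k) => N; exact: psum_partial_le. Qed.

Lemma psum_le k x : in_ball t x -> cmod (psum_deriv a k x) <= deriv_bound k.
Proof.
move=> xt; apply: ulim_le; first exact: psum_ubounded.
by apply: nearW => N; exact: psum_partial_le.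
Qed.

Lemma dmon_basis k m x i : dmon (k + mbasis i) m x =
  dpow (k i).+1 (m i) (x 0 i) * \prod_(j <- enum 'I_d | j != i) dpow (k j) (m j) (x 0 j).
Proof.
rewrite /dmon (bigD1_seq i) ?mem_enum ?enum_uniq//=; congr (_ * _).
  by rewrite !ffunE eqxx; congr dpow; exact: addn1.
by apply: eq_bigr => j ji; rewrite !ffunE (negPf ji) addr0.
Qed.

Definition second_bound k := 4 ^+ d * M * \prod_i dpow_const t (k i).+2 * 2 ^+ d.

(** The second-order expansions of the monomials are summed: their remainders are
    geometrically small, uniformly in the number of terms. *)
Lemma psum_second_order k x h (eta : R) : in_ball t x -> in_ball t (x + h) ->
  0 <= eta -> eta <= 1 -> in_ball eta h ->
  cmod (psum_deriv a k (x + h) - psum_deriv a k x -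
        \sum_(i <- enum 'I_d) h 0 i * psum_deriv a (k + mbasis i) x) <=
    eta ^+ 2 * second_bound k.
Proof.
move=> xt xht e0 e1 he.
have bs i : ubounded (fun N => h 0 i *
    \sum_(b : box N) a (unbox b) * dmon (k + mbasis i) (unbox b) x).
  by apply: uboundedM; [exact: ubounded_cst|exact: psum_ubounded].
have [bsum esum] := @ulim_sum R _ (enum 'I_d) _ (fun i _ => bs i).
have -> : \sum_(i <- enum 'I_d) h 0 i * psum_deriv a (k + mbasis i) x =
    ulim (fun N => \sum_(i <- enum 'I_d) h 0 i *
      \sum_(b : box N) a (unbox b) * dmon (k + mbasis i) (unbox b) x).
  by rewrite esum; apply: eq_bigr => i _; rewrite /psum_deriv -ulimZ//; exact: psum_ubounded.
have b1 := psum_ubounded k xt; have b2 := psum_ubounded k xht.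
have b21 := uboundedD b2 (uboundedN b1).
rewrite /psum_deriv -!ulimB//.
apply: ulim_le; first exact: uboundedD (uboundedN bsum).
apply: nearW => N.
have -> : \sum_(b : box N) a (unbox b) * dmon k (unbox b) (x + h) -
    \sum_(b : box N) a (unbox b) * dmon k (unbox b) x -
    \sum_(i <- enum 'I_d) h 0 i * \sum_(b : box N) a (unbox b) * dmon (k + mbasis i) (unbox b) x =
    \sum_(b : box N) a (unbox b) * (dmon k (unbox b) (x + h) - dmon k (unbox b) x -
      \sum_(i <- enum 'I_d) h 0 i * dmon (k + mbasis i) (unbox b) x).
  rewrite -sumrB; under [X in _ - X]eq_bigr do rewrite mulr_sumr.
  rewrite exchange_big /= -sumrB; apply: eq_bigr => b _.
  rewrite mulrBr mulrBr; congr (_ - _); rewrite mulr_sumr.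
  by apply: eq_bigr => i _; ring.
have -> : eta ^+ 2 * second_bound k =
    (4 ^+ d * eta ^+ 2) * M * \prod_i dpow_const t (k i).+2 * 2 ^+ d.
  by rewrite /second_bound; ring.
apply: (@box_sum_le N (fun m => dmon k m (x + h) - dmon k m x -
      \sum_(i <- enum 'I_d) h 0 i * dmon (k + mbasis i) m x)
  (fun i => dpow_const t (k i).+2)).
- by rewrite mulr_ge0 ?exprn_ge0.
- by move=> i; exact: dpow_const_ge0.
move=> m; have := @prod_second_order R _ (enum 'I_d)
  (fun i => dpow (k i) (m i) ((x + h) 0 i)) (fun i => dpow (k i) (m i) (x 0 i))
  (fun i => dpow (k i).+1 (m i) (x 0 i)) (fun i => h 0 i)
  (fun i => dpow_const t (k i).+2 * (2 * t) ^+ m i) eta.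
rewrite size_enum_ord; under [X in _ - X]eq_bigr do rewrite -dmon_basis.
apply=> // [|i|i|i].
- exact: enum_uniq.
- by apply: dpow_le => //; exact: leq_trans (leqnSn _) (leqnSn _).
- by apply: dpow_le.
- by rewrite mxE; apply: dpow_second_order => //; have := xht i; rewrite mxE.
Qed.

End Estimates.
End PowerSeriesSum.

(** * Differentiability and Taylor series of the sum *)

Lemma linear_continuous_bound (K : numFieldType) (V W : normedModType K)
    (f : {linear V -> W}) (B : K) : B \is Num.real ->
  (forall h, `|f h| <= B * `|h|) -> continuous f.
Proof.
move=> Br fB; apply: bounded_linear_continuous; exists `|B|; split => //.
move=> y By; apply/nbhs_normP; exists 1; first exact: ltr01.
move=> h /=; rewrite sub0r normrN => h1; apply: le_trans (fB h) _.
apply: le_trans (ltW By); apply: (@le_trans _ _ (`|B| * `|h|)).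
  by rewrite ler_wpM2r// real_ler_norm.
by rewrite ler_piMr// ltW.
Qed.

Lemma differentiable_intro (K : numFieldType) (V W : normedModType K)
    (f : V -> W) (df : {linear V -> W}) x : continuous df ->
  (forall e : K, 0 < e -> \forall h \near (0 : V),
     `|f (h + x) - (f x + df h)| <= e * `|h|) ->
  differentiable f x /\ forall v, 'D_v f x = df v.
Proof.
move=> dfc fdf; have o : f \o shift x = cst (f x) + df +o_ 0 id.
  by apply/eqaddoP => e /fdf.
have dE : 'd f x = df :> (V -> W) by exact: diff_unique o.
have fx : differentiable f x by apply/diff_locallyP; rewrite dE.
by split => // v; rewrite deriveE// dE.
Qed.

Section Frechet.
Variables (R : realType) (d : nat).
Local Notation C := (cplx R).
Implicit Types (x h : 'rV[C]_d) (c : 'I_d -> C).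

Definition rnorm h : R := complex.Re `|h|.

Lemma rnormE h : `|h| = rc (rnorm h).
Proof.
have : 0 <= `|h| by []. rewrite /rnorm; case: `|h| => u v.
by rewrite lecE /= => /andP[/eqP -> _].
Qed.

Lemma rnorm_ge0 h : 0 <= rnorm h.
Proof. by rewrite -rc_le rc0 -rnormE. Qed.

Lemma cmod_coord h i : cmod (h 0 i) <= rnorm h.
Proof.
rewrite -rc_le -rnormE -normr_cmod.
rewrite [leRHS]/Num.norm /= mx_normE -[leLHS]nngE num_le.
by apply: (le_bigmax _ (fun ij => `|h ij.1 ij.2|%:nng) (0, i)).
Qed.

Definition lin c h : C := \sum_(i <- enum 'I_d) h 0 i * c i.

Lemma lin_linear c : linear (lin c).
Proof.
move=> a u v; rewrite /lin scaler_sumr -big_split; apply: eq_bigr => i _ /=.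
by rewrite !mxE mulrDl -[a *: _]/(a * _) mulrA.
Qed.

HB.instance Definition _ c :=
  GRing.isLinear.Build C 'rV[C]_d C *:%R (lin c) (lin_linear c).

Lemma lin_continuous c : continuous (lin c).
Proof.
apply: (@linear_continuous_bound _ _ _ (lin c) (rc (\sum_(i <- enum 'I_d) cmod (c i)))).
- by apply/complex_realP; eexists.
- move=> h; rewrite normr_cmod rnormE -rcM rc_le mulr_suml; apply: cmod_sum_le => i _.
  by rewrite cmodM mulrC ler_wpM2l ?cmod_ge0// cmod_coord.
Qed.

Lemma lin_basis c i : lin c (delta_mx 0 i) = c i.
Proof.
rewrite /lin (bigD1_seq i) ?mem_enum ?enum_uniq//= big1 ?addr0.
  by rewrite mxE !eqxx mul1r.
by move=> j ji; rewrite mxE eqxx /= (negPf ji) mul0r.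
Qed.

Lemma frechet (f : 'rV[C]_d -> C) x c (B delta : R) : 0 < delta -> 0 <= B ->
  (forall h, rnorm h <= delta -> cmod (f (x + h) - f x - lin c h) <= B * rnorm h ^+ 2) ->
  differentiable f x /\ forall i, 'D_(delta_mx 0 i) f x = c i.
Proof.
move=> delta0 B0 fB.
have [||df Df] := @differentiable_intro _ _ _ f (lin c) x; first exact: lin_continuous.
  move=> e /gt0_rc[e' e'0 ->].
  pose r := Num.min delta (e' / (B + 1)).
  have r0 : 0 < r by rewrite lt_min delta0 divr_gt0// ltr_wpDl.
  apply/nbhs_normP; exists (rc r); first by rewrite /= -(rc0 R) rc_lt.
  move=> h; rewrite /ball_ /= sub0r normrN rnormE rc_lt lt_min => /andP[h1 h2].
  rewrite opprD addrA normr_cmod -rcM rc_le (addrC h).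
  apply: (le_trans (fB _ (ltW h1))); rewrite expr2 mulrA ler_wpM2r ?rnorm_ge0//.
  rewrite ltr_pdivlMr ?ltr_wpDl// in h2; apply: le_trans (ltW h2).
  by rewrite mulrC ler_wpM2l ?rnorm_ge0// lerDl.
by split => // i; rewrite Df /= lin_basis.
Qed.

Lemma finite_lower_bound (g : 'I_d -> R) : (forall i, 0 < g i) ->
  exists2 r : R, 0 < r & r <= 1 /\ forall i, r <= g i.
Proof.
move=> g0; exists (\big[Num.min/1]_(i < d) g i).
  by elim/big_ind: _ => // u v u0 v0; rewrite lt_min u0.
by split; [exact: bigmin_le_id|move=> i; exact: bigmin_le].
Qed.

Lemma polydiscP (t : R) x : polydisc t x <-> forall i, cmod (x 0 i) < t.
Proof.
by split=> xt i; have := xt i; rewrite normr_cmod -[_%:C%C]/(rc t) rc_lt.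
Qed.

Lemma polydisc_margin (t : R) x : polydisc t x -> exists2 r : R, 0 < r & r <= 1 /\
  forall h, rnorm h <= r -> in_ball t (x + h).
Proof.
move=> /polydiscP xt.
have [|r r0 [r1 rg]] := @finite_lower_bound (fun i => t - cmod (x 0 i)).
  by move=> i; rewrite subr_gt0.
exists r => //; split => // h hr i; rewrite mxE (le_trans (cmodD _ _))//.
by have := cmod_coord h i; have := rg i; lra.
Qed.

Lemma polydisc_near (t : R) x : polydisc t x -> \forall y \near x, polydisc t y.
Proof.
move=> /polydiscP xt; have [|r r0 [r1 rg]] := @finite_lower_bound (fun i => t - cmod (x 0 i)).
  by move=> i; rewrite subr_gt0.
apply/nbhs_normP; exists (rc r); first by rewrite /= -(rc0 R) rc_lt.
move=> y; rewrite /ball_ /= -normrN opprB rnormE rc_lt => yr; apply/polydiscP => i.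
have := cmod_coord (y - x) i; rewrite !mxE => yx.
rewrite -(subrK (x 0 i) (y 0 i)) (le_lt_trans (cmodD _ _))//.
by have := rg i; lra.
Qed.

Lemma eq_mpartial (f g : 'rV[C]_d -> C) (t : R) m :
  (forall x, polydisc t x -> f x = g x) ->
  forall x, polydisc t x -> mpartial m f x = mpartial m g x.
Proof.
move=> fg; rewrite /mpartial; elim: (enum 'I_d) => [|i l IH]; first exact: fg.
rewrite ![foldr _ _ (i :: l)]/=; elim: (m i) => [|e IHe]; first exact: IH.
move=> x xt; rewrite !iterS; apply: near_eq_derive.
by apply: filterS (polydisc_near xt) => y; exact: IHe.
Qed.

Lemma eq_taylor (f g : 'rV[C]_d -> C) (t : R) : 0 < t ->
  (forall x, polydisc t x -> f x = g x) -> taylor f = taylor g.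
Proof.
move=> t0 fg; apply/funext => m; rewrite /taylor (eq_mpartial m fg)//.
by apply/polydiscP => i; rewrite mxE cmod0.
Qed.

End Frechet.

Section TaylorOfSum.
Variables (R : realType) (d : nat).
Local Notation C := (cplx R).
Variables (a : fpseries R d) (s M t : R).
Hypotheses (s_gt0 : 0 < s) (aM : forall m, cmod (a m) * s ^+ mdeg m <= M).
Hypotheses (t_gt0 : 0 < t) (t_le1 : t <= 1) (ts : 4 * t <= s).

Lemma psum_frechet k x : polydisc t x -> differentiable (psum_deriv a k) x /\
  forall i, 'D_(delta_mx 0 i) (psum_deriv a k) x = psum_deriv a (k + mbasis i) x.
Proof.
move=> xt; have [r r0 [r1 rb]] := polydisc_margin xt.
have M0 : 0 <= M.
  by rewrite (le_trans _ (aM 0))// mulr_ge0 ?cmod_ge0 ?exprn_ge0 ?(ltW s_gt0).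
apply: (@frechet _ _ _ _ _ (second_bound M t k) r) => //.
  rewrite /second_bound !mulr_ge0// ?exprn_ge0//.
  by apply: prodr_ge0 => i _; rewrite mulr_ge0// invr_ge0 exprn_ge0// ltW.
move=> h hr; rewrite mulrC; apply: (psum_second_order (s := s)) => //.
- by move=> i; apply/ltW; move/polydiscP : xt.
- exact: rb.
- exact: rnorm_ge0.
- exact: le_trans hr r1.
- by move=> i; exact: cmod_coord.
Qed.

Lemma eq_psum_deriv (k k' : mindex d) x : (forall i, k i = k' i) ->
  psum_deriv a k x = psum_deriv a k' x.
Proof. by move=> kk'; rewrite (_ : k = k')//; apply/ffunP. Qed.

Lemma mpartial_psum m x : polydisc t x -> mpartial m (psum a) x = psum_deriv a m x.
Proof.
rewrite /mpartial /psum.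
suff H l : uniq l -> forall x, polydisc t x ->
    foldr (fun i g => iter (m i) (fun h x => 'D_(delta_mx 0 i) h x) g)
      (psum_deriv a 0) l x =
    psum_deriv a [ffun i => if i \in l then m i else 0%N] x.
  move=> xt; rewrite (H _ (enum_uniq _) _ xt); apply: eq_psum_deriv => i.
  by rewrite ffunE mem_enum.
elim: l => [_ y _|i l IH /= /andP[il ul]] /=.
  by apply: eq_psum_deriv => i; rewrite !ffunE.
have H e y : polydisc t y -> iter e (fun h x => 'D_(delta_mx 0 i) h x)
    (foldr (fun i g => iter (m i) (fun h x => 'D_(delta_mx 0 i) h x) g)
      (psum_deriv a 0) l) y =
    psum_deriv a [ffun j => if j == i then e else if j \in l then m j else 0%N] y.
  elim: e y => [|e IHe] y yt /=.
    rewrite (IH ul _ yt); apply: eq_psum_deriv => j; rewrite !ffunE.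
    by case: eqVneq => // ->; rewrite (negPf il).
  rewrite (@near_eq_derive _ _ _ _ (psum_deriv a
     [ffun j => if j == i then e else if j \in l then m j else 0%N])).
    have [_ ->] := psum_frechet [ffun j => if j == i then e else if j \in l then m j else 0%N] yt.
    apply: eq_psum_deriv => j; rewrite !ffunE.
    by case: eqVneq => _; [exact: addn1|exact: addn0].
  by apply: filterS (polydisc_near yt) => z; exact: IHe.
move=> y yt; rewrite (H _ _ yt); apply: eq_psum_deriv => j; rewrite !ffunE in_cons.
by case: eqVneq => // ->.
Qed.

(** At [0] only the term of exponent [m] contributes to the [m]-th derivative. *)
Lemma psum_deriv_at0 m : psum_deriv a m 0 = \prod_(i < d) (m i)`!%:R * a m.
Proof.
pose v := \prod_(i < d) (m i)`!%:R * a m.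
rewrite -[RHS]ulim_cst; apply: ulim_eq.
- by apply: (psum_ubounded s_gt0 aM t_gt0) => // i; rewrite mxE cmod0 ltW.
- exact: ubounded_cst.
move=> e e0; exists (\max_i m i).+1 => // N /= mN.
have [b bE] : exists b : box d N, unbox b = m.
  by apply: unbox_surj => i; apply: leq_trans mN; exact: leq_bigmax.
rewrite (bigD1 b)//= big1 => [|c cb].
  rewrite bE addr0 (_ : dmon m m 0 = \prod_(i < d) (m i)`!%:R).
    by rewrite mulrC subrr cmod0 ltW.
  rewrite /dmon big_enum; apply: eq_bigr => i _.
  by rewrite /dpow subnn expr0 mulr1 ffactnn.
rewrite (_ : dmon m (unbox c) 0 = 0) ?mulr0//.
have : unbox c != m by apply: contra_neq cb => cm; apply: unbox_inj; rewrite cm bE.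
move=> /eqP/ffunP/existsNP[i /eqP ci]; rewrite /dmon (bigD1_seq i) ?mem_enum ?enum_uniq//=.
rewrite /dpow mxE; have [lt|ge] := ltnP (unbox c i) (m i).
  by rewrite ffact_small// !mul0r.
by rewrite expr0n subn_eq0 leqNgt ltn_neqAle eq_sym ci ge /= mulr0 mul0r.
Qed.

(** The polydisc depends on the ratio [s] of the geometric bound but not on [M]:
    this gives a common polydisc for sequences of series of the same ratio. *)
Lemma taylor_psum : bounded_holomorphic (polydisc t) (psum a) /\ taylor (psum a) = a.
Proof.
split; first split.
- by move=> x xt; have [] := psum_frechet 0 xt.
- exists (rc (deriv_bound M t (0 : mindex d))); split.
    by apply/complex_realP; exists (deriv_bound M t (0 : mindex d)).
  move=> B MB x /polydiscP xt /=; apply: le_trans (ltW MB).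
  rewrite normr_cmod rc_le; apply: (psum_le s_gt0 aM t_gt0) => // i.
  exact/ltW/xt.
apply/funext => m; rewrite /taylor mpartial_psum ?psum_deriv_at0 ?mulKf//.
  by apply/prodf_neq0 => i _; rewrite pnatr_eq0 -lt0n fact_gt0.
by apply/polydiscP => i; rewrite mxE cmod0.
Qed.

End TaylorOfSum.

(** * The Cauchy formula and estimates on polydiscs *)

Section IteratedAverage.
Variables (R : realType) (d : nat) (r : R).
Local Notation C := (cplx R).
Hypothesis r_gt0 : 0 < r.
Implicit Types (x y : 'rV[C]_d) (l : seq 'I_d) (phi psi : 'rV[C]_d -> C).

Definition upd x i (z : C) : 'rV[C]_d := \row_j (if j == i then z else x 0 j).

(** The Cauchy formula in several variables is iterated one variable at a time;
    [x] supplies the coordinates that are not averaged. *)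
Fixpoint iter_avg l phi x : C :=
  if l is i :: l' then circ_avg r (fun z => iter_avg l' phi (upd x i z)) else phi x.

Definition on_torus l x y := (forall j, j \notin l -> y 0 j = x 0 j) /\
  (forall j, j \in l -> cmod (y 0 j) = r).

Definition torus_bounded l x phi :=
  exists M : R, forall y, on_torus l x y -> cmod (phi y) <= M.

Lemma on_torus_cons i l x y z : i \notin l -> cmod z = r ->
  on_torus l (upd x i z) y -> on_torus (i :: l) x y /\ y 0 i = z.
Proof.
move=> il zr [y1 y2]; have yi : y 0 i = z by rewrite y1// mxE eqxx.
split=> //; split=> j; rewrite in_cons.
  by rewrite negb_or => /andP[/negPf ji jl]; rewrite y1// mxE ji.
by case/orP => [/eqP ->|/y2//]; rewrite yi.
Qed.

Lemma iter_avg_le l phi x (M : R) : uniq l ->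
  (forall y, on_torus l x y -> cmod (phi y) <= M) -> cmod (iter_avg l phi x) <= M.
Proof.
elim: l x => [|i l IH] x /= => [_ pM|/andP[il ul] pM]; first by apply: pM; split.
apply: circ_avg_le (ltW r_gt0) _ => z zr; apply: IH => // y yt; apply: pM.
by have [] := on_torus_cons il zr yt.
Qed.

Lemma torus_bounded_cons i l x phi z : i \notin l -> cmod z = r ->
  torus_bounded (i :: l) x phi -> torus_bounded l (upd x i z) phi.
Proof.
move=> il zr [M pM]; exists M => y /(on_torus_cons il zr)[yt _]; exact: pM.
Qed.

Lemma torus_bounded_circ i l x phi : uniq (i :: l) ->
  torus_bounded (i :: l) x phi -> circ_bounded r (fun z => iter_avg l phi (upd x i z)).
Proof.
move=> /= /andP[il ul] [M pM]; exists M => z zr; apply: iter_avg_le => // y yt.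
by apply: pM; have [] := on_torus_cons il zr yt.
Qed.

Lemma eq_iter_avg l phi psi x : uniq l ->
  (forall y, on_torus l x y -> phi y = psi y) -> iter_avg l phi x = iter_avg l psi x.
Proof.
elim: l x => [|i l IH] x /= => [_ pq|/andP[il ul] pq]; first by apply: pq; split.
apply: eq_circ_avg (ltW r_gt0) _ => z zr; apply: IH => // y yt; apply: pq.
by have [] := on_torus_cons il zr yt.
Qed.

Lemma iter_avgD l phi psi x : uniq l -> torus_bounded l x phi ->
  torus_bounded l x psi ->
  iter_avg l (fun y => phi y + psi y) x = iter_avg l phi x + iter_avg l psi x.
Proof.
elim: l x => [//|i l IH] x /= /[dup] uil /andP[il ul] bp bq.
rewrite -circ_avgD ?(ltW r_gt0)//; try exact: torus_bounded_circ.
apply: eq_circ_avg (ltW r_gt0) _ => z zr; apply: IH => //;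
  exact: torus_bounded_cons zr _.
Qed.

Lemma iter_avgZ l c phi x : uniq l -> torus_bounded l x phi ->
  iter_avg l (fun y => c * phi y) x = c * iter_avg l phi x.
Proof.
elim: l x => [//|i l IH] x /= /[dup] uil /andP[il ul] bp.
rewrite -circ_avgZ ?(ltW r_gt0)//; last exact: torus_bounded_circ.
apply: eq_circ_avg (ltW r_gt0) _ => z zr; apply: IH => //.
exact: torus_bounded_cons zr _.
Qed.

Lemma torus_boundedD l x phi psi : torus_bounded l x phi ->
  torus_bounded l x psi -> torus_bounded l x (fun y => phi y + psi y).
Proof.
move=> [M pM] [N qN]; exists (M + N) => y yt.
by rewrite (le_trans (cmodD _ _))// lerD// ?pM ?qN.
Qed.

Lemma torus_boundedM l x phi psi : torus_bounded l x phi ->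
  torus_bounded l x psi -> torus_bounded l x (fun y => phi y * psi y).
Proof.
move=> [M pM] [N qN]; exists (M * N) => y yt.
by rewrite cmodM ler_pM ?cmod_ge0// ?pM ?qN.
Qed.

Lemma torus_bounded_prod (I : eqType) (s : seq I) l x (F : I -> 'rV[C]_d -> C) :
  {in s, forall i, torus_bounded l x (F i)} ->
  torus_bounded l x (fun y => \prod_(i <- s) F i y).
Proof.
elim: s => [|i s IH] Fb; first by exists 1 => y _; rewrite big_nil cmod1.
have [||M FM] := @torus_boundedM l x (F i) (fun y => \prod_(j <- s) F j y).
- by apply: Fb; rewrite mem_head.
- by apply: IH => j js; apply: Fb; rewrite in_cons js orbT.
by exists M => y yt; rewrite big_cons FM.
Qed.

Lemma iter_avg_sum (I : eqType) (s : seq I) l x (F : I -> 'rV[C]_d -> C) :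
  uniq l -> {in s, forall i, torus_bounded l x (F i)} ->
  torus_bounded l x (fun y => \sum_(i <- s) F i y) /\
  iter_avg l (fun y => \sum_(i <- s) F i y) x = \sum_(i <- s) iter_avg l (F i) x.
Proof.
move=> ul; elim: s => [|i s IH] Fb.
  split; first by exists 0 => y _; rewrite big_nil cmod0.
  rewrite (@eq_iter_avg _ _ (fun=> 0 * 0))//; last by move=> y _; rewrite big_nil mul0r.
  by rewrite iter_avgZ ?mul0r ?big_nil//; exists 0 => y _; rewrite cmod0.
have [|b e] := IH; first by move=> j js; apply: Fb; rewrite in_cons js orbT.
have bi : torus_bounded l x (F i) by apply: Fb; rewrite mem_head.
have E y : \sum_(j <- i :: s) F j y = F i y + \sum_(j <- s) F j y by rewrite big_cons.
split; first by have [M FM] := torus_boundedD bi b; exists M => y yt; rewrite E FM.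
by rewrite big_cons -e -iter_avgD//; apply: eq_iter_avg => // y _; rewrite E.
Qed.

Lemma iter_avg_base l phi x x' : (forall j, j \notin l -> x 0 j = x' 0 j) ->
  iter_avg l phi x = iter_avg l phi x'.
Proof.
elim: l x x' => [|i l IH] x x' xx' /=.
  by congr phi; apply/rowP => j; exact: xx'.
apply: eq_circ_avg (ltW r_gt0) _ => z zr; apply: IH => j jl; rewrite !mxE.
by case: eqVneq => // ji; rewrite xx'// in_cons negb_or ji.
Qed.

End IteratedAverage.

Section PolydiscCauchy.
Variables (R : realType) (d : nat).
Local Notation C := (cplx R).
Implicit Types (x y : 'rV[C]_d) (l : seq 'I_d).

Lemma upd_derivable (f : 'rV[C]_d -> C) x i (z : C) :
  differentiable f (upd x i z) -> derivable (fun w => f (upd x i w)) z 1.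
Proof.
move=> /(@diff_derivable _ _ _ _ _ (delta_mx 0 i)); rewrite /derivable.
rewrite [X in cvg (X @ _) -> _](_ : _ = (fun h : C => h^-1 *:
  (((fun w => f (upd x i w)) \o shift z) (h *: 1) - f (upd x i z))))//.
apply/funext => h /=; congr (_ *: (f _ - _)); apply/rowP => j; rewrite !mxE eqxx /=.
case: eqVneq => _; last by rewrite mulr0 add0r.
by rewrite -[h *: 1]/(h * 1).
Qed.

Variables (f : 'rV[C]_d -> C) (rho M r : R).
Hypothesis df : forall x, polydisc rho x -> differentiable f x.
Hypothesis fM : forall x, polydisc rho x -> cmod (f x) <= M.
Hypotheses (r_gt0 : 0 < r) (r_rho : r < rho).

Lemma polydisc_upd x i z : in_ball r x -> cmod z < rho -> polydisc rho (upd x i z).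
Proof.
move=> xr zr; apply/polydiscP => j; rewrite mxE; case: eqVneq => // _.
exact: le_lt_trans r_rho.
Qed.

Lemma kernel_bounded l x (c : 'I_d -> C) i : (cmod (c i) < r) -> i \in l ->
  torus_bounded r l x (fun y => y 0 i / (y 0 i - c i)).
Proof.
move=> ci il; exists (r * (r - cmod (c i))^-1) => w [_ wr].
rewrite cmodM wr// ler_wpM2l ?(ltW r_gt0)// cmodV lef_pV2 ?posrE ?subr_gt0//.
  by rewrite -[X in X - _](wr i il) cmod_lb.
by rewrite (lt_le_trans _ (cmod_lb _ _))// wr// subr_gt0.
Qed.

Lemma torus_in_ball l x y : in_ball r x -> on_torus r l x y -> in_ball r y.
Proof.
move=> xr [y1 y2] i; case: (boolP (i \in l)) => il; first by rewrite y2.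
by rewrite y1.
Qed.

Lemma in_ball_polydisc x : in_ball r x -> polydisc rho x.
Proof. by move=> xr; apply/polydiscP => i; exact: le_lt_trans (xr i) r_rho. Qed.

Lemma f_torus_bounded l x : in_ball r x -> torus_bounded r l x f.
Proof. by move=> xr; exists M => y /(torus_in_ball xr)/in_ball_polydisc/fM. Qed.

Lemma iter_cauchy l x (c : 'I_d -> C) : uniq l -> in_ball r x ->
  (forall i, i \in l -> c i = x 0 i) -> (forall i, i \in l -> cmod (c i) < r) ->
  iter_avg r l (fun y => f y * \prod_(i <- l) (y 0 i / (y 0 i - c i))) x = f x.
Proof.
elim: l x => [|i l IH] x /=; first by move=> _ _ _ _; rewrite big_nil mulr1.
move=> /andP[il ul] xr cx cr.
have ci : c i = x 0 i by rewrite cx// mem_head.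
have ub z : cmod z = r -> in_ball r (upd x i z).
  by move=> zr j; rewrite mxE; case: eqVneq => _ //; rewrite zr.
rewrite (@eq_circ_avg _ _ _ (fun z => f (upd x i z) * (z / (z - c i)))) ?(ltW r_gt0)//.
  rewrite (@cauchy_formula _ (fun z => f (upd x i z)) rho M r (c i))//.
  - congr f; apply/rowP => j; rewrite mxE; case: eqVneq => // ->; exact: ci.
  - move=> z zr; apply: upd_derivable; apply: df; exact: polydisc_upd.
  - by move=> z zr; apply: fM; exact: polydisc_upd.
  - by apply: cr; rewrite mem_head.
move=> z zr.
rewrite (@eq_iter_avg _ _ r r_gt0 _ _ (fun y => z / (z - c i) *
   (f y * \prod_(j <- l) (y 0 j / (y 0 j - c j)))))//; last first.
  move=> y yt; have [_ yi] := on_torus_cons il zr yt.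
  by rewrite big_cons yi; ring.
rewrite iter_avgZ//; last first.
  apply: torus_boundedM; first exact/f_torus_bounded/ub.
  apply: torus_bounded_prod => j jl; apply: kernel_bounded => //.
  by apply: cr; rewrite in_cons jl orbT.
rewrite IH; first by rewrite mulrC.
- by [].
- exact: ub.
- move=> j jl; rewrite mxE cx ?in_cons ?jl ?orbT//.
  by case: eqVneq => // ji; move: il; rewrite -ji jl.
- by move=> j jl; apply: cr; rewrite in_cons jl orbT.
Qed.

Definition cauchy_coef (m : mindex d) : C :=
  iter_avg r (enum 'I_d) (fun y => f y * \prod_(i <- enum 'I_d) (y 0 i)^-1 ^+ m i) 0.

Lemma in_ball0 : in_ball r (0 : 'rV[C]_d).
Proof. by move=> i; rewrite mxE cmod0 ltW. Qed.

Lemma cauchy_coef_le m : cmod (cauchy_coef m) * r ^+ mdeg m <= M.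
Proof.
rewrite -ler_pdivlMr ?exprn_gt0//; apply: iter_avg_le => //; first exact: enum_uniq.
move=> y yt; rewrite cmodM; apply: ler_pM; rewrite ?cmod_ge0//.
  exact/fM/in_ball_polydisc/(torus_in_ball in_ball0 yt).
rewrite cmod_prod big_enum /= /mdeg -prodrXr -prodfV le_eqVlt; apply/orP; left.
apply/eqP; apply: eq_bigr => i _; rewrite cmodX cmodV exprVn.
by have [_ ->] := yt; rewrite ?mem_enum.
Qed.

Lemma prod_difference (I : Type) (s : seq I) (A B : I -> C) (e : R) : 0 <= e ->
  (forall i, cmod (A i) <= 2) -> (forall i, cmod (B i) <= 2) ->
  (forall i, cmod (A i - B i) <= e) ->
  cmod (\prod_(i <- s) A i - \prod_(i <- s) B i) <= 4 ^+ size s * e.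
Proof.
move=> e0 A2 B2 AB.
have Bs u : cmod (\prod_(i <- u) B i) <= 2 ^+ size u.
  elim: u => [|i u IH]; first by rewrite big_nil cmod1.
  by rewrite big_cons cmodM exprS ler_pM ?cmod_ge0.
elim: s => [|i s IH]; first by rewrite !big_nil subrr cmod0 mulr_ge0.
rewrite !big_cons.
have -> : A i * \prod_(j <- s) A j - B i * \prod_(j <- s) B j =
  A i * (\prod_(j <- s) A j - \prod_(j <- s) B j) + (A i - B i) * \prod_(j <- s) B j by ring.
rewrite (le_trans (cmodD _ _))// !cmodM /= exprS.
have h : 2 ^+ size s <= 4 ^+ size s :> R by rewrite lerXn2r ?nnegrE// ler_nat.
have h2 : 0 <= 4 ^+ size s * e by rewrite mulr_ge0// exprn_ge0.
apply: (@le_trans _ _ (2 * (4 ^+ size s * e) + e * 4 ^+ size s)); last first.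
  by rewrite (mulrC e) -mulrA; lra.
apply: lerD; first by rewrite ler_pM ?cmod_ge0.
by rewrite ler_pM ?cmod_ge0// (le_trans (Bs s)).
Qed.

Lemma torus_bounded_X l x i n (c : C) : i \in l ->
  torus_bounded r l x (fun y => (c / y 0 i) ^+ n).
Proof.
move=> il; exists ((cmod c / r) ^+ n) => y [_ yr].
by rewrite cmodX cmodM cmodV yr.
Qed.

(** A sum over a box of a product of powers factors into one-variable sums, here
    partial sums of the geometric series. *)
Lemma cauchy_sum N x : \sum_(b : box d N) cauchy_coef (unbox b) * dmon 0 (unbox b) x =
  iter_avg r (enum 'I_d) (fun y => f y *
    \prod_(i <- enum 'I_d) \sum_(j < N) (x 0 i / y 0 i) ^+ j) 0.
Proof.
have E y : f y * \prod_(i <- enum 'I_d) \sum_(j < N) (x 0 i / y 0 i) ^+ j =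
    \sum_(b <- enum (box d N)) f y * \prod_(i <- enum 'I_d) (x 0 i / y 0 i) ^+ b i.
  rewrite -mulr_sumr big_enum /= (bigA_distr_bigA (fun i (j : 'I_N) => (x 0 i / y 0 i) ^+ j)) /=.
  by rewrite big_enum; under [in RHS]eq_bigr do rewrite big_enum.
rewrite (@eq_iter_avg _ _ r r_gt0 _ _ _ 0 (enum_uniq _) (fun y _ => E y)).
have bb (b : box d N) : torus_bounded r (enum 'I_d) 0
    (fun y => f y * \prod_(i <- enum 'I_d) (x 0 i / y 0 i) ^+ b i).
  apply: torus_boundedM; first exact/f_torus_bounded/in_ball0.
  by apply: torus_bounded_prod => i _; apply: torus_bounded_X; rewrite mem_enum.
have [_ ->] := iter_avg_sum r_gt0 (enum_uniq 'I_d) (fun b (_ : b \in enum (box d N)) => bb b).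
rewrite [RHS]big_enum; apply: eq_bigr => b _; rewrite mulrC /cauchy_coef.
rewrite -iter_avgZ ?enum_uniq//.
  apply: eq_iter_avg => //; first exact: enum_uniq.
  move=> y _; rewrite mulrCA -big_split; congr (_ * _); apply: eq_bigr => i _ /=.
  by rewrite /dpow !ffunE ffactn0 mul1r subn0 exprMn.
apply: torus_boundedM; first exact/f_torus_bounded/in_ball0.
apply: torus_bounded_prod => i _; have il : i \in enum 'I_d by rewrite mem_enum.
have [B hB] := torus_bounded_X 0 (unbox b i) 1 il.
by exists B => y /hB; rewrite mul1r.
Qed.

Lemma geometric_remainder (q : C) N : cmod q <= 1 / 2 ->
  cmod (1 - q)^-1 <= 2 /\ cmod (\sum_(j < N) q ^+ j) <= 2 /\
  cmod ((1 - q)^-1 - \sum_(j < N) q ^+ j) <= 2 * (1 / 2) ^+ N.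
Proof.
move=> q2; have q0 := cmod_ge0 q.
have q1 : 1 / 2 <= cmod (1 - q).
  by have := cmod_lb 1 q; rewrite cmod1; lra.
have nz : 1 - q != 0 by rewrite -cmod_gt0 (lt_le_trans _ q1)// divr_gt0.
have i2 : cmod (1 - q)^-1 <= 2.
  by rewrite cmodV -[leRHS]invrK lef_pV2 ?posrE ?cmod_gt0// -[leLHS]mul1r.
have E : \sum_(j < N) q ^+ j = (1 - q ^+ N) / (1 - q).
  apply: (mulIf nz); rewrite divfK// -opprB mulrN mulrC -[RHS]opprB.
  by rewrite subrX1.
have e : (1 - q)^-1 - \sum_(j < N) q ^+ j = q ^+ N / (1 - q) by rewrite E; ring.
split=> //; split.
  apply: (@le_trans _ _ (\sum_(j < N) (1 / 2) ^+ j)).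
    by apply: cmod_sum_le => j _; rewrite cmodX lerXn2r ?nnegrE ?divr_ge0.
  have -> : \sum_(j < N) (1 / 2) ^+ j = 2 * (1 - (1 / 2) ^+ N) :> R.
    by have := subrX1 (1 / 2 : R) N; lra.
  have h : 0 <= (1 / 2) ^+ N :> R by rewrite exprn_ge0// divr_ge0.
  lra.
rewrite e mulrC cmodM ler_pM ?cmod_ge0// cmodX lerXn2r ?nnegrE ?divr_ge0//.
Qed.

(** The Cauchy kernel is a product of geometric series of ratio at most [1 / 2]. *)
Lemma cauchy_expansion x : in_ball (r / 2) x -> f x = psum cauchy_coef x.
Proof.
move=> x2; have r2 : r / 2 <= r by rewrite ler_pdivrMr//; have := r_gt0; lra.
have r2' : r / 2 < r by rewrite ltr_pdivrMr//; have := r_gt0; lra.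
have xr : in_ball r x by move=> i; exact: le_trans (x2 i) r2.
have M0 : 0 <= M by rewrite (le_trans (cmod_ge0 _) (fM (in_ball_polydisc xr))).
rewrite -[LHS]ulim_cst; apply: ulim_eq; first exact: ubounded_cst.
  exists (M * 2 ^+ d) => N; rewrite cauchy_sum; apply: iter_avg_le; rewrite ?enum_uniq//.
  move=> y yt; rewrite cmodM ler_pM ?cmod_ge0//.
    exact/fM/in_ball_polydisc/(torus_in_ball in_ball0 yt).
  rewrite cmod_prod; apply: (@le_trans _ _ (\prod_(i <- enum 'I_d) 2)); last first.
    by rewrite big_enum prodr_const card_ord.
  apply: ler_prod => i _; rewrite cmod_ge0 /=.
  apply: (@geometric_remainder _ N _).2.1; have [_ yr] := yt.
  rewrite cmodM cmodV yr ?mem_enum// ler_pdivrMr//.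
  by rewrite mulrC mulrA mulr1; exact: x2.
move=> e e0.
have [N0 hN0] : exists N0, forall N, (N0 <= N)%N -> M * (4 ^+ d * (2 * (1 / 2) ^+ N)) <= e.
  have : M * 4 ^+ d * 2 * (1 / 2) ^+ N @[N --> \oo] --> M * 4 ^+ d * 2 * 0.
    apply: cvgM; first exact: cvg_cst.
    by apply: cvg_expr; rewrite ger0_norm ?divr_ge0// ltr_pdivrMr// mul1r ltr1n.
  rewrite mulr0 => /cvgr_le /(_ e e0) [N0 _ hN]; exists N0 => N NN0.
  by have := hN N NN0; rewrite /= !mulrA.
exists N0 => // N /= NN0; apply: le_trans (hN0 N NN0).
rewrite cauchy_sum -(@iter_cauchy (enum 'I_d) x (fun i => x 0 i)) ?enum_uniq//; last first.
  by move=> i _; exact: le_lt_trans (x2 i) r2'.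
rewrite (@iter_avg_base _ _ r r_gt0 _ _ x 0); last by move=> j; rewrite mem_enum.
have b1 : torus_bounded r (enum 'I_d) 0
   (fun y => f y * \prod_(i <- enum 'I_d) (y 0 i / (y 0 i - x 0 i))).
  apply: torus_boundedM; first exact/f_torus_bounded/in_ball0.
  apply: torus_bounded_prod => j jl; apply: (@kernel_bounded _ 0 (fun i => x 0 i) j) => //.
  exact: le_lt_trans (x2 j) r2'.
have b2 : torus_bounded r (enum 'I_d) 0
   (fun y => - 1 * (f y * \prod_(i <- enum 'I_d) \sum_(j < N) (x 0 i / y 0 i) ^+ j)).
  apply: torus_boundedM; first by exists 1 => y _; rewrite cmodN cmod1.
  apply: torus_boundedM; first exact/f_torus_bounded/in_ball0.
  apply: torus_bounded_prod => i il; rewrite /index_enum.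
  have [] := @iter_avg_sum _ _ r r_gt0 _ (index_enum 'I_N) (enum 'I_d) 0
    (fun j y => (x 0 i / y 0 i) ^+ j) (enum_uniq _) => // j _.
  exact: torus_bounded_X.
rewrite -mulN1r -iter_avgZ ?enum_uniq//; last first.
  have [B hB] := b2; exists B => y /hB; by rewrite mulN1r cmodN.
rewrite -iter_avgD ?enum_uniq//; apply: iter_avg_le; rewrite ?enum_uniq// => y yt.
rewrite mulN1r -mulrBr cmodM ler_pM ?cmod_ge0//.
  exact/fM/in_ball_polydisc/(torus_in_ball in_ball0 yt).
rewrite -[X in 4 ^+ X]size_enum_ord.
have [_ yr] := yt.
have y0 i : y 0 i != 0 by rewrite -cmod_gt0 yr ?mem_enum.
have q2 i : cmod (x 0 i / y 0 i) <= 1 / 2.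
  rewrite cmodM cmodV yr ?mem_enum// ler_pdivrMr//.
  by rewrite mulrC mulrA mulr1; exact: x2.
have KE i : y 0 i / (y 0 i - x 0 i) = (1 - x 0 i / y 0 i)^-1.
  by rewrite -[in RHS](mulfV (y0 i)) -mulrBl invf_div.
under [X in X - _]eq_bigr do rewrite KE.
apply: prod_difference => [|i|i|i].
- by rewrite mulr_ge0// exprn_ge0// divr_ge0.
- by have [] := geometric_remainder N (q2 i).
- by have [_ []] := geometric_remainder N (q2 i).
- by have [_ []] := geometric_remainder N (q2 i).
Qed.

End PolydiscCauchy.

Section HolomorphicTaylor.
Variables (R : realType) (d : nat).
Local Notation C := (cplx R).

(** Cauchy estimates: near [0] the function is the sum of a series whose
    coefficients are averages over a torus, and these are its Taylor
    coefficients. *)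
Lemma taylor_coef_bounded (f : 'rV[C]_d -> C) (rho : R) : 0 < rho ->
  bounded_holomorphic (polydisc rho) f -> coef_bounded (rho / 2) (taylor f).
Proof.
move=> rho0 [df [B [Breal fB]]].
have /complex_realP[b Bb] := Breal.
have fM x : polydisc rho x -> cmod (f x) <= b + 1.
  move=> xr; have := fB (rc (b + 1)); rewrite Bb ltcR ltrDl ltr01 => /(_ erefl x xr).
  by rewrite /= normr_cmod rc_le.
have r0 : 0 < rho / 2 by rewrite divr_gt0.
have r1 : rho / 2 < rho by rewrite ltr_pdivrMr//; lra.
pose a := cauchy_coef f (rho / 2).
have aM m : cmod (a m) * (rho / 2) ^+ mdeg m <= b + 1 by exact: (cauchy_coef_le fM r0 r1).
pose t := Num.min 1 (rho / 8).
have t0 : 0 < t by rewrite lt_min ltr01 divr_gt0.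
have t1 : t <= 1 by rewrite ge_min lexx.
have t8 : t <= rho / 8 by rewrite ge_min lexx orbT.
have [_ ta] := taylor_psum r0 aM t0 t1 (ltac:(lra) : 4 * t <= rho / 2).
suff -> : taylor f = a by exists (b + 1).
rewrite -ta; apply: (eq_taylor t0) => x /polydiscP xt.
apply: (cauchy_expansion df fM r0 r1) => i.
by have := xt i; lra.
Qed.

End HolomorphicTaylor.

(** * The ring of formal power series and substitutions *)

Section SeriesRing.
Variables (R : realType) (d : nat).
Local Notation C := (cplx R).
Implicit Types (F G H : fpseries R d) (k l m : mindex d).

Lemma mdegD k l : mdeg (k + l) = (mdeg k + mdeg l)%N.
Proof. by rewrite /mdeg -big_split; apply: eq_bigr => i _; rewrite ffunE. Qed.

Lemma mdeg0 : mdeg (0 : mindex d) = 0%N.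
Proof. by rewrite /mdeg big1// => i _; rewrite ffunE. Qed.

Lemma le_mdeg m i : (m i <= mdeg m)%N.
Proof. by rewrite /mdeg (bigD1 i)//= leq_addr. Qed.

Lemma mindexD k l i : (k + l)%R i = (k i + l i)%N.
Proof. by rewrite ffunE. Qed.

Lemma mindex_addI k l l' : k + l = k + l' -> l = l'.
Proof.
move=> /ffunP kl; apply/ffunP => i; have := kl i; rewrite !ffunE.
exact: addnI.
Qed.

Lemma fsum_box N (g : mindex d -> C) : (forall k, g k != 0 -> forall i, (k i < N)%N) ->
  \sum_(k \in [set: mindex d]) g k = \sum_(b : box d N) g (unbox b).
Proof.
move=> gN; rewrite (@fsbigE _ _ _ _ _ [seq unbox b | b <- enum (box d N)])//.
- rewrite big_map (eq_bigl xpredT) ?big_enum// => b; exact: in_setT.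
- by rewrite map_inj_uniq ?enum_uniq//; exact: unbox_inj.
- move=> k _ kr; apply/eqP; apply: contraNT kr => /gN/unbox_surj[b <-].
  by rewrite map_f// mem_enum.
Qed.

(** The product as a sum over boxes, to which the lemmas on big operators apply. *)
Lemma msmulE N F G m : (forall i, m i < N)%N -> msmul F G m =
  \sum_(b : box d N) \sum_(c : box d N | unbox b + unbox c == m)
    F (unbox b) * G (unbox c).
Proof.
move=> mN; rewrite pair_big_dep /=.
pose q (p : box d N * box d N) := (unbox p.1, unbox p.2).
pose P p := (q p).1 + (q p).2 == m.
rewrite /msmul (@fsbigE _ _ _ _ _ [seq q p | p <- enum {: box d N * box d N} & P p]).
- rewrite big_map big_filter_cond big_enum_cond /=; apply: eq_bigl => p.
  rewrite andbC; apply/andP/idP => [[]//|Pp]; split => //.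
  by apply/mem_set/eqP.
- rewrite map_inj_uniq; first exact/filter_uniq/enum_uniq.
  by move=> [a b] [c e] [/unbox_inj -> /unbox_inj ->].
- by move=> kl /= /mapP[p]; rewrite mem_filter => /andP[/eqP Pp _] ->.
- move=> [k l] /= kl /negP []; apply/mapP.
  have [|b bk] := @unbox_surj d N k.
    by move=> i; apply: leq_ltn_trans (mN i); rewrite -kl mindexD leq_addr.
  have [|c cl] := @unbox_surj d N l.
    by move=> i; apply: leq_ltn_trans (mN i); rewrite -kl mindexD leq_addl.
  exists (b, c); last by rewrite /q /= bk cl.
  by rewrite mem_filter mem_enum andbT /P /q /= bk cl; apply/eqP.
Qed.

Lemma mdeg_bound m i : (m i < (mdeg m).+1)%N.
Proof. by rewrite ltnS le_mdeg. Qed.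

Lemma msmulC : commutative (@msmul R d).
Proof.
move=> F G; apply/funext => m; rewrite !(@msmulE (mdeg m).+1) => [|i|i];
  try exact: mdeg_bound.
under eq_bigr do rewrite big_mkcond; rewrite exchange_big /=.
apply: eq_bigr => b _; rewrite [RHS]big_mkcond; apply: eq_bigr => c _.
by rewrite addrC mulrC.
Qed.

Lemma box_sum_pin N k (X : mindex d -> C) :
  \sum_(e : box d N) (if k == unbox e then X (unbox e) else 0) =
  if [forall i, k i < N]%N then X k else 0.
Proof.
case: ifP => [/forallP/unbox_surj[e0 e0k]|/negP kN].
  rewrite (bigD1 e0)//= e0k eqxx big1 ?addr0// => e ee0.
  by rewrite -e0k (inj_eq (@unbox_inj d N)) eq_sym (negPf ee0).
apply: big1 => e _; case: eqP => // ke; case: kN.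
by apply/forallP => i; rewrite ke ffunE.
Qed.

Lemma msmul3E N F G H m : (forall i, m i < N)%N -> msmul F (msmul G H) m =
  \sum_(b : box d N) \sum_(c : box d N) \sum_(e : box d N)
    if unbox b + (unbox c + unbox e) == m then F (unbox b) * (G (unbox c) * H (unbox e)) else 0.
Proof.
move=> mN; rewrite (msmulE _ _ mN); apply: eq_bigr => b _.
under eq_bigr => f _.
  rewrite (@msmulE N); last by move=> i; rewrite ffunE.
  under eq_bigr do rewrite big_mkcond.
  rewrite mulr_sumr; under eq_bigr do rewrite mulr_sumr.
  over.
rewrite exchange_big /=; apply: eq_bigr => c _.
rewrite exchange_big /=; apply: eq_bigr => e _.
rewrite big_mkcond; transitivity (\sum_(f : box d N)
    if unbox c + unbox e == unbox f then
      (if unbox b + unbox f == m then F (unbox b) * (G (unbox c) * H (unbox e)) else 0)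
    else 0).
  apply: eq_bigr => f _; case: ifP => _; first by case: ifP; rewrite ?mulr0.
  by case: ifP.
rewrite (box_sum_pin _ (unbox c + unbox e) (fun f => if unbox b + f == m then
  F (unbox b) * (G (unbox c) * H (unbox e)) else 0)).
case: ifP => // /negP ce; case: eqP => // bce; case: ce; apply/forallP => i.
by apply: leq_ltn_trans (mN i); rewrite -bce [X in (_ <= X)%N]mindexD leq_addl.
Qed.

Lemma msmulA : associative (@msmul R d).
Proof.
move=> F G H; rewrite [RHS]msmulC; apply/funext => m.
rewrite !(@msmul3E (mdeg m).+1) => [|i|i]; try exact: mdeg_bound.
under eq_bigr do rewrite exchange_big /=.
rewrite exchange_big /=; apply: eq_bigr => e _; apply: eq_bigr => b _.
apply: eq_bigr => c _; rewrite (addrC (unbox e)) -addrA.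
by case: ifP => // _; ring.
Qed.

Definition msdelta k : fpseries R d := fun m => if m == k then 1 else 0.

Lemma msmul_delta k F m : msmul (msdelta k) F (k + m) = F m.
Proof.
pose N := (mdeg (k + m)).+1.
have kmN i : ((k + m)%R i < N)%N by exact: mdeg_bound.
have kN i : (k i < N)%N by apply: leq_ltn_trans (kmN i); rewrite mindexD leq_addr.
have mN i : (m i < N)%N by apply: leq_ltn_trans (kmN i); rewrite mindexD leq_addl.
rewrite (msmulE _ _ kmN); have [b bk] := unbox_surj kN; have [c cm] := unbox_surj mN.
rewrite (bigD1 b)//= [X in _ + X]big1 => [|b' bb']; last first.
  rewrite big1// => c' _; rewrite /msdelta -bk (inj_eq (@unbox_inj _ _)).
  by rewrite (negPf bb') mul0r.
rewrite (bigD1 c) ?bk ?cm ?eqxx//= big1 ?addr0; first by rewrite /msdelta eqxx mul1r.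
move=> c' /andP[/eqP /mindex_addI]; rewrite -cm => /unbox_inj ->; by rewrite eqxx.
Qed.

Lemma msmul_delta_out k F m : (forall m', m <> k + m') -> msmul (msdelta k) F m = 0.
Proof.
move=> mk; rewrite (@msmulE (mdeg m).+1); last by move=> i; exact: mdeg_bound.
apply: big1 => b _; apply: big1 => c /eqP bc; rewrite /msdelta.
by case: eqP => bk; [case: (mk (unbox c)); rewrite -bk bc|rewrite mul0r].
Qed.

Lemma msconst_delta : msconst 1 = msdelta 0.
Proof. by []. Qed.

Lemma msvar_delta i : msvar i = msdelta (mbasis i).
Proof. by []. Qed.

Lemma msmul1 F : msmul (msconst 1) F = F.
Proof. by apply/funext => m; rewrite -[in LHS](add0r m) msmul_delta. Qed.

HB.instance Definition _ := Monoid.isComLaw.Build (fpseries R d) (msconst 1)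
  (@msmul R d) msmulA msmulC msmul1.

Lemma msmulDl F G H m :
  msmul (fun k => F k + G k) H m = msmul F H m + msmul G H m.
Proof.
rewrite !(@msmulE (mdeg m).+1) => [|i|i|i]; try exact: mdeg_bound.
rewrite -big_split; apply: eq_bigr => b _; rewrite -big_split; apply: eq_bigr => c _.
by rewrite mulrDl.
Qed.

Lemma msmulZl (a : C) F H m : msmul (fun k => a * F k) H m = a * msmul F H m.
Proof.
rewrite !(@msmulE (mdeg m).+1) => [|i|i]; try exact: mdeg_bound.
rewrite mulr_sumr; apply: eq_bigr => b _; rewrite mulr_sumr; apply: eq_bigr => c _.
by rewrite mulrA.
Qed.

Lemma msmulZr (a : C) F H m : msmul H (fun k => a * F k) m = a * msmul H F m.
Proof. by rewrite msmulC msmulZl msmulC. Qed.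

Lemma msmulDr F G H m :
  msmul H (fun k => F k + G k) m = msmul H F m + msmul H G m.
Proof. by rewrite msmulC msmulDl !(msmulC H). Qed.

Lemma msmulBr F G H m :
  msmul H (fun k => F k - G k) m = msmul H F m - msmul H G m.
Proof.
rewrite (_ : (fun k => F k - G k) = (fun k => F k + - 1 * G k)).
  by rewrite msmulDr msmulZr mulN1r.
by apply/funext => k; rewrite mulN1r.
Qed.

Lemma msmulBl F G H m :
  msmul (fun k => F k - G k) H m = msmul F H m - msmul G H m.
Proof. by rewrite msmulC msmulBr !(msmulC H). Qed.

Lemma msconst_scale (c : C) F m : msmul (msconst c) F m = c * F m.
Proof.
rewrite (_ : msconst c = fun k => c * msconst 1 k); first by rewrite msmulZl msmul1.
by apply/funext => k; rewrite /msconst; case: ifP; rewrite ?mulr1 ?mulr0.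
Qed.

Lemma msexpD F a b : msexp F (a + b) = msmul (msexp F a) (msexp F b).
Proof.
elim: a => [|a IH]; first by rewrite msmul1.
by rewrite addSn /msexp /= -/(msexp F _) IH msmulA.
Qed.

(** The pull-back of the monomial of exponent [k] under the substitution [b]. *)
Definition mspow (b : 'I_d -> fpseries R d) k : fpseries R d :=
  \big[@msmul R d/msconst 1]_(i < d) msexp (b i) (k i).

Lemma mspowD b k l : mspow b (k + l) = msmul (mspow b k) (mspow b l).
Proof.
rewrite /mspow -big_split; apply: eq_bigr => i _.
by rewrite mindexD msexpD.
Qed.

Lemma mspow0 b : mspow b 0 = msconst 1.
Proof. by rewrite /mspow big1// => i _; rewrite ffunE. Qed.

Lemma mspow_basis b i : mspow b (mbasis i) = b i.
Proof.
rewrite /mspow (bigD1 i)//= big1 => [|j ji].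
  by rewrite ffunE eqxx msmulC msmul1 /msexp /= msmulC msmul1.
by rewrite ffunE (negPf ji).
Qed.

Lemma mindex_ind (T : mindex d -> Prop) : T 0 ->
  (forall k i, T k -> T (mbasis i + k)) -> forall k, T k.
Proof.
move=> T0 TS k; move: {2}(mdeg k) (erefl (mdeg k)) => e.
elim: e k => [|e IH] k kd.
  suff -> : k = 0 by [].
  by apply/ffunP => i; rewrite ffunE; apply/eqP; rewrite -leqn0 -kd le_mdeg.
have [i ki] : exists i, (0 < k i)%N.
  apply/not_existsP => k0; move: kd; rewrite /mdeg big1// => i _.
  by apply/eqP; rewrite -leqn0 leqNgt; apply/negP; exact: k0.
have -> : k = mbasis i + [ffun j => (k j - (j == i))%N].
  apply/ffunP => j; rewrite mindexD !ffunE; case: eqP => [->|_]; last by rewrite subn0.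
  by rewrite subnKC.
apply/TS/IH; move: kd; rewrite /mdeg (bigD1 i)//= [in X in _ -> X](bigD1 i)//=.
rewrite ffunE eqxx subn1 -[k i in X in X -> _](prednK ki) addSn => -[<-].
congr (_ + _)%N; apply: eq_bigr => j ji; by rewrite ffunE (negPf ji) subn0.
Qed.

(** For a substitution of this kind, [mscomp] is computed on finitely many terms
    and is a ring morphism. *)
Definition degree_raising b := forall k v, mspow b k v != 0 -> (mdeg k <= mdeg v)%N.

Section Substitution.
Variable b : 'I_d -> fpseries R d.
Hypothesis braise : degree_raising b.

Lemma mscompE N F v : (mdeg v < N)%N ->
  mscomp F b v = \sum_(p : box d N) F (unbox p) * mspow b (unbox p) v.
Proof.
move=> vN; apply: fsum_box => k; rewrite mulf_eq0 negb_or => /andP[_ /braise kv] i.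
by rewrite (leq_ltn_trans _ vN)// (leq_trans (le_mdeg _ _)).
Qed.

(** Multiplication by a pull-back is a sum of multiplications by pull-backs of
    monomials, hence a bound for the latter gives one for the former. *)
Lemma msmul_comp N F K v : (mdeg v < N)%N -> msmul (mscomp F b) K v =
  \sum_(p : box d N) F (unbox p) * msmul (mspow b (unbox p)) K v.
Proof.
move=> vN.
have vi i : (v i < N)%N by rewrite (leq_ltn_trans _ vN)// le_mdeg.
rewrite (msmulE _ _ vi).
transitivity (\sum_(c : box d N) \sum_(e : box d N | unbox c + unbox e == v)
   \sum_(p : box d N) F (unbox p) * (mspow b (unbox p) (unbox c) * K (unbox e))).
  apply: eq_bigr => c _; apply: eq_bigr => e /eqP ce.
  rewrite (@mscompE N) ?mulr_suml; first by apply: eq_bigr => p _; rewrite mulrA.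
  by rewrite (leq_ltn_trans _ vN)// -ce mdegD leq_addr.
under eq_bigr do rewrite exchange_big /=.
rewrite exchange_big /=; apply: eq_bigr => p _; rewrite (msmulE _ _ vi) mulr_sumr.
by apply: eq_bigr => c _; rewrite mulr_sumr.
Qed.

Lemma mscompM F G : mscomp (msmul F G) b = msmul (mscomp F b) (mscomp G b).
Proof.
apply/funext => v; pose N := (mdeg v).+1; have vN : (mdeg v < N)%N by [].
rewrite (msmul_comp _ _ vN).
transitivity (\sum_(p : box d N) \sum_(q : box d N)
   F (unbox p) * G (unbox q) * mspow b (unbox p + unbox q) v); last first.
  apply: eq_bigr => p _; rewrite msmulC (msmul_comp _ _ vN) mulr_sumr.
  by apply: eq_bigr => q _; rewrite mspowD msmulC mulrA.
rewrite (mscompE _ vN).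
transitivity (\sum_(m : box d N) \sum_(p : box d N) \sum_(q : box d N)
  if unbox p + unbox q == unbox m then
   F (unbox p) * G (unbox q) * mspow b (unbox m) v else 0).
  apply: eq_bigr => m _; rewrite (@msmulE N); last by move=> i; rewrite ffunE.
  rewrite mulr_suml; apply: eq_bigr => p _; rewrite mulr_suml big_mkcond.
  by apply: eq_bigr => q _; case: ifP.
rewrite exchange_big /=; apply: eq_bigr => p _.
rewrite exchange_big /=; apply: eq_bigr => q _.
rewrite (box_sum_pin _ _ (fun m => F (unbox p) * G (unbox q) * mspow b m v)).
case: ifP => // /negP pq; have [->|/braise pqv] := eqVneq (mspow b (unbox p + unbox q) v) 0.
  by rewrite mulr0.
case: pq; apply/forallP => i.
by rewrite (leq_ltn_trans _ vN)// (leq_trans (le_mdeg _ i)).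
Qed.

Lemma mscompD F G : mscomp (fun k => F k + G k) b = fun v => mscomp F b v + mscomp G b v.
Proof.
apply/funext => v; rewrite !(@mscompE (mdeg v).+1)// -big_split.
by apply: eq_bigr => p _; rewrite mulrDl.
Qed.

Lemma mscompZ (c : C) F : mscomp (fun k => c * F k) b = fun v => c * mscomp F b v.
Proof.
apply/funext => v; rewrite !(@mscompE (mdeg v).+1)// mulr_sumr.
by apply: eq_bigr => p _; rewrite mulrA.
Qed.

Lemma mscompB F G : mscomp (fun k => F k - G k) b = fun v => mscomp F b v - mscomp G b v.
Proof.
apply/funext => v; rewrite !(@mscompE (mdeg v).+1)// -sumrB.
by apply: eq_bigr => p _; rewrite mulrBl.
Qed.

Lemma mscomp_delta k : mscomp (msdelta k) b = mspow b k.
Proof.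
apply/funext => v; pose N := (maxn (mdeg v) (mdeg k)).+1.
rewrite (@mscompE N) ?ltnS ?leq_maxl//.
have [|p pk] := @unbox_surj d N k.
  by move=> i; rewrite ltnS (leq_trans (le_mdeg _ _))// leq_maxr.
rewrite (bigD1 p)//= /msdelta pk eqxx mul1r big1 ?addr0// => q qp.
by rewrite -pk (inj_eq (@unbox_inj _ _)) (negPf qp) mul0r.
Qed.

Lemma mscomp1 : mscomp (msconst 1) b = msconst 1.
Proof. by rewrite msconst_delta mscomp_delta mspow0. Qed.

Lemma mscomp_var i : mscomp (msvar i) b = b i.
Proof. by rewrite msvar_delta mscomp_delta mspow_basis. Qed.

Lemma mscomp_exp F e : mscomp (msexp F e) b = msexp (mscomp F b) e.
Proof.
elim: e => [|e IH]; first exact: mscomp1.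
by rewrite /msexp /= -/(msexp F e) mscompM IH.
Qed.

End Substitution.
End SeriesRing.

(** * Weights and weighted coefficient bounds *)

Section WeightedBounds.
Variables (R : realType) (d : nat).
Local Notation C := (cplx R).
Implicit Types (F K : fpseries R d) (k v : mindex d) (rad w : 'I_d -> R).

(** The weight of an exponent when [x_i] has weight [w i]. *)
Definition wt w k : R := \sum_(i < d) (k i)%:R * w i.

(** The value of a monomial at the point with coordinates [rad]. *)
Definition Wt rad v : R := \prod_(i < d) rad i ^+ v i.

Lemma wtD w k l : wt w (k + l) = wt w k + wt w l.
Proof.
by rewrite /wt -big_split; apply: eq_bigr => i _; rewrite mindexD natrD mulrDl.
Qed.

Lemma wt_basis w i : wt w (mbasis i) = w i.
Proof.
rewrite /wt (bigD1 i)//= big1 ?addr0 => [|j ji]; first by rewrite ffunE eqxx mul1r.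
by rewrite ffunE (negPf ji) mul0r.
Qed.

Lemma wt0 w : wt w 0 = 0.
Proof. by rewrite /wt big1// => i _; rewrite ffunE mul0r. Qed.

Lemma wt_ge0 w k : (forall i, 0 <= w i) -> 0 <= wt w k.
Proof. by move=> w0; rewrite sumr_ge0// => i _; rewrite mulr_ge0. Qed.

Lemma wt_ge_mdeg w k (c : R) : (forall i, c <= w i) -> c * (mdeg k)%:R <= wt w k.
Proof.
move=> cw; rewrite /wt /mdeg natr_sum mulr_sumr; apply: ler_sum => i _.
by rewrite mulrC ler_wpM2l.
Qed.

Lemma WtD rad u v : Wt rad (u + v) = Wt rad u * Wt rad v.
Proof.
by rewrite /Wt -big_split; apply: eq_bigr => i _; rewrite mindexD exprD.
Qed.

Lemma Wt_basis rad i : Wt rad (mbasis i) = rad i.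
Proof.
rewrite /Wt (bigD1 i)//= big1 ?mulr1 => [|j ji]; first by rewrite ffunE eqxx expr1.
by rewrite ffunE (negPf ji) expr0.
Qed.

Lemma Wt0 rad : Wt rad 0 = 1.
Proof. by rewrite /Wt big1// => i _; rewrite ffunE expr0. Qed.

Lemma Wt_gt0 rad v : (forall i, 0 < rad i) -> 0 < Wt rad v.
Proof. by move=> r0; apply: prodr_gt0 => i _; rewrite exprn_gt0. Qed.

Section Bounds.
Variables (rad w : 'I_d -> R).
Hypotheses (rad_gt0 : forall i, 0 < rad i).

(** Cauchy-type coefficient estimate, restricted to the indices of weight less
    than [tau]: the truncation makes an a priori bound on a formal solution
    meaningful before its convergence is known. *)
Definition bnd (tau : R) K (M : R) : Prop :=
  forall v, wt w v < tau -> cmod (K v) * Wt rad v <= M.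

Lemma W0 v : 0 < Wt rad v. Proof. exact: Wt_gt0. Qed.

Lemma W_ge0 v : 0 <= Wt rad v. Proof. exact/ltW/W0. Qed.

Lemma bnd_le tau tau' K M M' : tau' <= tau -> M <= M' -> bnd tau K M -> bnd tau' K M'.
Proof.
by move=> tt MM Kb v vt; rewrite (le_trans (Kb v _))//; exact: lt_le_trans tt.
Qed.

Lemma bndD tau F K M N : bnd tau F M -> bnd tau K N ->
  bnd tau (fun v => F v + K v) (M + N).
Proof.
move=> Fb Kb v vt; rewrite (le_trans _ (lerD (Fb v vt) (Kb v vt)))//.
by rewrite -mulrDl ler_wpM2r ?W_ge0// cmodD.
Qed.

Lemma bndZ tau K (c : C) M : bnd tau K M -> bnd tau (fun v => c * K v) (cmod c * M).
Proof. by move=> Kb v vt; rewrite cmodM -mulrA ler_wpM2l ?cmod_ge0// Kb. Qed.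

Lemma bndN tau K M : bnd tau K M -> bnd tau (fun v => - K v) M.
Proof. by move=> Kb v vt; rewrite cmodN Kb. Qed.

Lemma bndB tau F K M N : bnd tau F M -> bnd tau K N ->
  bnd tau (fun v => F v - K v) (M + N).
Proof. by move=> Fb /bndN Kb; exact: bndD. Qed.

Lemma eq_bnd tau F K M : (forall v, F v = K v) -> bnd tau F M -> bnd tau K M.
Proof. by move=> FK Fb v vt; rewrite -FK Fb. Qed.

Lemma mpred_spec i v : {v' | v = mbasis i + v'} + {v i = 0%N}.
Proof.
have [v0|vi] := posnP (v i); [by right|left].
exists [ffun j => (v j - (j == i))%N]; apply/ffunP => j; rewrite mindexD !ffunE.
by case: eqP => [->|_]; rewrite ?subnKC// subn0.
Qed.

Lemma msvar_mul0 i K v : v i = 0%N -> msmul (msvar i) K v = 0.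
Proof.
move=> vi; apply: msmul_delta_out => v' vE.
by move: vi; rewrite vE mindexD ffunE eqxx.
Qed.

Lemma msvar_mulS i K v : msmul (msvar i) K (mbasis i + v) = K v.
Proof. exact: msmul_delta. Qed.

Lemma bnd_var i tau K M : 0 <= M -> bnd tau K M ->
  bnd (w i + tau) (msmul (msvar i) K) (rad i * M).
Proof.
move=> M0 Kb v; have [[v' ->]|vi] := mpred_spec i v.
  rewrite wtD wt_basis ltrD2l => vt; rewrite msvar_mulS WtD Wt_basis mulrCA.
  by rewrite ler_wpM2l ?(ltW (rad_gt0 i))// Kb.
by move=> _; rewrite msvar_mul0// cmod0 mul0r mulr_ge0// ltW.
Qed.

(** [N i] bounds multiplication by [b i], which shifts weights by [u i]. *)
Lemma bnd_mspow (b : 'I_d -> fpseries R d) (N u : 'I_d -> R) : (forall i, 0 <= N i) ->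
  (forall i tau K M, 0 <= M -> bnd tau K M -> bnd (u i + tau) (msmul (b i) K) (N i * M)) ->
  forall k tau K M, 0 <= M -> bnd tau K M ->
    bnd (wt u k + tau) (msmul (mspow b k) K) (Wt N k * M).
Proof.
move=> N0 bN; elim/mindex_ind => [|k i IH] tau K M M0 Kb.
  by rewrite wt0 add0r Wt0 mul1r mspow0 msmul1.
rewrite wtD wt_basis WtD Wt_basis mspowD mspow_basis -msmulA -addrA -mulrA.
apply: bN; last exact: IH.
by rewrite mulr_ge0// prodr_ge0// => j _; rewrite exprn_ge0.
Qed.

Lemma bnd1 tau : bnd tau (msconst 1) 1.
Proof.
move=> v _; rewrite /msconst; case: eqP => [->|_]; first by rewrite cmod1 Wt0 mulr1.
by rewrite cmod0 mul0r.
Qed.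

End Bounds.
End WeightedBounds.

(** * Blow-up charts and division by linear forms *)

Section Charts.
Variables (R : realType) (n : nat).
Local Notation C := (cplx R).
Local Notation series := (fpseries R n.+2).
Local Notation idx := (mindex n.+2).
Implicit Types (F K f g : series) (k v p : idx) (xi : proj_line R).

Definition i0 : 'I_n.+2 := ord0.
Definition i1 : 'I_n.+2 := lift ord0 ord0.

Lemma i01F : (i0 == i1) = false. Proof. by []. Qed.
Lemma i10F : (i1 == i0) = false. Proof. by []. Qed.

Definition mset k (a b : nat) : idx :=
  [ffun j => if j == i0 then a else if j == i1 then b else k j].

Lemma mset0 k a b : mset k a b i0 = a. Proof. by rewrite ffunE eqxx. Qed.
Lemma mset1 k a b : mset k a b i1 = b. Proof. by rewrite ffunE. Qed.
Lemma mset_other k a b j : j != i0 -> j != i1 -> mset k a b j = k j.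
Proof. by move=> /negPf j0 /negPf j1; rewrite ffunE j0 j1. Qed.

Lemma mset_eqP k a b p : (p = mset k a b) <->
  p i0 = a /\ p i1 = b /\ forall j, j != i0 -> j != i1 -> p j = k j.
Proof.
split=> [->|[p0 [p1 pj]]].
  by rewrite mset0 mset1; split=> //; split=> // j; exact: mset_other.
apply/ffunP => j; rewrite ffunE; case: eqVneq => [->//|j0].
by case: eqVneq => [->//|j1]; exact: pj.
Qed.

Lemma mset_id k : mset k (k i0) (k i1) = k.
Proof. by apply/esym/mset_eqP. Qed.

Lemma basis0 i : mbasis i i0 = (i == i0). Proof. by rewrite ffunE eq_sym. Qed.
Lemma basis1 i : mbasis i i1 = (i == i1). Proof. by rewrite ffunE eq_sym. Qed.

Lemma mscale_shift (c : C) i K v :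
  msmul (msadd (msconst c) (msvar i)) K v = c * K v + msmul (msvar i) K v.
Proof. by rewrite /msadd msmulDl msconst_scale. Qed.

Lemma blowup0_fin c K : msmul (blowup n (PFin c) i0) K = msmul (msvar i1) K.
Proof. by []. Qed.

Lemma blowup1_fin c K v : msmul (blowup n (PFin c) i1) K v =
  c * msmul (msvar i1) K v + msmul (msvar i0) (msmul (msvar i1) K) v.
Proof. by rewrite -mscale_shift msmulA. Qed.

Lemma blowup0_inf K : msmul (blowup n PInf i0) K =
  msmul (msvar i0) (msmul (msvar i1) K).
Proof. by rewrite msmulA. Qed.

Lemma blowup1_inf K : msmul (blowup n PInf i1) K = msmul (msvar i1) K.
Proof. by []. Qed.

Lemma blowup_other xi K j : j != i0 -> j != i1 ->
  msmul (blowup n xi j) K = msmul (msvar j) K.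
Proof.
move=> /negPf j0 /negPf j1; rewrite /blowup -/i0 -/i1.
by case: xi => [c|]; rewrite j0 ?j1.
Qed.

(** The blow-up charts are graded: the exponent of [v_2] is the total degree in
    [x_1, x_2], and the exponents of [x''] are unchanged. *)
Definition same_level k v := v i1 = (k i0 + k i1)%N /\
  forall j, j != i0 -> j != i1 -> v j = k j.

Definition level_supported k K := forall v, K v != 0 -> same_level k v.

Lemma level_mulvar1 i K k : (i == i0) || (i == i1) -> level_supported k K ->
  level_supported (mbasis i + k) (msmul (msvar i1) K).
Proof.
move=> ii Kk v; have [[v' ->]|vi] := mpred_spec i1 v; last first.
  by rewrite msvar_mul0 ?eqxx.
rewrite msvar_mulS => /Kk[v1 vj]; split.
  rewrite !mindexD !basis0 !basis1 v1 eqxx.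
  by case/orP: ii => /eqP ->; rewrite ?eqxx ?add0n addnA // addnCA addnA.
move=> j j0 j1; rewrite !mindexD !ffunE vj// (negPf j1).
by case/orP: ii => /eqP ->; rewrite ?(negPf j0) ?(negPf j1).
Qed.

Lemma level_mulvar0 K k : level_supported k K ->
  level_supported k (msmul (msvar i0) K).
Proof.
move=> Kk v; have [[v' ->]|vi] := mpred_spec i0 v; last first.
  by rewrite msvar_mul0 ?eqxx.
rewrite msvar_mulS => /Kk[v1 vj]; split; first by rewrite mindexD basis1.
by move=> j j0 j1; rewrite mindexD ffunE vj// (negPf j0).
Qed.

Lemma level_mulvar_other j K k : j != i0 -> j != i1 -> level_supported k K ->
  level_supported (mbasis j + k) (msmul (msvar j) K).
Proof.
move=> j0 j1 Kk v; have [[v' ->]|vi] := mpred_spec j v; last first.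
  by rewrite msvar_mul0 ?eqxx.
rewrite msvar_mulS => /Kk[v1 vj]; split.
  by rewrite !mindexD v1 !ffunE 2![_ == j]eq_sym (negPf j0) (negPf j1).
by move=> l l0 l1; rewrite !mindexD vj.
Qed.

Lemma mspow_level xi k : level_supported k (mspow (blowup n xi) k).
Proof.
elim/mindex_ind: k => [|k i IH].
  rewrite mspow0 => v; rewrite /msconst.
  have [->|_] := eqVneq v 0; last by rewrite eqxx.
  by move=> _; split=> [|j _ _]; rewrite !ffunE.
rewrite mspowD mspow_basis.
have [->|iN0] := eqVneq i i0.
  case: xi IH => [c|] IH; first exact: level_mulvar1.
  by rewrite blowup0_inf; apply/level_mulvar0/level_mulvar1.
have [->|iN1] := eqVneq i i1.
  case: xi IH => [c|] IH; last exact: level_mulvar1.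
  move=> v; rewrite blowup1_fin => vn0.
  have [E|/level_mulvar1] := eqVneq (msmul (msvar i1) (mspow (blowup n (PFin c)) k) v) 0.
    move: vn0; rewrite E mulr0 add0r; apply: level_mulvar0.
    by apply: level_mulvar1.
  by apply.
by rewrite blowup_other//; exact: level_mulvar_other.
Qed.

Lemma mdeg_split k : mdeg k = (k i0 + (k i1 + \sum_(j < n.+2 | (j != i0) && (j != i1)) k j))%N.
Proof. by rewrite /mdeg (bigD1 i0)//= (bigD1 i1). Qed.

Lemma blowup_raising xi : degree_raising (blowup n xi).
Proof.
move=> k v /mspow_level[v1 vj]; rewrite !mdeg_split v1.
have -> : \sum_(j < n.+2 | (j != i0) && (j != i1)) k j =
          \sum_(j < n.+2 | (j != i0) && (j != i1)) v j.
  by apply: eq_bigr => j /andP[j0 j1]; rewrite vj.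
by rewrite addnA leq_addl.
Qed.

(** The exponents whose monomials are pulled back, in the chart at [xi] itself, to
    monomials without [v_1]; there is one for each level. *)
Definition axis xi k : Prop := if xi is PFin _ then k i1 = 0%N else k i0 = 0%N.

Lemma mspow_axis xi k : axis xi k ->
  mspow (blowup n xi) k = msdelta R (mset k 0 (k i0 + k i1)).
Proof.
elim/mindex_ind: k => [|k i IH] ax.
  rewrite mspow0 msconst_delta; congr msdelta; apply/mset_eqP.
  by rewrite !ffunE; split=> //; split=> // j _ _; rewrite ffunE.
have [axk iax] : axis xi k /\ i != (if xi is PFin _ then i1 else i0).
  case: xi ax {IH} => [c|]; rewrite /axis mindexD ?basis0 ?basis1;
    by case: (eqVneq i) => // _ ->.
rewrite mspowD mspow_basis IH//.
have key j q : msmul (msvar j) (msdelta R q) = msdelta R (mbasis j + q).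
  apply/funext => v; have [[v' ->]|vj] := mpred_spec j v.
    rewrite msvar_mulS /msdelta; case: eqP => [->|vq]; first by rewrite eqxx.
    by case: eqP => // /mindex_addI.
  rewrite msvar_mul0// /msdelta; case: eqP => // vE.
  by move: vj; rewrite vE mindexD ffunE eqxx.
have case01 : (i == i0) || (i == i1) ->
    msmul (blowup n xi i) (msdelta R (mset k 0 (k i0 + k i1))) =
    msmul (msvar i1) (msdelta R (mset k 0 (k i0 + k i1))).
  by case: xi iax {IH ax axk} => [c|] /negPf ->; rewrite ?orbF ?orFb => /eqP ->.
case: (boolP ((i == i0) || (i == i1))) => [ii|].
  rewrite case01// key; congr msdelta; apply/mset_eqP.
  rewrite !mindexD mset0 mset1 !basis0 !basis1; split=> //; split.
    by case/orP: ii => /eqP ->; rewrite ?i01F ?i10F !eqxx /= ?add0n;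
      [rewrite addnA|rewrite addnCA].
  move=> j j0 j1; rewrite !mindexD mset_other// !ffunE (negPf j1).
  by case/orP: ii => /eqP ->; rewrite ?(negPf j0) ?(negPf j1).
rewrite negb_or => /andP[iN0 iN1]; rewrite blowup_other// key; congr msdelta.
apply/mset_eqP; rewrite !mindexD mset0 mset1 !basis0 !basis1 (negPf iN0) (negPf iN1).
by split=> //; split=> // j j0 j1; rewrite !mindexD mset_other.
Qed.

(** Division by the linear form vanishing at [xi]; for a finite point this is
    synthetic division, performed on all homogeneous parts at once. *)
Definition lform xi : series :=
  if xi is PFin c then fun k => msvar i1 k - c * msvar i0 k else msvar i0.

Definition ldiv xi f : series :=
  if xi is PFin c then fun k => \sum_(l < (k i0).+1) c ^+ l * f (mset k (k i0 - l) (k i1 + l).+1)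
  else fun k => f (mbasis i0 + k).

Definition lrem xi f : series := fun k => f k - msmul (lform xi) (ldiv xi f) k.

Lemma lform_fin c K k : msmul (lform (PFin c)) K k =
  msmul (msvar i1) K k - c * msmul (msvar i0) K k.
Proof. by rewrite /lform msmulBl msmulZl. Qed.

(** The remainder of a binary form is a multiple of a power of the other
    coordinate: it records the value of the form at [xi]. *)
Lemma lrem_axis xi f k : lrem xi f k != 0 -> axis xi k.
Proof.
case: xi => [c|]; rewrite /lrem /=; last first.
  have [[k' ->]|//] := mpred_spec i0 k.
  by rewrite msvar_mulS subrr eqxx.
have [[k' ->]|//] := mpred_spec i1 k.
rewrite lform_fin msvar_mulS => /eqP []; apply/eqP.
rewrite subr_eq0; apply/eqP.
rewrite /= big_ord_recl /= expr0 mul1r subn0 addn0.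
have -> : mset k' (k' i0) (k' i1).+1 = mbasis i1 + k'.
  apply/esym/mset_eqP; rewrite !mindexD !basis0 !basis1; split=> //; split=> // j j0 j1.
  by rewrite mindexD ffunE (negPf j1).
rewrite -addrA -[LHS]addr0; congr (_ + _); apply/esym/eqP.
rewrite subr_eq0; apply/eqP.
have [[k'' k'E]|k0] := mpred_spec i0 k'; last first.
  rewrite msvar_mul0 ?mulr0; last by rewrite mindexD k0 basis0.
  by rewrite k0 big_ord0.
rewrite k'E addrCA msvar_mulS /= mulr_sumr.
have e0 : (mbasis i0 + k'')%R i0 = (k'' i0).+1 by rewrite mindexD basis0.
have e1 : (mbasis i0 + k'')%R i1 = k'' i1 by rewrite mindexD basis1.
have f0 : (mbasis i1 + k'')%R i0 = k'' i0 by rewrite mindexD basis0.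
have f1 : (mbasis i1 + k'')%R i1 = (k'' i1).+1 by rewrite mindexD basis1.
rewrite e0 e1 f0 f1; apply: eq_bigr => l _.
rewrite /bump /= add1n exprS mulrA subSS addnS addSn; congr (_ * f _).
apply/mset_eqP; rewrite mset0 mset1; split=> //; split=> // j j0 j1.
by rewrite mset_other// !mindexD !ffunE (negPf j0) (negPf j1).
Qed.

Lemma lform_div xi f k : f k = msmul (lform xi) (ldiv xi f) k + lrem xi f k.
Proof. by rewrite /lrem addrC subrK. Qed.

Lemma ldivB xi f g : ldiv xi (fun k => f k - g k) = fun k => ldiv xi f k - ldiv xi g k.
Proof.
case: xi => [c|] //; apply/funext => k; rewrite /= -sumrB.
by apply: eq_bigr => l _; rewrite mulrBr.
Qed.

Definition axis_of xi v : idx :=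
  if xi is PFin _ then mset v (v i1) 0 else mset v 0 (v i1).

Lemma axis_ofP xi v : axis xi (axis_of xi v).
Proof. by case: xi => [c|]; rewrite /axis /axis_of ?mset0 ?mset1. Qed.

Lemma axis_of_uniq xi p v : axis xi p -> same_level p v -> p = axis_of xi v.
Proof.
case: xi => [c|]; rewrite /axis /axis_of => ax [v1 vj]; apply/mset_eqP.
  by rewrite ax v1 ax addn0; split=> //; split=> // j j0 j1; rewrite vj.
by rewrite ax v1 ax add0n; split=> //; split=> // j j0 j1; rewrite vj.
Qed.

Lemma axis_of_level xi v : same_level (axis_of xi v) v.
Proof.
case: xi => [c|]; rewrite /axis_of; split; rewrite ?mset0 ?mset1 ?addn0//;
  by move=> j j0 j1; rewrite mset_other.
Qed.

Lemma mscomp_axis xi xi' F v : (forall k, F k != 0 -> axis xi k) ->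
  mscomp F (blowup n xi') v =
    F (axis_of xi v) * mspow (blowup n xi') (axis_of xi v) v.
Proof.
move=> Fax; rewrite (@mscompE _ _ _ (@blowup_raising xi') (mdeg v).+1)//.
have [|b bE] := @unbox_surj n.+2 (mdeg v).+1 (axis_of xi v).
  move=> i; rewrite ltnS; apply: leq_trans (le_mdeg _ i) _.
  have [v1 vj] := axis_of_level xi v; rewrite !mdeg_split v1.
  have -> : \sum_(j < n.+2 | (j != i0) && (j != i1)) (axis_of xi v) j =
            \sum_(j < n.+2 | (j != i0) && (j != i1)) v j.
    by apply: eq_bigr => j /andP[j0 j1]; rewrite vj.
  by rewrite addnA leq_addl.
rewrite (bigD1 b)//= bE big1 ?addr0// => c cb; apply/eqP; rewrite mulf_eq0.
apply/norP => -[/Fax cax /mspow_level cl]; move/negP: cb; apply.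
by apply/eqP/unbox_inj; rewrite bE; exact: axis_of_uniq.
Qed.

Lemma axis_of_id xi v : v i0 = 0%N -> mset (axis_of xi v) 0 (axis_of xi v i0 + axis_of xi v i1) = v.
Proof.
move=> v0; have [v1 vj] := axis_of_level xi v.
by apply/esym/mset_eqP; split => //; split.
Qed.

(** In its own chart the remainder is the restriction to [v_1 = 0]. *)
Lemma lrem_comp xi f v : mscomp (lrem xi f) (blowup n xi) v =
  if v i0 == 0%N then lrem xi f (axis_of xi v) else 0.
Proof.
rewrite (@mscomp_axis xi xi); last exact: lrem_axis.
rewrite mspow_axis /msdelta; last exact: axis_ofP.
have [v0|v0] := eqVneq (v i0) 0%N.
  by rewrite (axis_of_id xi v0) eqxx mulr1.
case: eqP => [vE|_]; last by rewrite mulr0.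
by move: v0; rewrite vE mset0 eqxx.
Qed.

(** In coordinates, the linear form [lform xi] becomes [(u + w v_1) v_2]. *)
Definition lcoef xi xi' : C * C := match xi, xi' with
  | PFin c, PFin c' => (c' - c, 1)
  | PFin c, PInf => (1, - c)
  | PInf, PFin _ => (1, 0)
  | PInf, PInf => (0, 1)
  end.

Lemma lform_comp xi xi' K v : let: (u, w) := lcoef xi xi' in
  msmul (mscomp (lform xi) (blowup n xi')) K v =
    u * msmul (msvar i1) K v + w * msmul (msvar i0) (msmul (msvar i1) K) v.
Proof.
have br := @blowup_raising xi'.
case: xi => [c|]; rewrite [lform _]/lform; last first.
  rewrite mscomp_var//; case: xi' br => [c'|] br; rewrite [lcoef _ _]/lcoef.
    by rewrite mul1r mul0r addr0.
  by rewrite mul0r add0r mul1r msmulA.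
rewrite (mscompB br) (mscompZ br) !mscomp_var// msmulBl msmulZl.
case: xi' br => [c'|] br; rewrite [lcoef _ _]/lcoef.
  by rewrite blowup1_fin blowup0_fin; ring.
by rewrite blowup0_inf blowup1_inf; ring.
Qed.

(** There the linear form becomes [v_1 v_2], which vanishes for [v_1 = 0]. *)
Lemma lform_own_chart xi f v : v i0 = 0%N ->
  mscomp f (blowup n xi) v = lrem xi f (axis_of xi v).
Proof.
move=> v0; have br := @blowup_raising xi.
rewrite (_ : f = fun k => msmul (lform xi) (ldiv xi f) k + lrem xi f k); last first.
  by apply/funext => k; exact: lform_div.
rewrite (mscompD br) (mscompM br) lrem_comp v0 eqxx.
rewrite (_ : msmul _ _ v = 0); last first.
  have := lform_comp xi xi (mscomp (ldiv xi f) (blowup n xi)) v.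
  case: xi {br} => [c|] /= ->; rewrite ?subrr mul0r add0r mul1r;
    by rewrite msvar_mul0.
by rewrite add0r; congr lrem; apply/funext => k; exact: lform_div.
Qed.

Lemma ldiv_own_chart xi f v : mscomp (ldiv xi f) (blowup n xi) v =
  mscomp f (blowup n xi) (mbasis i0 + (mbasis i1 + v)).
Proof.
have br := @blowup_raising xi.
rewrite [in RHS](_ : f = fun k => msmul (lform xi) (ldiv xi f) k + lrem xi f k); last first.
  by apply/funext => k; exact: lform_div.
rewrite (mscompD br) (mscompM br) lrem_comp mindexD basis0 /= addr0.
have := lform_comp xi xi (mscomp (ldiv xi f) (blowup n xi)) (mbasis i0 + (mbasis i1 + v)).
by case: xi {br} => [c|] /= ->; rewrite ?subrr mul0r add0r mul1r !msvar_mulS.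
Qed.

End Charts.

(** * Division with bounds in all charts *)

Section Division.
Variables (R : realType) (n : nat).
Local Notation C := (cplx R).
Local Notation series := (fpseries R n.+2).
Local Notation idx := (mindex n.+2).
Local Notation i0 := (i0 n).
Local Notation i1 := (i1 n).
Implicit Types (F K f g : series) (k v p : idx) (xi : proj_line R).

Variables (Z : set (proj_line R)) (s A eps : R) (w : 'I_n.+2 -> R).

(** The radii of the charts: [v_1] has radius [s], and the radius of [v_2] is
    larger by the factor [A] in the chart at infinity, so that restricting to a
    point of the exceptional divisor and extending as a pure power of a
    coordinate does not increase norms in any chart. *)
Record separated : Prop := Separated {
  sep_w0 : w i0 = eps; sep_w1 : w i1 = eps;
  sep_w : forall i, 0 < w i;
  sep_s : 0 < s; sep_A : 1 <= A; sep_sA : 2 * (s * A) <= 1;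
  sep_fin : forall c, Z (PFin c) -> cmod c + s <= A;
  sep_dist : forall c c', Z (PFin c) -> Z (PFin c') -> c != c' -> 2 * s <= cmod (c - c')
}.

Hypothesis sepZ : separated.

Definition sigma xi : R := if xi is PFin _ then 1 else A.

(** As [T] grows, all radii but that of [v_1] shrink, at the rate given by the
    weights: large [T] makes the terms of higher weight negligible. *)
Definition rad (T : R) xi (i : 'I_n.+2) : R :=
  if i == i0 then s else if i == i1 then sigma xi * expR (- T * w i) else expR (- T * w i).

(** The weights of the chart coordinates; [v_1] has weight zero, as the charts
    preserve weights (see [wt_level]). *)
Definition lw (i : 'I_n.+2) : R := if i == i0 then 0 else w i.

(** Multiplication by the pull-back of [x_i] has norm at most
    [kappa xi i * expR (- T * w i)]. *)
Definition kappa xi (i : 'I_n.+2) : R :=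
  if i == i0 then if xi is PFin _ then 1 else s * A
  else if i == i1 then if xi is PFin c then cmod c + s else A
  else 1.

Lemma sigma_ge1 xi : 1 <= sigma xi.
Proof. by case: xi => [c|] //=; exact: sep_A. Qed.

Lemma A_gt0 : 0 < A. Proof. exact: lt_le_trans ltr01 (sep_A sepZ). Qed.

Lemma rad_gt0 T xi i : 0 < rad T xi i.
Proof.
rewrite /rad; case: ifP => _; first exact: (sep_s sepZ).
case: ifP => _; last exact: expR_gt0.
by rewrite mulr_gt0 ?expR_gt0// (lt_le_trans ltr01 (sigma_ge1 xi)).
Qed.

Lemma lw_ge0 i : 0 <= lw i.
Proof. by rewrite /lw; case: ifP => // _; exact/ltW/(sep_w sepZ). Qed.

Lemma kappa_ge0 xi i : 0 <= kappa xi i.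
Proof.
have s0 := ltW (sep_s sepZ); have A0 := ltW A_gt0.
rewrite /kappa; case: ifP => _; first by case: xi => [c|]; rewrite // mulr_ge0.
case: ifP => _ //; case: xi => [c|] //; by rewrite addr_ge0 ?cmod_ge0.
Qed.

Lemma wt_split (u : 'I_n.+2 -> R) k : wt u k = (k i0)%:R * u i0 + ((k i1)%:R * u i1 +
  \sum_(j < n.+2 | (j != i0) && (j != i1)) (k j)%:R * u j).
Proof. by rewrite /wt (bigD1 i0)//= (bigD1 i1). Qed.

Lemma wt_level k v : same_level k v -> wt w k = wt lw v.
Proof.
move=> [v1 vj]; rewrite !wt_split v1 /lw eqxx /= mulr0 add0r.
rewrite (sep_w0 sepZ) (sep_w1 sepZ) natrD mulrDl -addrA; congr (_ + (_ + _)).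
by apply: eq_bigr => j /andP[j0 j1]; rewrite vj// (negPf j0).
Qed.

Lemma bnd_blowup T xi : Z xi -> forall i tau K M, 0 <= M ->
  bnd (rad T xi) lw tau K M ->
  bnd (rad T xi) lw (w i + tau) (msmul (blowup n xi i) K)
    (kappa xi i * expR (- T * w i) * M).
Proof.
move=> Zxi i tau K M M0 Kb.
have r1 : rad T xi i1 = sigma xi * expR (- T * eps) by rewrite /rad /= (sep_w1 sepZ).
have r0 : rad T xi i0 = s by rewrite /rad eqxx.
have b1 := @bnd_var _ _ _ _ (rad_gt0 T xi) i1 _ _ _ M0 Kb.
have l1 : lw i1 = eps by rewrite /lw /= (sep_w1 sepZ).
have l0 : lw i0 = 0 by rewrite /lw eqxx.
have M1 : 0 <= rad T xi i1 * M by rewrite mulr_ge0// ltW// rad_gt0.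
have b01 := @bnd_var _ _ _ _ (rad_gt0 T xi) i0 _ _ _ M1 b1; rewrite l0 add0r in b01.
rewrite l1 in b1 b01.
have [->|iN0] := eqVneq i i0.
  rewrite (sep_w0 sepZ) /kappa eqxx; case: xi Zxi {Kb} r1 r0 b1 b01 M1 => [c|] _ r1 r0 b1 b01 M1.
    by rewrite r1 in b1.
  rewrite blowup0_inf; apply: bnd_le b01 => //.
  by rewrite r1 r0 /= !mulrA.
have [->|iN1] := eqVneq i i1.
  rewrite (sep_w1 sepZ) /kappa /=; case: xi Zxi {Kb} r1 r0 b1 b01 M1 => [c|] Zxi r1 r0 b1 b01 M1.
    apply: (@eq_bnd _ _ _ _ _ (fun v => c * msmul (msvar i1) K v +
        msmul (msvar i0) (msmul (msvar i1) K) v)).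
      by move=> v; rewrite blowup1_fin.
    apply: bnd_le (bndD (rad_gt0 T (PFin c)) (bndZ c b1) b01) => //.
    by rewrite r1 r0 /= mul1r -mulrA mulrDl.
  by rewrite r1 in b1.
rewrite blowup_other//; have := @bnd_var _ _ _ _ (rad_gt0 T xi) i _ _ _ M0 Kb.
rewrite /lw (negPf iN0) => bi; apply: bnd_le bi => //.
by rewrite /rad /kappa (negPf iN0) (negPf iN1) mul1r.
Qed.

Lemma Wt_scale (a u : 'I_n.+2 -> R) (T : R) k :
  Wt (fun i => a i * expR (- T * u i)) k = Wt a k * expR (- T * wt u k).
Proof.
rewrite /Wt /wt mulr_sumr expR_sum -big_split; apply: eq_bigr => i _ /=.
by rewrite exprMn -expRM_natl mulrCA mulr_natl.
Qed.

Lemma Wt_mset (a : 'I_n.+2 -> R) k q r : (forall j, j != i0 -> j != i1 -> a j = 1) ->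
  Wt a (mset k q r) = a i0 ^+ q * a i1 ^+ r.
Proof.
move=> a1; rewrite /Wt (bigD1 i0)//= (bigD1 i1)//= mset0 mset1 big1 ?mulr1//.
by move=> j /andP[j0 j1]; rewrite a1// expr1n.
Qed.

Definition sigma_rad xi (i : 'I_n.+2) : R :=
  if i == i0 then s else if i == i1 then sigma xi else 1.

Lemma Wt_rad T xi v : Wt (rad T xi) v = Wt (sigma_rad xi) v * expR (- T * wt lw v).
Proof.
rewrite -Wt_scale; congr Wt; apply/funext => i; rewrite /rad /sigma_rad /lw.
case: ifP => _; first by rewrite mulr0 expR0 mulr1.
by case: ifP => _ //; rewrite mul1r.
Qed.

Definition chart_bnd (T tau : R) (F : proj_line R -> series) (M : R) : Prop :=
  forall xi, Z xi -> bnd (rad T xi) lw tau (F xi) M.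

(** A controlled division by [U], of weight [u]: whatever formal quotients
    [K xi] of [f o b_xi - F xi] by [U o b_xi] are given, the pull-backs of [D f]
    are close to all of them at once, with a loss that is the expected [exp (T u)] up to a
    constant independent of [T]. *)
Definition divisor (U : series) (u c : R) (D : series -> series) : Prop :=
  [/\ 0 <= c,
      forall f g, D (fun k => f k - g k) = fun k => D f k - D g k,
      forall tau f, (forall k, wt w k < u + tau -> f k = 0) ->
        forall k, wt w k < tau -> D f k = 0 &
      forall (T : R) f (F K : proj_line R -> series),
        (forall xi, Z xi -> forall v, mscomp f (blowup n xi) v =
            F xi v + msmul (mscomp U (blowup n xi)) (K xi) v) ->
        forall tau M, 0 <= M -> chart_bnd T (u + tau) F M ->
        chart_bnd T tau (fun xi v => K xi v - mscomp (D f) (blowup n xi) v)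
          (c * expR (T * u) * M)].

Lemma divisorM U V u u' c c' D D' : divisor U u c D -> divisor V u' c' D' ->
  divisor (msmul U V) (u + u') (c * c') (fun f => D' (D f)).
Proof.
move=> [c0 DB Dl Dd] [c'0 DB' Dl' Dd']; split; first exact: mulr_ge0.
- by move=> f g; rewrite DB DB'.
- move=> tau f f0; apply: Dl'; apply: Dl => k; rewrite addrA; exact: f0.
move=> T f F K fFK tau M M0; rewrite -addrA => Fb.
have h1 xi : Z xi -> forall v, mscomp f (blowup n xi) v = F xi v +
    msmul (mscomp U (blowup n xi)) (msmul (mscomp V (blowup n xi)) (K xi)) v.
  by move=> Zxi v; rewrite fFK// (mscompM (@blowup_raising R n xi)) msmulA.
have b1 := Dd T f F _ h1 _ M M0 Fb.
have h2 xi : Z xi -> forall v, mscomp (D f) (blowup n xi) v =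
    (fun v => mscomp (D f) (blowup n xi) v - msmul (mscomp V (blowup n xi)) (K xi) v) v +
    msmul (mscomp V (blowup n xi)) (K xi) v.
  by move=> Zxi v; rewrite subrK.
have M1 : 0 <= c * expR (T * u) * M by rewrite !mulr_ge0 ?expR_ge0.
have := Dd' T (D f) _ K h2 tau _ M1 => /(_ _)/wrap[|b2].
  move=> xi Zxi; apply: eq_bnd (bndN (b1 xi Zxi)).
  by move=> v; rewrite opprB.
move=> xi Zxi; apply: bnd_le (b2 xi Zxi) => //.
by rewrite mulrDr expRD; rewrite le_eqVlt; apply/orP; left; apply/eqP; ring.
Qed.

Lemma divisor_const c : c != 0 ->
  divisor (msconst c) 0 (cmod c)^-1 (fun f k => c^-1 * f k).
Proof.
move=> c0; split; first by rewrite invr_ge0 cmod_ge0.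
- by move=> f g; apply/funext => k; rewrite mulrBr.
- by move=> tau f f0 k kt; rewrite f0 ?mulr0// add0r.
move=> T f F K fFK tau M M0; rewrite add0r => Fb xi Zxi.
have br := @blowup_raising R n xi.
rewrite mulr0 expR0 mulr1 -cmodV.
apply: (@eq_bnd _ _ _ _ _ (fun v => - (c^-1 * F xi v))); last first.
  by apply/bndN/bndZ; exact: Fb.
move=> v; rewrite (mscompZ br) fFK//.
rewrite (_ : msconst c = fun k => c * msconst 1 k); last first.
  by apply/funext => k; rewrite /msconst; case: ifP; rewrite ?mulr1 ?mulr0.
by rewrite (mscompZ br) (mscomp1 br) msmulZl msmul1; field.
Qed.

(** The remainder of the division by [x_j] does not contain [x_j], and neither
    does its pull-back. *)
Lemma divisor_var j : j != i0 -> j != i1 ->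
  divisor (msvar j) (w j) 1 (fun f k => f (mbasis j + k)).
Proof.
move=> j0 j1; split=> //.
  by move=> tau f f0 k kt; apply: f0; rewrite wtD wt_basis ltrD2l.
move=> T f F K fFK tau M M0 Fb xi Zxi v vt.
have br := @blowup_raising R n xi.
pose E k := f k - msmul (msvar j) (fun k => f (mbasis j + k)) k.
have E0 k : E k != 0 -> k j = 0%N.
  have [[k' ->]|//] := mpred_spec j k.
  by rewrite /E msvar_mulS subrr eqxx.
have Ev : mscomp E (blowup n xi) (mbasis j + v) = 0.
  rewrite (@mscompE _ _ _ br (mdeg (mbasis j + v)).+1)//; apply: big1 => p _.
  apply/eqP; rewrite mulf_eq0; apply/norP => -[/E0 pj /mspow_level[_ /(_ j j0 j1)]].
  by rewrite pj mindexD ffunE eqxx.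
have fE : mscomp f (blowup n xi) (mbasis j + v) =
   mscomp (fun k => f (mbasis j + k)) (blowup n xi) v.
  rewrite (_ : f = fun k => msmul (msvar j) (fun k => f (mbasis j + k)) k + E k); last first.
    by apply/funext => k; rewrite /E addrC subrK.
  rewrite (mscompD br) Ev addr0 (mscompM br) (mscomp_var br) blowup_other// msvar_mulS.
  by congr mscomp; apply/funext => k; rewrite /E !msvar_mulS subrr addr0.
have := fFK xi Zxi (mbasis j + v); rewrite fE (mscomp_var br) blowup_other// msvar_mulS => ->.
have -> : K xi v - (F xi (mbasis j + v) + K xi v) = - F xi (mbasis j + v) by ring.
have TE : T * w j = - (- T * w j) by ring.
rewrite cmodN mul1r TE expRN ler_pdivlMl ?expR_gt0// mulrCA.
have := Fb xi Zxi (mbasis j + v).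
by rewrite wtD wt_basis {1}/lw (negPf j0) ltrD2l WtD Wt_basis /rad (negPf j0) (negPf j1); exact.
Qed.

End Division.

(** * Bounds for the division by a linear form *)

Section LinearForms.
Variables (R : realType) (n : nat).
Local Notation C := (cplx R).
Local Notation series := (fpseries R n.+2).
Local Notation idx := (mindex n.+2).
Local Notation i0 := (i0 n).
Local Notation i1 := (i1 n).
Implicit Types (F K f g : series) (k v p : idx) (xi : proj_line R).
Variables (Z : set (proj_line R)) (s A eps : R) (w : 'I_n.+2 -> R).
Hypothesis sepZ : separated Z s A eps w.

Local Arguments cmod : simpl never.
Local Notation lform := (@lform R n).
Local Notation rad := (rad s A w).
Local Notation lw := (lw w).
Local Notation divisor := (divisor Z s A w).

Lemma lcoef_cases xi xi' : Z xi -> Z xi' ->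
  (lcoef xi xi' = (0, 1)) \/
  ((lcoef xi xi').1 != 0 /\ cmod (lcoef xi xi').2 * s <= cmod (lcoef xi xi').1 / 2 /\
   (cmod (lcoef xi xi').1)^-1 <= s^-1 + 2).
Proof.
have s0 := sep_s sepZ; have sA := sep_sA sepZ; have A1 := sep_A sepZ.
have si : 0 < s^-1 by rewrite invr_gt0.
case: xi => [c|]; case: xi' => [c'|] /= Zc Zc'; last by left.
- have [->|cc] := eqVneq c c'; [by left; rewrite subrr|right].
  have := sep_dist sepZ Zc Zc' cc; rewrite cmodBC => d.
  rewrite subr_eq0 eq_sym cc cmod1 mul1r; split=> //; split; first by lra.
  apply: (@le_trans _ _ s^-1); last by lra.
  by rewrite lef_pV2 ?posrE//; lra.
- right; rewrite oner_neq0 cmodN cmod1 invr1; split=> //; split; last by lra.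
  have := sep_fin sepZ Zc; have := cmod_ge0 c; nra.
- right; rewrite oner_neq0 cmod0 mul0r cmod1 invr1; split=> //; split; lra.
Qed.

(** Dividing by [(u + w v_1) v_2]: either [u = 0] and this is a shift, or the
    factor [u + w v_1] is invertible on the disc of radius [s]. *)
Lemma lform_quotient_bnd T xi xi' K tau M : Z xi -> Z xi' -> 0 <= M ->
  bnd (rad T xi') lw (eps + tau) (msmul (mscomp (lform xi) (blowup n xi')) K) M ->
  bnd (rad T xi') lw tau K (2 * (s^-1 + 2) * expR (T * eps) * M).
Proof.
move=> Zxi Zxi' M0 Xb.
have s0 := sep_s sepZ; have si : 0 < s^-1 by rewrite invr_gt0.
have rg := rad_gt0 sepZ T xi'; have W0 v := Wt_gt0 v rg.
have r0 : rad T xi' i0 = s by rewrite /rad eqxx.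
have r1 : rad T xi' i1 = sigma A xi' * expR (- T * eps) by rewrite /rad /= (sep_w1 sepZ).
have l1 : lw i1 = eps by rewrite /lw /= (sep_w1 sepZ).
have l0 : lw i0 = 0 by rewrite /lw eqxx.
have sg := sigma_ge1 sepZ xi'.
have e0 : 0 < expR (T * eps) := expR_gt0 _.
have r1V : (rad T xi' i1)^-1 <= expR (T * eps).
  rewrite r1 invfM mulNr expRN invrK -[leRHS]mul1r ler_wpM2r ?(ltW e0)//.
  by rewrite invf_le1// (lt_le_trans ltr01).
have r1_gt0 : 0 < rad T xi' i1 := rg i1.
set Q := 2 * (s^-1 + 2) * expR (T * eps) * M.
have XE v := lform_comp xi xi' K v.
case: (lcoef_cases Zxi Zxi') => [E|[u0 [wu ui]]].
  move=> v vt; have := XE (mbasis i0 + (mbasis i1 + v)); rewrite E.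
  rewrite mul0r add0r mul1r !msvar_mulS => XEv.
  have := Xb (mbasis i0 + (mbasis i1 + v)); rewrite XEv !wtD !wt_basis l0 l1 add0r ltrD2l vt.
  move=> /(_ isT); rewrite !WtD !Wt_basis r0 => h.
  have -> : cmod (K v) * Wt (rad T xi') v = s^-1 * ((rad T xi' i1)^-1 *
      (cmod (K v) * (s * (rad T xi' i1 * Wt (rad T xi') v)))).
    by field; rewrite !gt_eqF.
  apply: (@le_trans _ _ (s^-1 * (expR (T * eps) * M))).
    rewrite ler_wpM2l ?(ltW si)// ler_pM ?invr_ge0 ?(ltW r1_gt0)//.
    rewrite mulr_ge0 ?cmod_ge0// mulr_ge0 ?(ltW s0)//.
    by rewrite mulr_ge0 ?(ltW r1_gt0) ?(ltW (W0 v)).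
  rewrite /Q -!mulrA; have : 0 <= expR (T * eps) * M by rewrite mulr_ge0// ltW.
  nra.
set u := (lcoef xi xi').1 in u0 wu ui; set z := (lcoef xi xi').2 in wu.
have XE' v : msmul (mscomp (lform xi) (blowup n xi')) K v =
    u * msmul (msvar i1) K v + z * msmul (msvar i0) (msmul (msvar i1) K) v.
  by have := XE v; rewrite /u /z; case: (lcoef xi xi').
have cu : 0 < cmod u by rewrite cmod_gt0.
have Q2 : (cmod u)^-1 * expR (T * eps) * M <= Q / 2.
  rewrite /Q -!mulrA; have : 0 <= expR (T * eps) * M by rewrite mulr_ge0// ltW.
  nra.
have Q0 : 0 <= Q by rewrite /Q !mulr_ge0 ?(ltW e0)// addr_ge0// ltW.
move=> v; have [N] := ubnP (v i0); elim: N v => // N IH v vN vt.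
have := Xb (mbasis i1 + v); rewrite wtD wt_basis l1 ltrD2l vt => /(_ isT).
rewrite WtD Wt_basis => Xv.
have Xv' : cmod (msmul (mscomp (lform xi) (blowup n xi')) K (mbasis i1 + v)) *
    Wt (rad T xi') v <= expR (T * eps) * M.
  apply: (@le_trans _ _ ((rad T xi' i1)^-1 * M)); last by rewrite ler_wpM2r.
  by rewrite ler_pdivlMl// mulrCA.
have rec : cmod (z * msmul (msvar i0) (msmul (msvar i1) K) (mbasis i1 + v)) *
    Wt (rad T xi') v <= cmod u / 2 * Q.
  have [[v' vE]|v0] := mpred_spec i0 v; last first.
    rewrite msvar_mul0; last by rewrite mindexD basis0 v0.
    rewrite mulr0 cmod0 mul0r; apply: mulr_ge0 => //.
    by rewrite divr_ge0 ?cmod_ge0.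
  rewrite vE addrCA !msvar_mulS WtD Wt_basis r0 cmodM.
  have : cmod (K v') * Wt (rad T xi') v' <= Q.
    apply: IH; first by rewrite vE mindexD basis0 in vN.
    by move: vt; rewrite vE wtD wt_basis l0 add0r.
  move=> h; have -> : cmod z * cmod (K v') * (s * Wt (rad T xi') v') =
     (cmod z * s) * (cmod (K v') * Wt (rad T xi') v') by ring.
  by rewrite ler_pM ?mulr_ge0 ?cmod_ge0 ?(ltW s0) ?(ltW (W0 v')).
have -> : K v = u^-1 * (msmul (mscomp (lform xi) (blowup n xi')) K (mbasis i1 + v) -
    z * msmul (msvar i0) (msmul (msvar i1) K) (mbasis i1 + v)).
  by rewrite XE' msvar_mulS addrK mulKf.
rewrite cmodM cmodV -mulrA ler_pdivrMl//.
apply: (@le_trans _ _ (expR (T * eps) * M + cmod u / 2 * Q)).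
  apply: le_trans (lerD Xv' rec); rewrite -mulrDl ler_wpM2r ?(ltW (W0 v))//.
  exact: cmodB.
have : expR (T * eps) * M <= cmod u * (Q / 2).
  by rewrite -ler_pdivrMl// mulrA.
lra.
Qed.

(** The remainder is the value of [f] at [xi], extended as a pure power of a
    coordinate.  In the chart at [xi] it is the part of [F xi] without [v_1],
    since the linear form vanishes there; the radii make the bound on it valid
    in the other charts. *)
Lemma divisor_lform xi : Z xi -> divisor (lform xi) eps (4 * (s^-1 + 2)) (ldiv xi).
Proof.
move=> Zxi; have s0 := sep_s sepZ; have si : 0 < s^-1 by rewrite invr_gt0.
split; first by rewrite mulr_ge0// addr_ge0// ltW.
- exact: ldivB.
- move=> tau f f0 k kt; case: xi Zxi => [c|] _ /=; last first.
    by apply: f0; rewrite wtD wt_basis (sep_w0 sepZ) ltrD2l.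
  apply: big1 => l _; rewrite f0 ?mulr0//.
  suff -> : wt w (mset k (k i0 - l) (k i1 + l).+1) = eps + wt w k by rewrite ltrD2l.
  rewrite !wt_split mset0 mset1 (sep_w0 sepZ) (sep_w1 sepZ).
  have -> : \sum_(j < n.+2 | (j != i0) && (j != i1))
      (mset k (k i0 - l) (k i1 + l).+1 j)%:R * w j =
      \sum_(j < n.+2 | (j != i0) && (j != i1)) (k j)%:R * w j.
    by apply: eq_bigr => j /andP[j0 j1]; rewrite mset_other.
  by rewrite natrB -1?ltnS ?ltn_ord// -natr1 natrD; ring.
move=> T f F K fFK tau M M0 Fb xi' Zxi'.
have br := @blowup_raising R n xi'.
have rg := rad_gt0 sepZ T xi'; have rg0 := rad_gt0 sepZ T xi.
pose K' v := K xi' v - mscomp (ldiv xi f) (blowup n xi') v.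
have Eb : bnd (rad T xi') lw (eps + tau) (mscomp (lrem xi f) (blowup n xi')) M.
  move=> v vt; rewrite (@mscomp_axis _ _ xi); last exact: lrem_axis.
  pose v0 := mset v 0 (v i1).
  have ax : axis_of xi v = axis_of xi v0.
    case: (xi) => [c|]; rewrite /axis_of /v0 mset1; apply/mset_eqP;
      rewrite mset0 mset1; split=> //; split=> // j j0 j1; by rewrite !mset_other.
  have lv0 : wt lw v0 = wt lw v.
    rewrite !wt_split /v0 mset0 mset1 /lw eqxx !mulr0 !add0r; congr (_ + _).
    by apply: eq_bigr => j /andP[j0 j1]; rewrite mset_other.
  have h1 : cmod (lrem xi f (axis_of xi v)) * Wt (rad T xi) v0 <= M.
    rewrite ax -lform_own_chart; last by rewrite /v0 mset0.
    rewrite fFK//.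
    have -> : msmul (mscomp (lform xi) (blowup n xi)) (K xi) v0 = 0.
      have := lform_comp xi xi (K xi) v0.
      case: (xi) => [c|] /= ->; rewrite ?subrr mul0r add0r mul1r;
        by rewrite msvar_mul0// /v0 mset0.
    by rewrite addr0; apply: Fb => //; rewrite lv0.
  apply: le_trans h1; rewrite cmodM -mulrA ler_wpM2l ?cmod_ge0//.
  have kg i : 0 <= kappa s A xi' i * expR (- T * w i).
    by rewrite mulr_ge0 ?expR_ge0// (kappa_ge0 sepZ).
  have := @bnd_mspow _ _ (rad T xi') lw (blowup n xi') _ w kg (bnd_blowup sepZ Zxi')
    (axis_of xi v) (wt lw v - wt w (axis_of xi v) + 1) _ 1 ler01 (@bnd1 R n.+2 (rad T xi') lw _).
  rewrite msmulC msmul1 => /(_ v) /(_ _)/wrap[|h]; first by lra.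
  apply: le_trans h _; rewrite mulr1 Wt_scale.
  rewrite (Wt_rad _ _ _ _ _ v0) lv0 (wt_level sepZ (axis_of_level xi v)).
  rewrite ler_wpM2r ?expR_ge0//.
  have A0 := A_gt0 sepZ.
  have kj j : j != i0 -> j != i1 -> kappa s A xi' j = 1.
    by move=> /negPf j0 /negPf j1; rewrite /kappa j0 j1.
  have sj j : j != i0 -> j != i1 -> sigma_rad s A xi j = 1.
    by move=> /negPf j0 /negPf j1; rewrite /sigma_rad j0 j1.
  rewrite /v0 (Wt_mset _ _ _ sj) expr0 mul1r /sigma_rad /=.
  have sA : s * A <= 1 by have := sep_sA sepZ; have := mulr_gt0 s0 A0; lra.
  have sA0 : 0 <= s * A by rewrite mulr_ge0 ?ltW.
  case: (xi) => [c|] /=; rewrite (Wt_mset _ _ _ kj) expr0 ?mulr1 ?mul1r /kappa /=.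
    rewrite expr1n; case: (xi') => [c'|]; first by rewrite expr1n.
    by rewrite exprn_ile1.
  case: (xi') Zxi' => [c'|] Zxi'' //.
  apply: lerXn2r; rewrite ?nnegrE ?(ltW A0)//; last exact: (sep_fin sepZ Zxi'').
  by rewrite addr_ge0 ?cmod_ge0 ?(ltW s0).
have Xb : bnd (rad T xi') lw (eps + tau)
    (msmul (mscomp (lform xi) (blowup n xi')) K') (2 * M).
  apply: (@eq_bnd _ _ _ _ _ (fun v => mscomp (lrem xi f) (blowup n xi') v - F xi' v)).
    move=> v; rewrite /K' msmulBr; have := fFK _ Zxi' v.
    rewrite {1}(_ : f = fun k => msmul (lform xi) (ldiv xi f) k + lrem xi f k); last first.
      by apply/funext => k; exact: lform_div.
    rewrite (mscompD br) (mscompM br) => e; apply/eqP; rewrite -subr_eq0; apply/eqP.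
    by move/eqP: e; rewrite -subr_eq0 => /eqP <-; ring.
  have -> : 2 * M = M + M by ring.
  by apply: bndB => //; exact: Fb.
have M2 : 0 <= 2 * M by rewrite mulr_ge0.
apply: bnd_le (lform_quotient_bnd Zxi Zxi' M2 Xb) => //.
by rewrite le_eqVlt; apply/orP; left; apply/eqP; ring.
Qed.

End LinearForms.

(** * Bounds for the division by a binary form *)

Section Block.
Variables (R : realType) (n : nat).
Local Notation C := (cplx R).
Local Notation series := (fpseries R n.+2).
Local Notation idx := (mindex n.+2).
Local Notation i0 := (i0 n).
Local Notation i1 := (i1 n).
Local Notation lform := (@lform R n).
Implicit Types (F K f g : series) (k v p a : idx) (xi : proj_line R).

(** Every homogeneous component of [f] in [x_1, x_2] vanishes at the point [xi]:
    the exceptional divisor is [v_2 = 0], and [v_1 = 0] is the point [xi] on it. *)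
Definition root_at xi f : Prop :=
  forall v, v i0 = 0%N -> mscomp f (blowup n xi) v = 0.

Lemma root_lrem xi f : root_at xi f -> forall k, f k = msmul (lform xi) (ldiv xi f) k.
Proof.
move=> rf k; rewrite [LHS](lform_div xi) -[RHS]addr0; congr (_ + _).
have [//|ax] := eqVneq (lrem xi f k) 0; have kax := lrem_axis ax.
have kE : k = axis_of xi (mset k 0 (k i0 + k i1)).
  apply: axis_of_uniq => //; split; rewrite ?mset1// => j j0 j1.
  by rewrite mset_other.
by rewrite kE -lform_own_chart ?mset0// rf ?mset0.
Qed.

Lemma root_lrem0 xi f : (forall k, axis xi k -> lrem xi f k = 0) -> root_at xi f.
Proof.
move=> f0 v v0; rewrite lform_own_chart//; apply: f0; exact: axis_ofP.
Qed.

Lemma root_mul xi f g : root_at xi g -> root_at xi (msmul f g).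
Proof.
move=> rg v v0; rewrite (mscompM (@blowup_raising R n xi)).
rewrite (@msmulE _ _ (mdeg v).+1); last by move=> i; exact: mdeg_bound.
apply: big1 => b _; apply: big1 => c /eqP bc; rewrite rg ?mulr0//.
have := congr1 (fun m : idx => m i0) bc.
by rewrite mindexD v0 => /eqP; rewrite addn_eq0 => /andP[_ /eqP].
Qed.

Lemma lrem_fin_eval c f k : k i1 = 0%N -> lrem (PFin c) f k =
  \sum_(l < (k i0).+1) c ^+ l * f (mset k (k i0 - l) l).
Proof.
move=> k1; rewrite /lrem lform_fin msvar_mul0// sub0r opprK big_ord_recl expr0 mul1r subn0.
rewrite (_ : mset k (k i0) 0 = k); last by apply/esym/mset_eqP.
congr (_ + _); have [[k' kE]|k0] := mpred_spec i0 k; last first.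
  by rewrite msvar_mul0// mulr0 k0 big_ord0.
have e0 : k i0 = (k' i0).+1 by rewrite kE mindexD basis0.
have e1 : k' i1 = 0%N by rewrite -k1 kE mindexD basis1.
rewrite [in LHS]kE msvar_mulS /= e0 e1 mulr_sumr; apply: eq_bigr => l _.
rewrite /bump /= add1n exprS mulrA subSS add0n; congr (_ * f _).
apply/mset_eqP; rewrite mset0 mset1; split=> //; split=> // j j0 j1.
by rewrite mset_other// kE mindexD ffunE (negPf j0).
Qed.

Lemma lrem_inf_eval f k : k i0 = 0%N -> lrem PInf f k = f k.
Proof. by move=> k0; rewrite /lrem msvar_mul0// subr0. Qed.

Definition bihomogeneous N a f := forall k, f k != 0 ->
  (k i0 + k i1 = N)%N /\ forall j, j != i0 -> j != i1 -> k j = a j.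

Lemma bihomogeneous_ldiv xi N a f : bihomogeneous N.+1 a f -> bihomogeneous N a (ldiv xi f).
Proof.
move=> fb k; case: xi => [c|] /=; last first.
  move=> /fb[]; rewrite !mindexD basis0 basis1 /= add1n addSn add0n => -[<-] kj.
  by split=> // j j0 j1; rewrite -kj// mindexD ffunE (negPf j0).
move=> S0; have [l lP] : exists l : 'I_(k i0).+1, f (mset k (k i0 - l) (k i1 + l).+1) != 0.
  apply/not_existsP => al; move: S0; rewrite big1 ?eqxx// => l _.
  by have /negP := al l; rewrite negbK => /eqP ->; rewrite mulr0.
have [+ kj] := fb _ lP; rewrite mset0 mset1 addnS => -[E]; split.
  by rewrite -E addnCA subnK ?(addnC (k i1))// -ltnS.
by move=> j j0 j1; rewrite -kj// mset_other.
Qed.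

(** Either [x_1] divides the form, which then vanishes at infinity, or its
    dehomogenization has degree [N.+1] and a root in the algebraically closed
    field. *)
Lemma bihomogeneous_root N a f : bihomogeneous N.+1 a f -> exists xi, root_at xi f.
Proof.
move=> fb; have [f0|fN] := eqVneq (f (mset a 0 N.+1)) 0.
  exists PInf; apply: root_lrem0 => k k0; rewrite lrem_inf_eval//.
  apply/eqP/negPn/negP => fk; have [+ kj] := fb _ fk; rewrite k0 add0n => k1.
  move: fk; rewrite (_ : k = mset a 0 N.+1) ?f0 ?eqxx//.
  by apply/mset_eqP.
pose p : {poly C} := \poly_(l < N.+2) f (mset a (N.+1 - l) l).
have sp : size p = N.+2.
  by rewrite size_poly_eq// subnn.
have /closed_rootP[c /rootP pc] : size p != 1%N by rewrite sp.
exists (PFin c); apply: root_lrem0 => k k1; rewrite lrem_fin_eval//.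
have [/andP[/eqP k0 /forallP kj]|nk] :=
    boolP ((k i0 == N.+1) && [forall j, (j != i0) ==> (j != i1) ==> (k j == a j)]).
  transitivity p.[c]; last exact: pc.
  rewrite horner_poly k0; apply: eq_bigr => l _; rewrite mulrC; congr (f _ * _).
  apply/mset_eqP; rewrite mset0 mset1; split=> //; split=> // j j0 j1.
  by rewrite mset_other//; have := kj j; rewrite j0 j1 => /eqP.
apply: big1 => l _; apply/eqP; rewrite mulf_eq0; apply/orP; right.
apply/negPn/negP => /fb[]; rewrite mset0 mset1 subnK -1?ltnS// => k0 kj.
move/negP: nk; apply; rewrite k0 eqxx /=; apply/forallP => j.
apply/implyP => j0; apply/implyP => j1; apply/eqP.
by rewrite -kj// mset_other.
Qed.

Section Divisor.
Variables (Z : set (proj_line R)) (s A eps : R) (w : 'I_n.+2 -> R).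
Hypothesis sepZ : separated Z s A eps w.
Local Notation divisor := (divisor Z s A w).

Lemma divisor_eq U U' u u' c D : (forall k, U k = U' k) -> u = u' ->
  divisor U u c D -> divisor U' u' c D.
Proof. by move=> /funext <- <-. Qed.

Lemma divisor_monomial a : a i0 = 0%N -> a i1 = 0%N ->
  exists c D, divisor (msdelta R a) (wt w a) c D.
Proof.
elim/mindex_ind: a => [_ _|a j IH].
  exists (cmod 1)^-1, (fun f k => 1^-1 * f k).
  by apply: divisor_eq (divisor_const Z s A w (oner_neq0 C)) => //; rewrite wt0.
rewrite !mindexD basis0 basis1 => /eqP; rewrite addn_eq0 => /andP[jN0 /eqP a0].
move=> /eqP; rewrite addn_eq0 => /andP[jN1 /eqP a1].
have j0 : j != i0 by move: jN0; case: (j == i0).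
have j1 : j != i1 by move: jN1; case: (j == i1).
have [c [D cD]] := IH a0 a1; exists (1 * c), (fun f => D (fun k => f (mbasis j + k))).
have := divisorM (@divisor_var _ _ Z s A w j j0 j1) cD; apply: divisor_eq.
  move=> k; have [[k' ->]|kj] := mpred_spec j k.
    rewrite msvar_mulS /msdelta; case: (eqVneq k' a) => [->|ka]; first by rewrite eqxx.
    by case: eqP => // /mindex_addI/eqP; rewrite (negPf ka).
  rewrite msvar_mul0// /msdelta; case: eqP => // kE.
  by move: kj; rewrite kE mindexD ffunE eqxx.
by rewrite wtD wt_basis.
Qed.

(** A binary form splits into linear forms, which are divided out one at a time;
    the hypothesis on [Z] provides the charts at all their zeros. *)
Lemma divisor_bihomogeneous N a f : a i0 = 0%N -> a i1 = 0%N ->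
  (exists k, f k != 0) -> bihomogeneous N a f -> (forall xi, root_at xi f -> Z xi) ->
  exists c D, divisor f (N%:R * eps + wt w a) c D.
Proof.
move=> a0 a1; elim: N f => [|N IH] f [k fk] fb fZ.
  have supp k' : f k' != 0 -> k' = a.
    move=> /fb[/eqP]; rewrite addn_eq0 => /andP[/eqP k0 /eqP k1] kj.
    apply/ffunP => j; have [->|j0] := eqVneq j i0; first by rewrite k0 a0.
    by have [->|j1] := eqVneq j i1; [rewrite k1 a1|exact: kj].
  have fa : f a != 0 by rewrite -(supp _ fk).
  have [c [D cD]] := divisor_monomial a0 a1.
  exists ((cmod (f a))^-1 * c), (fun g => D (fun k => (f a)^-1 * g k)).
  have := divisorM (divisor_const Z s A w fa) cD; apply: divisor_eq.
    move=> k'; rewrite msconst_scale /msdelta; case: eqP => [->|ka]; first by rewrite mulr1.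
    rewrite mulr0; apply/esym/eqP/negPn/negP => /supp; exact: ka.
  by rewrite mul0r.
have [xi rxi] := bihomogeneous_root fb; have Zxi := fZ _ rxi.
have fE := root_lrem rxi.
have [|||c [D cD]] := IH (ldiv xi f).
- apply/not_existsP => d0; move/negP: fk; apply; rewrite fE.
  rewrite (@msmulE _ _ (mdeg k).+1); last by move=> i; exact: mdeg_bound.
  rewrite big1// => b _; rewrite big1// => e _.
  by have /negP := d0 (unbox e); rewrite negbK => /eqP ->; rewrite mulr0.
- exact: bihomogeneous_ldiv.
- move=> xi' rxi'; apply: fZ; rewrite (funext fE); exact: root_mul.
exists (4 * (s^-1 + 2) * c), (fun g => D (ldiv xi g)).
have := divisorM (divisor_lform sepZ Zxi) cD; apply: divisor_eq.
  by move=> k'; rewrite -fE.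
by rewrite -natr1; ring.
Qed.

End Divisor.
End Block.

(** * Bounds for the division by a perturbed form *)

Section Perturbation.
Variables (R : realType) (n : nat).
Local Notation C := (cplx R).
Local Notation series := (fpseries R n.+2).
Local Notation idx := (mindex n.+2).
Implicit Types (F K f g G : series) (k v p : idx) (xi : proj_line R).
Variables (Z : set (proj_line R)) (s A eps : R) (w : 'I_n.+2 -> R).
Hypothesis sepZ : separated Z s A eps w.
Variables (T r delta : R).
Hypotheses (T_ge0 : 0 <= T) (r_gt0 : 0 < r) (delta_gt0 : 0 < delta).
Hypothesis Tdelta : A * expR (- T * delta) / r <= 1 / 2.

Local Notation rad := (rad s A w T).
Local Notation lw := (lw w).
Local Notation chart_bnd := (chart_bnd Z s A w T).

Lemma kappa_le xi (i : 'I_n.+2) : Z xi -> kappa s A xi i <= A.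
Proof.
have A1 := sep_A sepZ; have s0 := sep_s sepZ; have sA := sep_sA sepZ.
have sA0 := mulr_gt0 s0 (A_gt0 sepZ).
move=> Zxi; rewrite /kappa; case: ifP => _; first by case: xi Zxi => [c|] _; lra.
case: ifP => _ //; case: xi Zxi => [c|] // Zc; exact: (sep_fin sepZ Zc).
Qed.

Lemma mspow_bnd xi : Z xi -> forall k tau K M, 0 <= M ->
  bnd (rad xi) lw tau K M ->
  bnd (rad xi) lw (wt w k + tau) (msmul (mspow (blowup n xi) k) K)
    (A ^+ mdeg k * expR (- T * wt w k) * M).
Proof.
move=> Zxi k tau K M M0 Kb.
have kg i : 0 <= kappa s A xi i * expR (- T * w i).
  by rewrite mulr_ge0 ?expR_ge0// (kappa_ge0 sepZ).
apply: bnd_le (@bnd_mspow _ _ (rad xi) lw (blowup n xi) _ w kg (bnd_blowup sepZ Zxi) k tau K M M0 Kb) => //.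
rewrite Wt_scale ler_wpM2r// ler_wpM2r ?expR_ge0// /Wt /mdeg -prodrXr.
apply: ler_prod => i _; rewrite exprn_ge0 ?(kappa_ge0 sepZ)//=.
by apply: lerXn2r; rewrite ?nnegrE ?(kappa_ge0 sepZ) ?(ltW (A_gt0 sepZ)) ?kappa_le.
Qed.

(** A series whose terms have weight at least [u], and more in proportion to the
    degree, acts with a norm of order [exp (- T u)]: the excess of weight turns
    the sum over its terms into a geometric series. *)
Lemma mscomp_mul_bnd G (u MG : R) : 0 <= MG ->
  (forall p, G p != 0 -> u + delta * (mdeg p)%:R <= wt w p) ->
  (forall p, cmod (G p) * r ^+ mdeg p <= MG) ->
  forall xi, Z xi -> forall tau K M, 0 <= M -> bnd (rad xi) lw tau K M ->
  bnd (rad xi) lw (u + tau) (msmul (mscomp G (blowup n xi)) K)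
    (MG * expR (- T * u) * 2 ^+ n.+2 * M).
Proof.
move=> MG0 Gw Gr xi Zxi tau K M M0 Kb v vt.
have br := @blowup_raising R n xi.
have W0 := Wt_gt0 v (rad_gt0 sepZ T xi).
have A0 := A_gt0 sepZ.
rewrite (@msmul_comp _ _ _ br (mdeg v).+1)//.
pose q := A * expR (- T * delta) / r.
have q0 : 0 <= q by rewrite divr_ge0 ?mulr_ge0 ?expR_ge0 ?ltW.
have term p : cmod (G p * msmul (mspow (blowup n xi) p) K v) * Wt (rad xi) v <=
    MG * expR (- T * u) * M * q ^+ mdeg p.
  have c0 : 0 <= MG * expR (- T * u) * M by rewrite !mulr_ge0 ?expR_ge0.
  have [->|Gp] := eqVneq (G p) 0; first by rewrite mul0r cmod0 mul0r mulr_ge0// exprn_ge0.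
  have Kp : bnd (rad xi) lw (u + tau - wt w p) K M.
    apply: bnd_le Kb => //; have := Gw p Gp.
    have : 0 <= delta * (mdeg p)%:R by rewrite mulr_ge0// ltW.
    lra.
  have := @mspow_bnd xi Zxi p _ _ _ M0 Kp; rewrite addrC subrK => /(_ v vt) h.
  rewrite cmodM -mulrA.
  have rp : 0 < r ^+ mdeg p by rewrite exprn_gt0.
  have hG : cmod (G p) <= MG / r ^+ mdeg p by rewrite ler_pdivlMr.
  apply: le_trans (ler_pM (cmod_ge0 _) _ hG h) _; first by rewrite mulr_ge0 ?cmod_ge0 ?ltW.
  have -> : MG * expR (- T * u) * M * q ^+ mdeg p = (MG / r ^+ mdeg p) *
      (A ^+ mdeg p * (expR (- T * u) * expR (- T * delta) ^+ mdeg p) * M).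
    rewrite /q expr_div_n exprMn; field; by rewrite gt_eqF.
  rewrite ler_wpM2l ?divr_ge0 ?(ltW rp)// ler_wpM2r// ler_wpM2l ?exprn_ge0 ?(ltW A0)//.
  rewrite -expRM_natr -expRD ler_expR -mulrA -mulrDr !mulNr lerN2 ler_wpM2l//.
  exact: Gw.
apply: (@le_trans _ _ (\sum_(b : box n.+2 (mdeg v).+1)
   MG * expR (- T * u) * M * \prod_i q ^+ b i)).
  rewrite -ler_pdivlMr//; apply: le_trans (cmod_sum _ _ _) _.
  rewrite ler_pdivlMr// mulr_suml; apply: ler_sum => b _.
  apply: le_trans (term (unbox b)) _.
  rewrite /mdeg -prodrXr le_eqVlt; apply/orP; left; apply/eqP.
  by congr (_ * _); apply: eq_bigr => i _; rewrite ffunE.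
rewrite -mulr_sumr -[leRHS]mulrA [2 ^+ _ * M]mulrC mulrA ler_wpM2l//.
  by rewrite !mulr_ge0 ?expR_ge0.
by apply: (@box_geometric _ _ _ (fun=> q)) => i; rewrite q0.
Qed.

Variables (P0 P1 : series) (u c MP : R) (D : series -> series).
Hypothesis P0div : divisor Z s A w P0 u c D.
Hypothesis P1w : forall p, P1 p != 0 -> u + delta + delta * (mdeg p)%:R <= wt w p.
Hypothesis P1r : forall p, cmod (P1 p) * r ^+ mdeg p <= MP.
Hypothesis small : c * (MP * expR (- T * delta) * 2 ^+ n.+2) <= 1 / 2.

Let MP_ge0 : 0 <= MP.
Proof. by apply: le_trans (P1r 0); rewrite mulr_ge0 ?cmod_ge0 ?exprn_ge0 ?ltW. Qed.

(** Division by [P0 + P1] is a fixed point problem for the division by [P0]; as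
    [P1] has larger weight, the iteration is stationary in each weight. *)
Fixpoint quot_iter f m : series :=
  if m is m'.+1 then D (fun k => f k - msmul P1 (quot_iter f m') k) else fun=> 0.

Lemma quot_iter_stable f m k : wt w k < m%:R * delta -> quot_iter f m.+1 k = quot_iter f m k.
Proof.
have [_ DB Dl _] := P0div.
elim: m k => [|m IH] k.
  by rewrite mul0r ltNge wt_ge0// => i; exact/ltW/(sep_w sepZ).
move=> km; apply/eqP; rewrite -subr_eq0; apply/eqP => /=.
rewrite -[LHS]/((fun k => _ - _) k) -DB.
apply: (Dl (m.+1%:R * delta)) km => {}k km.
have -> : f k - msmul P1 (quot_iter f m.+1) k - (f k - msmul P1 (quot_iter f m) k) =
    msmul P1 (fun k => quot_iter f m k - quot_iter f m.+1 k) k.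
  by rewrite msmulBr; ring.
rewrite (@msmulE _ _ (mdeg k).+1); last by move=> i; exact: mdeg_bound.
apply: big1 => b _; apply: big1 => e /eqP be.
have [->|Pb] := eqVneq (P1 (unbox b)) 0; first by rewrite mul0r.
rewrite IH ?subrr ?mulr0//.
have := congr1 (wt w) be; rewrite wtD => wE.
have := P1w Pb; have : 0 <= delta * (mdeg (unbox b))%:R by rewrite mulr_ge0// ltW.
have := delta_gt0; rewrite -natr1 mulrDl mul1r in km; lra.
Qed.

Definition quot f : series := fun k =>
  quot_iter f (Num.bound (wt w k / delta)) k.

Lemma quotE f m k : wt w k < m%:R * delta -> quot f k = quot_iter f m k.
Proof.
move=> km; rewrite /quot; set N := Num.bound _.
have kN : wt w k < N%:R * delta.
  rewrite -ltr_pdivrMr//; apply: archi_boundP; apply: divr_ge0 (ltW delta_gt0).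
  by apply: wt_ge0 => i; exact/ltW/(sep_w sepZ).
have stab a b : wt w k < a%:R * delta -> (a <= b)%N -> quot_iter f b k = quot_iter f a k.
  move=> ka; elim: b => [|b IH]; first by rewrite leqn0 => /eqP ->.
  rewrite leq_eqVlt => /orP[/eqP -> //|]; rewrite ltnS => ab.
  rewrite quot_iter_stable ?IH//; apply: lt_le_trans ka _.
  by rewrite ler_wpM2r ?(ltW delta_gt0)// ler_nat.
have [Nm|/ltnW mN] := leqP N m; first by rewrite (stab N m).
by rewrite (stab m N).
Qed.

(** By induction on [m], the [m]-th approximation satisfies the bound for all
    weights less than [m * delta].  In the step, dividing by [P0] costs the factor
    [c * expR (T * u)] and multiplying by [P1] gains more than that. *)
Lemma quot_bound f (F K : proj_line R -> series) (M : R) : 0 <= M ->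
  (forall xi, Z xi -> forall v, mscomp f (blowup n xi) v =
     F xi v + msmul (mscomp (fun k => P0 k + P1 k) (blowup n xi)) (K xi) v) ->
  (forall xi, Z xi -> forall v, cmod (F xi v) * Wt (rad xi) v <= M) ->
  forall xi, Z xi -> forall v,
    cmod (K xi v - mscomp (quot f) (blowup n xi) v) * Wt (rad xi) v <=
      2 * c * expR (T * u) * M.
Proof.
have [c0 DB Dl Dd] := P0div.
move=> M0 fFK Fb; pose Q := 2 * c * expR (T * u) * M.
have Q0 : 0 <= Q by rewrite /Q !mulr_ge0 ?expR_ge0.
have est m : forall tau, tau <= m%:R * delta ->
    chart_bnd tau (fun xi v => K xi v - mscomp (quot_iter f m) (blowup n xi) v) Q.
  elim: m => [|m IH] tau.
    rewrite mul0r => tau0 xi Zxi v vt.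
    have := wt_ge0 v (lw_ge0 sepZ); move: vt tau0; lra.
  move=> taum.
  pose F' xi v := F xi v + msmul (mscomp P1 (blowup n xi))
    (fun v => K xi v - mscomp (quot_iter f m) (blowup n xi) v) v.
  have fF' xi : Z xi -> forall v,
      mscomp (fun k => f k - msmul P1 (quot_iter f m) k) (blowup n xi) v =
      F' xi v + msmul (mscomp P0 (blowup n xi)) (K xi) v.
    move=> Zxi v; have br := @blowup_raising R n xi.
    rewrite (mscompB br) (mscompM br) fFK// /F' msmulBr (mscompD br) msmulDl; ring.
  pose th := MP * expR (- T * delta) * 2 ^+ n.+2.
  have th0 : 0 <= th.
    by apply: mulr_ge0; [apply: mulr_ge0 MP_ge0 (expR_ge0 _)|exact: exprn_ge0].
  pose M' := M + expR (- T * u) * th * Q.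
  have M'0 : 0 <= M'.
    apply: addr_ge0 M0 _; apply: mulr_ge0 Q0; apply: mulr_ge0 th0; exact: expR_ge0.
  have F'b : chart_bnd (u + tau) F' M'.
    move=> xi Zxi; apply: bndD; first exact: (rad_gt0 sepZ).
      by move=> v _; exact: Fb.
    have Kb : bnd (rad xi) lw (tau - delta)
        (fun v => K xi v - mscomp (quot_iter f m) (blowup n xi) v) Q.
      by apply: IH => //; rewrite -natr1 mulrDl mul1r in taum; lra.
    have := @mscomp_mul_bnd P1 (u + delta) MP MP_ge0 P1w P1r xi Zxi _ _ _ Q0 Kb.
    apply: bnd_le; first by lra.
    rewrite /th mulrDr expRD le_eqVlt; apply/orP; left; apply/eqP; ring.
  have := Dd T _ F' K fF' tau M' M'0 F'b.
  move=> h xi Zxi; apply: bnd_le (h xi Zxi) => //.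
  have -> : c * expR (T * u) * M' = Q / 2 + (c * th) * Q.
    have : expR (T * u) * expR (- T * u) = 1.
      by rewrite -expRD mulNr subrr expR0.
    rewrite /M' /Q mulrDr => e; congr (_ + _); first by field.
    by transitivity (c * th * (2 * c * expR (T * u) * M) * (expR (T * u) * expR (- T * u)));
      [ring|rewrite e mulr1].
  have : c * th * Q <= 1 / 2 * Q by rewrite ler_wpM2r.
  lra.
move=> xi Zxi v; pose m := Num.bound (wt lw v / delta).
have vm : wt lw v < m%:R * delta.
  rewrite -ltr_pdivrMr//; apply: archi_boundP; apply: divr_ge0 (ltW delta_gt0).
  exact: wt_ge0 (lw_ge0 sepZ).
have -> : mscomp (quot f) (blowup n xi) v = mscomp (quot_iter f m) (blowup n xi) v.
  have br := @blowup_raising R n xi; rewrite !(@mscompE _ _ _ br (mdeg v).+1)//.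
  apply: eq_bigr => p _; have [->|/mspow_level/(wt_level sepZ) pv] :=
    eqVneq (mspow (blowup n xi) (unbox p) v) 0; first by rewrite !mulr0.
  by rewrite (@quotE f m)// pv.
exact: (est m _ (lexx _) xi Zxi v vm).
Qed.

End Perturbation.

(** * Division by powers *)

Section Powers.
Variables (R : realType) (n : nat).
Local Notation C := (cplx R).
Local Notation series := (fpseries R n.+2).
Local Notation idx := (mindex n.+2).
Implicit Types (f g q G : series) (F K : proj_line R -> series) (v p : idx).
Variables (Z : set (proj_line R)) (s A eps : R) (w : 'I_n.+2 -> R).
Hypothesis sepZ : separated Z s A eps w.
Variables (T r delta : R).
Hypotheses (T_ge0 : 0 <= T) (r_gt0 : 0 < r) (delta_gt0 : 0 < delta).
Hypothesis Tdelta : A * expR (- T * delta) / r <= 1 / 2.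
Hypothesis delta_w : forall i, delta <= w i.

Local Notation rad := (rad s A w T).
Local Notation lw := (lw w).

Definition chart_bounded F : Prop :=
  exists2 M, 0 <= M & forall xi, Z xi -> forall v, cmod (F xi v) * Wt (rad xi) v <= M.

Lemma eq_chart_bounded F F' : (forall xi, Z xi -> forall v, F xi v = F' xi v) ->
  chart_bounded F -> chart_bounded F'.
Proof.
by move=> FF' [M M0 FM]; exists M => // xi Zxi v; rewrite -FF'//; exact: FM.
Qed.

Lemma chart_boundedN F : chart_bounded F -> chart_bounded (fun xi v => - F xi v).
Proof. by move=> [M M0 FM]; exists M => // xi Zxi v; rewrite cmodN; exact: FM. Qed.

Lemma chart_boundedD F F' : chart_bounded F -> chart_bounded F' ->
  chart_bounded (fun xi v => F xi v + F' xi v).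
Proof.
move=> [M M0 FM] [M' M'0 FM']; exists (M + M'); first exact: addr_ge0.
move=> xi Zxi v; apply: le_trans (lerD (FM xi Zxi v) (FM' xi Zxi v)).
by rewrite -mulrDl ler_wpM2r ?cmodD// ltW// Wt_gt0// => i; exact: (rad_gt0 sepZ).
Qed.

Lemma chart_bounded_mul G (MG : R) F : (forall p, cmod (G p) * r ^+ mdeg p <= MG) ->
  chart_bounded F ->
  chart_bounded (fun xi => msmul (mscomp G (blowup n xi)) (F xi)).
Proof.
move=> Gr [M M0 FM].
have MG0 : 0 <= MG.
  by apply: le_trans (Gr 0); rewrite mulr_ge0 ?cmod_ge0 ?exprn_ge0 ?ltW.
have Gw p : G p != 0 -> 0 + delta * (mdeg p)%:R <= wt w p.
  by move=> _; rewrite add0r; exact: wt_ge_mdeg.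
exists (MG * expR (- T * 0) * 2 ^+ n.+2 * M).
  by apply: mulr_ge0 M0; apply: mulr_ge0; [apply: mulr_ge0 MG0 (expR_ge0 _)|exact: exprn_ge0].
move=> xi Zxi v.
have Fb : bnd (rad xi) lw (wt lw v + 1) (F xi) M by move=> v' _; exact: FM.
have := @mscomp_mul_bnd _ _ _ _ _ _ _ sepZ T r delta T_ge0 r_gt0 delta_gt0 Tdelta
  G 0 MG MG0 Gw Gr xi Zxi _ _ _ M0 Fb.
by apply; rewrite add0r ltrDl.
Qed.

Variables (P0 P1 : series) (u c MP : R) (D : series -> series).
Hypothesis P0div : divisor Z s A w P0 u c D.
Hypothesis P1w : forall p, P1 p != 0 -> u + delta + delta * (mdeg p)%:R <= wt w p.
Hypothesis P1r : forall p, cmod (P1 p) * r ^+ mdeg p <= MP.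
Hypothesis small : c * (MP * expR (- T * delta) * 2 ^+ n.+2) <= 1 / 2.
Hypothesis Pr : forall p, cmod (P0 p + P1 p) * r ^+ mdeg p <= MP.

Local Notation P := (fun k => P0 k + P1 k).

(** The quotient of [f] by [P] differs from the pull-backs of the first division
    by bounded series, so that the division can be repeated on it. *)
Lemma power_quotient e f F K :
  (forall xi, Z xi -> forall v, mscomp f (blowup n xi) v =
     F xi v + msmul (mscomp (msexp P e) (blowup n xi)) (K xi) v) ->
  chart_bounded F ->
  exists q, chart_bounded (fun xi v => K xi v - mscomp q (blowup n xi) v).
Proof.
elim: e f F K => [|e IH] f F K fFK Fb.
  exists f; apply: eq_chart_bounded (chart_boundedN Fb) => xi Zxi v.
  rewrite fFK// /msexp /= (mscomp1 (@blowup_raising R n xi)) msmul1; ring.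
pose K' xi := msmul (mscomp (msexp P e) (blowup n xi)) (K xi).
have [M M0 FM] := Fb.
have := @quot_bound _ _ _ _ _ _ _ sepZ T r delta T_ge0 r_gt0 delta_gt0 Tdelta
  P0 P1 u c MP D P0div P1w P1r small f F K' M M0 => /(_ _ FM)/wrap[|qb].
  move=> xi Zxi v; rewrite fFK// /K' msmulA.
  by rewrite -(mscompM (@blowup_raising R n xi)).
set q1 := quot _ _ _ _ _ in qb.
apply: (IH q1 (fun xi v => - (K' xi v - mscomp q1 (blowup n xi) v))).
  by move=> xi Zxi v; rewrite opprB subrK.
apply: chart_boundedN; exists (2 * c * expR (T * u) * M); last exact: qb.
by have [c0 _ _ _] := P0div; rewrite !mulr_ge0 ?expR_ge0.
Qed.

Lemma chart_bounded_exp e F : chart_bounded F ->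
  chart_bounded (fun xi => msmul (mscomp (msexp P e) (blowup n xi)) (F xi)).
Proof.
move=> Fb; elim: e => [|e IH].
  apply: eq_chart_bounded Fb => xi Zxi v.
  by rewrite /msexp /= (mscomp1 (@blowup_raising R n xi)) msmul1.
apply: eq_chart_bounded (chart_bounded_mul Pr IH) => xi Zxi v.
by rewrite msmulA -(mscompM (@blowup_raising R n xi)).
Qed.

(** Dividing repeatedly turns the formal quotients in the charts into one series
    [q] on the base.  Subtracting [P ^ e q] from [f] leaves a series whose
    pull-backs are bounded at radii that do not depend on [e]. *)
Lemma power_remainder e f F K :
  (forall xi, Z xi -> forall v, mscomp f (blowup n xi) v =
     F xi v + msmul (mscomp (msexp P e) (blowup n xi)) (K xi) v) ->
  chart_bounded F ->
  exists q, chart_bounded (fun xi =>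
    mscomp (fun k => f k - msmul (msexp P e) q k) (blowup n xi)).
Proof.
move=> fFK Fb; have [q qb] := power_quotient fFK Fb; exists q.
apply: eq_chart_bounded (chart_boundedD Fb (chart_bounded_exp e qb)) => xi Zxi v.
have br := @blowup_raising R n xi.
rewrite (mscompB br) fFK// (mscompM br) msmulBr; ring.
Qed.

End Powers.

(** * Recovering coefficients from one chart *)

Section BlowDown.
Variables (R : realType) (n : nat).
Local Notation C := (cplx R).
Local Notation series := (fpseries R n.+2).
Local Notation idx := (mindex n.+2).
Local Notation i0 := (i0 n).
Local Notation i1 := (i1 n).
Implicit Types (g : series) (k v : idx).
Variables (xi : proj_line R) (rad : 'I_n.+2 -> R).
Hypothesis rad_gt0 : forall i, 0 < rad i.

(** One division by the linear form, followed by a multiplication, costs this factor. *)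
Definition bdown : R := (1 + (if xi is PFin c then cmod c else 0)) / rad i0 + 1.

Lemma bdown_ge1 : 1 <= bdown.
Proof.
rewrite lerDr divr_ge0 ?(ltW (rad_gt0 _))// addr_ge0//.
by case: xi => // c; exact: cmod_ge0.
Qed.

Lemma Wt_msetS k e : Wt rad (mset k 0 e.+1) = rad i1 * Wt rad (mset k 0 e).
Proof.
rewrite -[rad i1](Wt_basis rad) -WtD; congr Wt.
apply/esym/mset_eqP; rewrite !mindexD basis0 basis1 mset0 mset1; split=> //; split=> //.
by move=> j j0 j1; rewrite mindexD mset_other// ffunE (negPf j1).
Qed.

Lemma lform_coef K k (B : R) : 0 <= B ->
  (forall k', mset k' 0 (k' i0 + k' i1).+1 = mset k 0 (k i0 + k i1) -> cmod (K k') <= B) ->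
  cmod (msmul (lform xi) K k) <= (1 + (if xi is PFin c then cmod c else 0)) * B.
Proof.
move=> B0 KB.
have h0 : cmod (msmul (msvar i0) K k) <= B.
  have [[k' kE]|k0] := mpred_spec i0 k; last by rewrite msvar_mul0// cmod0.
  rewrite kE msvar_mulS; apply: KB; apply/mset_eqP; rewrite kE mset0 mset1 !mindexD !basis0 !basis1.
  by split=> //; split=> // j j0 j1; rewrite mset_other// mindexD ffunE (negPf j0).
have h1 : cmod (msmul (msvar i1) K k) <= B.
  have [[k' kE]|k0] := mpred_spec i1 k; last by rewrite msvar_mul0// cmod0.
  rewrite kE msvar_mulS; apply: KB; apply/mset_eqP; rewrite kE mset0 mset1 !mindexD !basis0 !basis1.
  split=> //; split; first by rewrite add0n addnCA.
  by move=> j j0 j1; rewrite mset_other// mindexD ffunE (negPf j1).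
case: (xi) => [c|]; last by rewrite addr0 mul1r.
rewrite lform_fin mulrDl mul1r; apply: le_trans (cmodD _ _) _.
by rewrite cmodN cmodM lerD// ler_wpM2l ?cmod_ge0.
Qed.

(** Coefficients are recovered from a single chart by dividing repeatedly by the
    linear form of that chart: the remainders are restrictions to [v_1 = 0]. *)
Lemma coef_from_chart g (M : R) :
  (forall v, cmod (mscomp g (blowup n xi) v) * Wt rad v <= M) ->
  forall k, cmod (g k) * Wt rad (mset k 0 (k i0 + k i1)) <= M * bdown ^+ (k i0 + k i1).
Proof.
move=> gM k; move: {2}(k i0 + k i1)%N (erefl (k i0 + k i1)%N) => e.
have b1 := bdown_ge1.
elim: e g M gM k => [|e IH] g M gM k ke.
all: have M0 : 0 <= M by apply: le_trans (gM 0); rewrite mulr_ge0 ?cmod_ge0// ltW// Wt_gt0.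
all: have rem : cmod (lrem xi g k) * Wt rad (mset k 0 (k i0 + k i1)) <= M.
  1,3: have [->|/lrem_axis ax] := eqVneq (lrem xi g k) 0; first by rewrite cmod0 mul0r.
  1,2: have kE : k = axis_of xi (mset k 0 (k i0 + k i1)) by
    apply: axis_of_uniq => //; split; rewrite ?mset1// => j j0 j1; rewrite mset_other.
  1,2: by rewrite {1}kE -lform_own_chart ?mset0.
- rewrite [in bdown ^+ _]ke expr0 mulr1; move: rem; rewrite /lrem.
  have /eqP := ke; rewrite addn_eq0 => /andP[/eqP k0 /eqP k1].
  rewrite (_ : msmul _ _ _ = 0) ?subr0//.
  case: (xi) => [c|]; first by rewrite lform_fin !msvar_mul0// mulr0 subrr.
  exact: msvar_mul0.
- have r0 := rad_gt0 i0; have r1 := rad_gt0 i1.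
  have dM v : cmod (mscomp (ldiv xi g) (blowup n xi) v) * Wt rad v <= M / (rad i0 * rad i1).
    rewrite ldiv_own_chart ler_pdivlMr ?mulr_gt0//.
    have := gM (mbasis i0 + (mbasis i1 + v)); rewrite !WtD !Wt_basis => h.
    by apply: le_trans h; rewrite le_eqVlt; apply/orP; left; apply/eqP; ring.
  have W0 : 0 < Wt rad (mset k 0 e) by exact: Wt_gt0.
  pose B := M / (rad i0 * rad i1) * bdown ^+ e / Wt rad (mset k 0 e).
  have B0 : 0 <= B.
    apply: divr_ge0 (ltW W0); apply: mulr_ge0; last by rewrite exprn_ge0// (le_trans ler01).
    by apply: divr_ge0 M0 _; exact/ltW/mulr_gt0.
  have dB k' : mset k' 0 (k' i0 + k' i1).+1 = mset k 0 (k i0 + k i1) -> cmod (ldiv xi g k') <= B.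
    move=> kk; have ke' : (k' i0 + k' i1)%N = e.
      have := congr1 (fun m : idx => m i1) kk.
      by rewrite !mset1 ke => -[].
    have kk' : mset k' 0 e = mset k 0 e.
      apply/mset_eqP; rewrite mset0 mset1; split=> //; split=> // j j0 j1.
      have := congr1 (fun m : idx => m j) kk.
      by rewrite !mset_other.
    rewrite /B ler_pdivlMr// -kk' -ke'; exact: IH.
  rewrite (lform_div xi g k); apply: le_trans (_ : (cmod (msmul (lform xi) (ldiv xi g) k) + cmod (lrem xi g k)) * Wt rad (mset k 0 (k i0 + k i1)) <= _).
    by rewrite ler_wpM2r ?cmodD// ltW// Wt_gt0.
  rewrite mulrDl; apply: le_trans (lerD _ rem) _.
    by apply: ler_wpM2r (lform_coef B0 dB); rewrite ltW// Wt_gt0.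
  rewrite ke Wt_msetS.
  set q := 1 + _; have -> : q * B * (rad i1 * Wt rad (mset k 0 e)) = M * bdown ^+ e * (q / rad i0).
    by rewrite /B; field; rewrite !gt_eqF.
  have bE : bdown = q / rad i0 + 1 by [].
  rewrite exprSr [in leRHS]mulrA [X in _ <= _ * X]bE mulrDr mulr1 lerD2l.
  by rewrite ler_peMr// exprn_ege1.
Qed.

Lemma chart_coef_bounded (r : R) g (M : R) : 0 < r ->
  (forall j, j != i0 -> bdown * r <= rad j) ->
  (forall v, cmod (mscomp g (blowup n xi) v) * Wt rad v <= M) ->
  forall k, cmod (g k) * r ^+ mdeg k <= M.
Proof.
move=> r0 rj gM k; have b1 := bdown_ge1.
have b0 : 0 < bdown by exact: lt_le_trans ltr01 b1.
have := coef_from_chart gM k; set e := (k i0 + k i1)%N => h.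
have be : 0 < bdown ^+ e by rewrite exprn_gt0.
rewrite -(ler_pM2r be); apply: le_trans h; rewrite -mulrA ler_wpM2l ?cmod_ge0//.
have -> : mdeg k = mdeg (mset k 0 e).
  rewrite !mdeg_split mset0 mset1 add0n addnA; congr (_ + _)%N.
  by apply: eq_bigr => j /andP[j0 j1]; rewrite mset_other.
suff key (p : idx) : p i0 = 0%N -> r ^+ mdeg p * bdown ^+ p i1 <= Wt rad p.
  by have := key (mset k 0 e); rewrite mset0 mset1; apply.
move=> p0.
have le1 : r ^+ mdeg p * bdown ^+ p i1 <= (bdown * r) ^+ mdeg p.
  rewrite exprMn mulrC ler_wpM2r ?exprn_ge0 ?(ltW r0)//.
  by apply: ler_weXn2l => //; exact: le_mdeg.
apply: le_trans le1 _; rewrite /mdeg -prodrXr /Wt; apply: ler_prod => j _.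
rewrite exprn_ge0 ?mulr_ge0 ?(ltW r0) ?(ltW b0)//=.
have [->|j0] := eqVneq j i0; first by rewrite p0.
by apply: lerXn2r; rewrite ?nnegrE ?mulr_ge0 ?(ltW (rad_gt0 j)) ?(ltW r0) ?(ltW b0) ?rj.
Qed.

End BlowDown.

(** * Minimal values of a positive linear form *)

Section Uniform.
Variables (R : realType).

(** This replaces the choice of a largest constant among finitely many. *)
Lemma fin_uniform (I : finType) (G : I -> R -> Prop) :
  (forall i M M', G i M -> M <= M' -> G i M') -> (forall i, exists M, G i M) ->
  exists2 M, 1 <= M & forall i, G i M.
Proof.
move=> Gup /choice[m Gm]; exists (1 + \sum_i `|m i|).
  by rewrite lerDl sumr_ge0.
move=> i; apply: Gup (Gm i) _; apply: le_trans (ler_norm _) _.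
rewrite (bigD1 i)//= addrCA lerDl addr_ge0// sumr_ge0//.
Qed.

End Uniform.

Section LinearForm.
Variables (R : realType) (n : nat) (L : {additive {ffun 'I_n -> nat} -> R}).
Hypotheses (L_ge0 : forall a, 0 <= L a) (L_inj : injective L).
Implicit Types (a b : mindex n).

Lemma L_wt a : L a = wt (fun j => L (mbasis j)) a.
Proof.
elim/mindex_ind: a => [|a j IH]; first by rewrite raddf0 wt0.
by rewrite raddfD IH wtD wt_basis.
Qed.

Lemma L_basis_gt0 j : 0 < L (mbasis j).
Proof.
rewrite lt_neqAle L_ge0 andbT; apply/eqP => L0.
have /ffunP/(_ j) : mbasis j = 0 :> mindex n by apply: L_inj; rewrite -L0 raddf0.
by rewrite !ffunE eqxx.
Qed.

(** The values of [L] at the unit vectors are bounded below, as there are finitely many. *)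
Lemma L_box (B : R) : exists N, forall a, L a <= B -> exists b : box n N, unbox b = a.
Proof.
have [||c c1 Lc] := @fin_uniform R 'I_n (fun j c => 0 < c /\ c^-1 <= L (mbasis j)).
- move=> j M M' [M0 LM] MM'; have M'0 := lt_le_trans M0 MM'; split=> //.
  by apply: le_trans LM; rewrite lef_pV2.
- move=> j; exists (L (mbasis j))^-1; rewrite invr_gt0 invrK lexx.
  by split=> //; exact: L_basis_gt0.
have c0 : 0 < c by exact: lt_le_trans ltr01 c1.
exists (Num.bound (`|c * B|)).+1 => a aB; apply: unbox_surj => j; rewrite ltnS.
apply: leq_trans (le_mdeg _ j) _; rewrite -(ler_nat R).
apply: le_trans (ltW (archi_boundP (normr_ge0 (c * B)))).
apply: le_trans (ler_norm _); rewrite -ler_pdivrMl//.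
apply: le_trans aB; rewrite L_wt; apply: wt_ge_mdeg => i; by have [] := Lc i.
Qed.

(** The values of a positive linear form on multi-indices are discrete, so that a
    nonempty set of multi-indices has a minimizer, separated by a gap. *)
Lemma discrete_min (S : mindex n -> Prop) : (exists a, S a) ->
  exists a, S a /\ exists2 eta, 0 < eta & forall b, S b -> b != a -> L a + eta <= L b.
Proof.
move=> [a1 Sa1]; have [N LN] := L_box (L a1 + 1).
have [b1 b1E] : exists b : box n N, unbox b = a1 by apply: LN; rewrite lerDl.
have Sb1 : `[< S (unbox b1) >] by apply/asboolP; rewrite b1E.
case: (@Order.TotalTheory.arg_minP _ R (box n N) b1
  (fun b : box n N => `[< S (unbox b) >]) (fun b : box n N => L (unbox b)) Sb1) => b0 /asboolP Sb0 b0min.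
exists (unbox b0); split=> //.
have b01 : L (unbox b0) <= L a1 by rewrite -b1E b0min.
have [||c c1 Lc] := @fin_uniform R (box n N) (fun (b : box n N) c => 0 < c /\
  (S (unbox b) -> unbox b != unbox b0 -> L (unbox b0) + c^-1 <= L (unbox b))).
- move=> b M M' [M0 LM] MM'; have M'0 := lt_le_trans M0 MM'; split=> // Sb bb.
  by apply: le_trans (LM Sb bb); rewrite lerD2l lef_pV2.
- move=> b; have [Sb|nSb] := pselect (S (unbox b)); last by exists 1; split.
  have [->|bb] := eqVneq (unbox b) (unbox b0); first by exists 1; split=> // _; rewrite eqxx.
  have Lbb : 0 < L (unbox b) - L (unbox b0).
    rewrite subr_gt0 lt_neqAle b0min ?andbT; last exact/asboolP.
    by apply: contra_neq bb => /L_inj.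
  by exists (L (unbox b) - L (unbox b0))^-1; rewrite invr_gt0 invrK; split=> // _ _; lra.
have c0 : 0 < c by exact: lt_le_trans ltr01 c1.
exists c^-1; first by rewrite invr_gt0.
move=> b Sb bb; have [Lb|Lb] := leP (L b) (L a1 + 1).
  have [b' b'E] := LN _ Lb; have [_] := Lc b'; rewrite b'E; exact.
have : c^-1 <= 1 by rewrite invf_le1.
move=> ?; apply: le_trans (ltW Lb); exact: lerD.
Qed.

End LinearForm.

Section Tail.
Variables (R : realType) (n : nat) (L : {additive {ffun 'I_n -> nat} -> R}).
Implicit Types (k : mindex n.+2).

Definition chart_weight (eps : R) (i : 'I_n.+2) : R :=
  match fintype.split (i : 'I_(2 + n)) with inl _ => eps | inr j => L (mbasis j) end.

Lemma chart_weight_l eps j : chart_weight eps (@lshift 2 n j) = eps.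
Proof. by rewrite /chart_weight (unsplitK (inl j)). Qed.

Lemma chart_weight_r eps j : chart_weight eps (@rshift 2 n j) = L (mbasis j).
Proof. by rewrite /chart_weight (unsplitK (inr j)). Qed.

Lemma i0_lshift : i0 n = @lshift 2 n ord0. Proof. exact: val_inj. Qed.
Lemma i1_lshift : i1 n = @lshift 2 n ord_max. Proof. exact: val_inj. Qed.

Lemma wt_chart_weight eps k : wt (chart_weight eps) k =
  (k (i0 n) + k (i1 n))%:R * eps + L (mtail k).
Proof.
rewrite /wt (@big_split_ord _ _ _ 2 n) /= !big_ord_recl big_ord0 addr0 L_wt /wt.
rewrite natrD mulrDl; congr (_ + _ + _).
- by rewrite chart_weight_l i0_lshift.
- rewrite chart_weight_l i1_lshift; congr ((k _)%:R * _); exact: val_inj.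
by apply: eq_bigr => j _; rewrite chart_weight_r ffunE.
Qed.

Lemma mtail_eqP k k' : (forall j, j != i0 n -> j != i1 n -> k j = k' j) <-> mtail k = mtail k'.
Proof.
split=> [kk|/ffunP kk].
  by apply/ffunP => j; rewrite !ffunE; apply: kk.
move=> j; case: (@fintype.splitP 2 n j) => i ji; last first.
  by move=> _ _; have := kk i; rewrite !ffunE; congr (_ = _); congr (_ _); apply: val_inj.
case: i ji => -[|[|//]] i2 ji j0 j1.
  by move/negP: j0; case; apply/eqP/val_inj.
by move/negP: j1; case; apply/eqP/val_inj.
Qed.

End Tail.

(** * The initial part and its zeros *)

Section Initial.
Variables (R : realType) (n : nat).
Local Notation C := (cplx R).
Local Notation series := (fpseries R n.+2).
Local Notation idx := (mindex n.+2).
Local Notation i0 := (i0 n).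
Local Notation i1 := (i1 n).
Implicit Types (k : idx) (p : mindex 2) (b : mindex n) (xi : proj_line R).

Lemma mcat0 p b : mcat p b i0 = p ord0.
Proof. by rewrite ffunE i0_lshift (unsplitK (inl _)). Qed.

Lemma mcat1 p b : mcat p b i1 = p ord_max.
Proof. by rewrite ffunE i1_lshift (unsplitK (inl _)). Qed.

Lemma mtail_mcat p b : mtail (mcat p b) = b.
Proof. by apply/ffunP => j; rewrite !ffunE (unsplitK (inr _)). Qed.

Lemma mset_mcat k p b : mset k (p ord0) (p ord_max) = mcat p b <-> mtail k = b.
Proof.
split=> [kE|kb].
  rewrite -(mtail_mcat p b) -kE; apply/mtail_eqP => j j0 j1.
  by rewrite mset_other.
apply/esym/mset_eqP; rewrite mcat0 mcat1; split=> //; split=> //.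
by apply/mtail_eqP; rewrite mtail_mcat.
Qed.

Lemma mdeg2 p : mdeg p = (p ord0 + p ord_max)%N.
Proof.
rewrite /mdeg !big_ord_recl big_ord0 addn0; congr (_ + p _)%N; exact: val_inj.
Qed.

Definition mpair (x y : nat) : mindex 2 := [ffun i => if i == ord0 then x else y].

Lemma mpair0 x y : mpair x y ord0 = x. Proof. by rewrite ffunE. Qed.

Lemma mpair1 x y : mpair x y ord_max = y. Proof. by rewrite ffunE. Qed.

Lemma mpairK p : mpair (p ord0) (p ord_max) = p.
Proof.
apply/ffunP => -[[|[|//]] i]; rewrite ffunE; congr (p _); exact: val_inj.
Qed.

Lemma lowest_degreeP (F : fpseries R 2) : (exists p, F p != 0) ->
  (exists2 p, F p != 0 & mdeg p = lowest_degree F) /\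
  forall p, F p != 0 -> (lowest_degree F <= mdeg p)%N.
Proof.
move=> [p0 Fp0].
apply: (@xgetPex _ 0%N [set e | (exists2 p, F p != 0 & mdeg p = e) /\
  (forall p, F p != 0 -> (e <= mdeg p)%N)]).
have ex : exists e, `[< exists2 p, F p != 0 & mdeg p = e >].
  by exists (mdeg p0); apply/asboolP; exists p0.
case: (ex_minnP ex) => e /asboolP[p Fp pe] emin; exists e; split; first by exists p.
by move=> q Fq; apply: emin; apply/asboolP; exists q.
Qed.

Variables (P : series) (L : {additive {ffun 'I_n -> nat} -> R}).
Hypotheses (P_neq0 : P <> mszero) (L_ge0 : forall a, 0 <= L a) (L_inj : injective L).

Local Notation a := (min_exponent P L).
Local Notation N := (lowest_degree (PL P L)).

Lemma min_exponentP : (exists2 k, P k != 0 & mtail k = a) /\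
  exists2 eta, 0 < eta & forall k, P k != 0 -> mtail k != a -> L a + eta <= L (mtail k).
Proof.
have [k0 Pk0] : exists k, P k != 0.
  apply/not_existsP => P0; apply: P_neq0; apply/funext => k.
  by have /negP := P0 k; rewrite negbK => /eqP.
have [|b [[k Pk kb] [eta eta0 gap]]] :=
    @discrete_min R n L L_ge0 L_inj (fun b => exists2 k, P k != 0 & mtail k = b).
  by exists (mtail k0), k0.
have gap' k' : P k' != 0 -> mtail k' != b -> L b + eta <= L (mtail k').
  by move=> Pk'; apply: gap; exists k'.
have aE : a = b.
  have [|[k' Pk' k'a] amin] := @xgetPex _ 0 [set b | (exists2 m, P m != 0 & mtail m = b) /\
      (forall m, P m != 0 -> L b <= L (mtail m))].
    exists b; split; first by exists k.
    move=> m Pm; have [->//|mb] := eqVneq (mtail m) b.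
    by apply: le_trans (gap' _ Pm mb); rewrite lerDl ltW.
  apply/eqP/negPn/negP => ab; have := gap' _ Pk'; rewrite k'a => /(_ ab).
  have := amin _ Pk; rewrite kb /min_exponent; lra.
rewrite aE; split; [by exists k|by exists eta].
Qed.

Lemma PL_lowest : (exists2 p, PL P L p != 0 & mdeg p = N) /\
  forall p, PL P L p != 0 -> (N <= mdeg p)%N.
Proof.
apply: lowest_degreeP; have [[k Pk ka] _] := min_exponentP.
exists (mpair (k i0) (k i1)); rewrite /PL (_ : mcat _ _ = k)//.
by rewrite -(proj2 (mset_mcat k _ _) ka) mpair0 mpair1 mset_id.
Qed.

Definition in_init k := (mtail k == a) && (k i0 + k i1 == N)%N.

(** The terms of [P] with the minimal exponent of [x''] and of lowest degree in
    [x_1, x_2]: the binary form [HL P L] times a monomial in [x'']. *)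
Definition init_part : series := fun k => if in_init k then P k else 0.

Definition rest_part : series := fun k => if in_init k then 0 else P k.

Lemma init_rest k : init_part k + rest_part k = P k.
Proof. by rewrite /init_part /rest_part; case: ifP; rewrite (addr0, add0r). Qed.

Let a' : idx := mcat 0 a.

Lemma init_bihomogeneous : bihomogeneous N a' init_part.
Proof.
move=> k; rewrite /init_part /in_init; case: ifP => [|_]; last by rewrite eqxx.
move=> /andP[/eqP ka /eqP kN] _; split=> //.
by apply/mtail_eqP; rewrite mtail_mcat.
Qed.

Lemma init_neq0 : exists k, init_part k != 0.
Proof.
have [[p Pp pN] _] := PL_lowest; exists (mcat p a).
by rewrite /init_part /in_init mtail_mcat mcat0 mcat1 -mdeg2 pN !eqxx.
Qed.

Lemma HL_init x y : HL P L (mpair x y) = init_part (mset a' x y) * (x + y == N)%N%:R.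
Proof.
rewrite /HL /lowest_form mdeg2 mpair0 mpair1 /init_part /in_init mset0 mset1.
case: eqP => _; last by rewrite mulr0.
rewrite andbT mulr1.
have mE : mset a' x y = mcat (mpair x y) a.
  by have := proj2 (mset_mcat a' (mpair x y) a); rewrite mpair0 mpair1; apply; rewrite mtail_mcat.
by rewrite mE mtail_mcat eqxx.
Qed.

Lemma eval2_HL (z w : C) : eval2 (HL P L) z w =
  \sum_(l < N.+1) init_part (mset a' (N - l) l) * z ^+ (N - l) * w ^+ l.
Proof.
rewrite /eval2 (@fsbigE _ _ _ _ _ [seq mpair (N - l) l | l : 'I_N.+1 <- enum 'I_N.+1])//.
- rewrite big_map (eq_bigl xpredT); last by move=> l; exact: in_setT.
  rewrite big_enum; apply: eq_bigr => l _.
  have lN : (l <= N)%N by rewrite -ltnS ltn_ord.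
  by rewrite HL_init (subnK lN) eqxx mulr1 mpair0 mpair1.
- rewrite map_inj_uniq ?enum_uniq// => l l' /ffunP/(_ ord_max).
  by rewrite !ffunE /= => /val_inj.
move=> p _ pr; rewrite -[p]mpairK HL_init.
case: eqP => [pN|_]; last by rewrite mulr0 !mul0r.
case/negP: pr; apply/mapP; have lt : (p ord_max < N.+1)%N by rewrite ltnS -pN leq_addl.
by exists (Ordinal lt); rewrite ?mem_enum//= -pN addnK mpairK.
Qed.

Lemma root_eval2 xi : root_at xi init_part -> projective_zeros (HL P L) xi.
Proof.
move=> rxi; case: xi rxi => [c|] /= rxi; rewrite eval2_HL.
  have := rxi (mset a' 0 N) (mset0 _ _ _); rewrite lform_own_chart ?mset0//.
  rewrite /axis_of mset1 lrem_fin_eval ?mset1// mset0 => r0; rewrite -[RHS]r0.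
  apply: eq_bigr => l _; rewrite expr1n mulr1 mulrC; congr (_ * init_part _).
  by apply/mset_eqP; rewrite mset0 mset1; split=> //; split=> // j j0 j1; rewrite !mset_other.
rewrite big_ord_recr /= subnn expr0 mulr1 expr1n mulr1 big1 ?add0r.
  have := rxi (mset a' 0 N) (mset0 _ _ _); rewrite lform_own_chart ?mset0//.
  rewrite /axis_of mset1 lrem_inf_eval ?mset0// => r0; rewrite -[RHS]r0; congr init_part.
  by apply/mset_eqP; rewrite mset0 mset1; split=> //; split=> // j j0 j1; rewrite !mset_other.
by move=> l _; rewrite expr0n subn_eq0 leqNgt ltn_ord mulr0 mul0r.
Qed.

(** In degree zero the initial part is a multiple of a monomial in [x''], which
    every chart leaves unchanged. *)
Lemma root_positive xi : root_at xi init_part -> (0 < N)%N.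
Proof.
move=> rxi; rewrite lt0n; apply/eqP => N0.
have [k fk] := init_neq0; have [kN kj] := init_bihomogeneous fk.
move/eqP: kN; rewrite N0 addn_eq0 => /andP[/eqP k0 /eqP k1].
move/negP: fk; apply; apply/eqP.
have := rxi k k0; rewrite lform_own_chart// => r0; rewrite -[RHS]r0 {r0}.
have kE : axis_of xi k = k.
  by case: (xi) => [c|] /=; apply/esym/mset_eqP; rewrite k0 k1.
rewrite kE; case: xi {rxi kE} => [c|]; last by rewrite lrem_inf_eval.
rewrite lrem_fin_eval// k0 big_ord_recl big_ord0 addr0 expr0 mul1r subn0.
by congr init_part; apply/mset_eqP.
Qed.

Lemma HL_nonconst : (0 < N)%N -> ~ is_constant (HL P L).
Proof.
move=> N0 [c cE]; have [[p Pp pN] _] := PL_lowest.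
have := congr1 (fun F => F p) cE; rewrite /HL /lowest_form pN eqxx /msconst.
case: eqP => [p0|_]; last by move/eqP; rewrite (negPf Pp).
by move: N0; rewrite -pN p0 mdeg0.
Qed.

Lemma HL_const : N = 0%N -> is_constant (HL P L).
Proof.
move=> N0; exists (PL P L 0); apply/funext => p; rewrite /HL /lowest_form N0 /msconst.
have [->|p0] := eqVneq p 0; first by rewrite mdeg0 eqxx.
case: eqP => // pd; case/negP: p0; apply/eqP/ffunP => i.
by have := le_mdeg p i; rewrite pd leqn0 ffunE => /eqP.
Qed.

Variables (Z : set (proj_line R)).
Hypothesis Z_nonconst : ~ is_constant (HL P L) -> Z = projective_zeros (HL P L).
Hypothesis Z_const : is_constant (HL P L) -> exists xi, Z = [set xi].

(** All points at which the initial part vanishes belong to [Z]; when the form is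
    constant there are none. *)
Lemma root_Z xi : root_at xi init_part -> Z xi.
Proof.
move=> rxi; rewrite Z_nonconst; first exact: root_eval2.
exact/HL_nonconst/root_positive/rxi.
Qed.

Lemma Z_inhabited : exists xi, Z xi.
Proof.
have [/HL_const/Z_const[xi ->]|N0] := posnP N; first by exists xi.
have := init_bihomogeneous; rewrite -(prednK N0) => /bihomogeneous_root[xi /root_Z Zxi].
by exists xi.
Qed.

Lemma Z_finite : exists (I : finType) (e : I -> proj_line R),
  forall xi, Z xi -> exists i, e i = xi.
Proof.
have [/HL_const/Z_const[xi ->]|N0] := posnP N.
  by exists unit, (fun=> xi) => _ ->; exists tt.
rewrite Z_nonconst; last exact: HL_nonconst.
pose p : {poly C} := \poly_(l < N.+1) init_part (mset a' (N - l) l).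
have p0 : p != 0.
  have [k fk] := init_neq0; have [kN kj] := init_bihomogeneous fk.
  apply/eqP => /(congr1 (fun q : {poly C} => q`_(k i1))).
  rewrite coef0 coef_poly ltnS -kN leq_addl addnK => /eqP; apply/negP.
  rewrite (_ : mset _ _ _ = k)//; exact/esym/mset_eqP.
have [rs pE] := closed_field_poly_normal p.
exists (option 'I_(size rs)), (fun o : option 'I_(size rs) => if o is Some i then PFin rs`_i else PInf).
move=> [c|] /=; last by exists None.
rewrite eval2_HL => ec; have pc : p.[c] = 0.
  by rewrite horner_poly -[RHS]ec; apply: eq_bigr => l _; rewrite expr1n mulr1.
have : c \in rs.
  move: pc; rewrite pE hornerZ => /eqP; rewrite mulf_eq0 lead_coef_eq0 (negPf p0) /=.
  by rewrite -[_ == 0]/(root _ c) root_prod_XsubC.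
move=> crs; have lt : (index c rs < size rs)%N by rewrite index_mem.
by exists (Some (Ordinal lt)); rewrite /= nth_index.
Qed.

End Initial.

(** * Choice of the constants and conclusion *)

Section Constants.
Variables (R : realType).

Lemma expR_small (kap del : R) : 0 < kap -> 0 < del ->
  exists2 T, 0 <= T & expR (- T * del) <= kap.
Proof.
move=> k0 d0; exists (kap^-1 / del); first by rewrite divr_ge0 ?invr_ge0 ?ltW.
rewrite mulNr divfK ?gt_eqF// expRN invf_ple ?posrE ?expR_gt0//.
by apply: le_trans (expR_ge1Dx _); rewrite lerDr.
Qed.

Lemma convergent_coef_bounded d (P : fpseries R d) : ms_convergent P ->
  exists2 r : R, 0 < r & coef_bounded r P.
Proof.
move=> [r r0 Ps]; exists r => //.
have := Ps; rewrite /summable; set S := esum _ _ => Sfin.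
have S0 : (0 <= S)%E by exact: esum_ge0.
exists (fine S) => m; rewrite -lee_fin fineK; last by rewrite ge0_fin_numE.
apply: esum_ge; exists [set m]; first by split.
rewrite fsbig_set1 /= ger0_norm// mulr_ge0 ?exprn_ge0 ?(ltW r0)//.
exact: cmod_ge0.
Qed.

Lemma coef_bounded_le d (P : fpseries R d) (s t : R) : 0 <= t -> t <= s ->
  coef_bounded s P -> coef_bounded t P.
Proof.
move=> t0 ts [M PM]; exists M => m; apply: le_trans (PM m).
by rewrite ler_wpM2l ?cmod_ge0// lerXn2r ?nnegrE// (le_trans t0).
Qed.

Lemma msexp_order d (P : fpseries R d) : P 0 = 0 ->
  forall e H m, (mdeg m < e)%N -> msmul (msexp P e) H m = 0.
Proof.
move=> P0; elim=> [//|e IH] H m me.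
rewrite /msexp /= -/(msexp P e) -msmulA.
rewrite (@msmulE _ _ (mdeg m).+1); last by move=> i; exact: mdeg_bound.
apply: big1 => b _; apply: big1 => c /eqP bc.
have [/eqP|bN] := eqVneq (mdeg (unbox b)) 0%N.
  rewrite /mdeg sum_nat_eq0 => /forallP b0.
  have -> : unbox b = 0 by apply/ffunP => i; rewrite [in RHS]ffunE; exact/eqP/b0.
  by rewrite P0 mul0r.
rewrite IH ?mulr0//; have := congr1 (@mdeg d) bc; rewrite mdegD => bc'.
move: me; rewrite -{1}bc' ltnS; apply: leq_trans; by rewrite -add1n leq_add2r lt0n.
Qed.

(** [A] exceeds the moduli of the finitely many points of [Z], and [s] is small
    compared with the distances between them. *)
Lemma separated_exists n (Z : set (proj_line R)) (I : finType) (e : I -> proj_line R)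
    (rho eps : R) (w : 'I_n.+2 -> R) :
  (forall xi, Z xi -> exists i, e i = xi) -> 0 < rho ->
  w (i0 n) = eps -> w (i1 n) = eps -> (forall i, 0 < w i) ->
  exists s A, s <= rho /\ separated Z s A eps w.
Proof.
move=> eZ rho0 w0 w1 wi.
have [||A0 A1 eA] := @fin_uniform R I (fun i M => forall c, e i = PFin c -> cmod c <= M).
- by move=> i M M' h MM c /h ?; apply: le_trans MM.
- move=> i; case: (e i) => [c|]; last by exists 0.
  by exists (cmod c) => c' [<-].
have [||D D1 eD] := @fin_uniform R (I * I)%type (fun ij M => 0 < M /\
    forall c c', e ij.1 = PFin c -> e ij.2 = PFin c' -> c != c' -> M^-1 <= cmod (c - c')).
- move=> i M M' [M0 h] MM; have M'0 := lt_le_trans M0 MM; split=> // c c' ec ec' cc'.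
  by apply: le_trans (h c c' ec ec' cc'); rewrite lef_pV2.
- case=> i j /=; case: (e i) => [c|]; last by exists 1; split.
  case: (e j) => [c'|]; last by exists 1; split.
  have [->|cc'] := eqVneq c c'.
    by exists 1; split=> // _ _ [<-] [<-]; rewrite eqxx.
  have d0 : 0 < cmod (c - c') by rewrite lt_neqAle cmod_ge0 eq_sym cmod_eq0 subr_eq0 cc'.
  by exists (cmod (c - c'))^-1; rewrite invr_gt0 invrK; split=> // _ _ [<-] [<-].
have D0 : 0 < D by exact: lt_le_trans ltr01 D1.
pose A := A0 + 1; have A0' : 0 < A by rewrite /A; lra.
pose s := Num.min rho (Num.min (A^-1 / 2) (D^-1 / 2)).
have s0 : 0 < s by rewrite !lt_min rho0 !divr_gt0 ?invr_gt0.
have srho : s <= rho by rewrite /s ge_min lexx.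
have sA : s <= A^-1 / 2 by rewrite /s !ge_min lexx orbT.
have sD : s <= D^-1 / 2 by rewrite /s !ge_min lexx !orbT.
have sA' : s * A <= 1 / 2.
  by apply: le_trans (ler_wpM2r (ltW A0') sA) _; rewrite -mulrA mulrCA mulVf ?mulr1 ?gt_eqF//; lra.
have s1 : s <= 1.
  have : s * 1 <= s * A by rewrite ler_wpM2l ?(ltW s0)// /A; lra.
  lra.
exists s, A; split=> //; split=> //.
- by rewrite /A; lra.
- by lra.
- by move=> c /eZ[i /eA]; rewrite /A; lra.
move=> c c' /eZ[i ei] /eZ[j ej] cc'.
have [_ /(_ c c' ei ej cc')] := eD (i, j); lra.
Qed.

End Constants.

Section Gap.
Variables (R : realType) (n : nat) (P : fpseries R n.+2).
Variables (L : {additive {ffun 'I_n -> nat} -> R}).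
Hypotheses (P_neq0 : P <> mszero) (L_ge0 : forall a, 0 <= L a) (L_inj : injective L).
Local Notation N := (lowest_degree (PL P L)).
Local Notation a := (mcat 0 (min_exponent P L) : mindex n.+2).

(** For a small weight [eps] of [x_1] and [x_2], the initial part consists of the
    terms of least weight; a part of the gap to the other weights is traded for
    a lower bound proportional to the degree. *)
Lemma weight_gap : exists eps delta : R, let w := chart_weight L eps in
  [/\ 0 < delta, forall i, 0 < w i, forall i, delta <= w i &
    forall p, rest_part P L p != 0 ->
      N%:R * eps + wt w a + delta + delta * (mdeg p)%:R <= wt w p].
Proof.
have [_ [eta eta0 gap]] := min_exponentP P_neq0 L_ge0 L_inj.
have [_ Nmin] := PL_lowest P_neq0 L_ge0 L_inj.
have N1 : 0 < 2 * (N%:R + 1) :> R by rewrite mulr_gt0// ltr_wpDl.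
pose eps := eta / (2 * (N%:R + 1)); pose w := chart_weight L eps.
have eps0 : 0 < eps by rewrite divr_gt0.
have etaE : eta = 2 * (N%:R * eps) + 2 * eps.
  by rewrite -[LHS](divfK (lt0r_neq0 N1)) -/eps; ring.
have Ne0 : 0 <= N%:R * eps by rewrite mulr_ge0// ltW.
have w0 i : 0 < w i.
  rewrite /w /chart_weight; case: (fintype.split _) => // j; exact: L_basis_gt0.
have [||c c1 cw] := @fin_uniform R 'I_n.+2 (fun j c => 0 < c /\ c^-1 <= w j).
- move=> j M M' [M0 LM] MM'; have M'0 := lt_le_trans M0 MM'; split=> //.
  by apply: le_trans LM; rewrite lef_pV2.
- by move=> j; exists (w j)^-1; rewrite invr_gt0 invrK lexx.
have m0 : 0 < c^-1 by rewrite invr_gt0; exact: lt_le_trans ltr01 c1.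
have mw i : c^-1 <= w i by have [] := cw i.
move: (c^-1) m0 mw => m m0 mw {c c1 cw}.
pose u := N%:R * eps + wt w a.
have wa : wt w a = L (min_exponent P L).
  by rewrite wt_chart_weight mcat0 mcat1 !ffunE mul0r add0r mtail_mcat.
have u0 : 0 <= u by rewrite addr_ge0// wa.
have S0 : 0 < u + eps + m by lra.
pose th := eps / (u + eps + m).
have th0 : 0 < th by rewrite divr_gt0.
have thE : th * (u + eps + m) = eps by rewrite divfK ?gt_eqF.
have th1 : th <= 1 by rewrite ler_pdivrMr// mul1r; lra.
exists eps, (th * m); split => //.
- exact: mulr_gt0.
- by move=> i; apply: le_trans (mw i); rewrite ler_piMl ?(ltW m0).
move=> p pr; have ge1 : u + eps <= wt w p.
  rewrite /u wa wt_chart_weight; move: pr; rewrite /rest_part /in_init.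
  have [pa|pa] := eqVneq (mtail p) (min_exponent P L); last first.
    move=> Pp; have := gap p Pp pa.
    have : 0 <= (p (i0 n) + p (i1 n))%:R * eps by rewrite mulr_ge0 ?(ltW eps0).
    lra.
  have [pN|pN] := eqVneq (p (i0 n) + p (i1 n))%N N; first by rewrite /= eqxx.
  rewrite pa /= => Pp; have lt : (N < p (i0 n) + p (i1 n))%N.
    rewrite ltn_neqAle eq_sym pN /=.
    have := Nmin (mpair (p (i0 n)) (p (i1 n))); rewrite mdeg2 mpair0 mpair1; apply.
    rewrite /PL (_ : mcat _ _ = p)//.
    by have := proj2 (mset_mcat p (mpair (p (i0 n)) (p (i1 n))) _) pa; rewrite mpair0 mpair1 mset_id.
  have : (N.+1)%:R * eps <= (p (i0 n) + p (i1 n))%:R * eps.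
    by rewrite ler_wpM2r ?(ltW eps0)// ler_nat.
  by rewrite -natr1 mulrDl mul1r; lra.
have ge2 := wt_ge_mdeg p mw.
have h1 : th * (m * (mdeg p)%:R) <= th * wt w p by rewrite ler_wpM2l// ltW.
have h2 : (1 - th) * (u + eps) <= (1 - th) * wt w p by rewrite ler_wpM2l// subr_ge0.
rewrite -[leLHS]/(u + th * m + th * m * (mdeg p)%:R) -[leRHS]/(wt w p).
clearbody th u; lra.
Qed.

End Gap.

Section Assembly.
Variables (R : realType) (n : nat) (P : fpseries R n.+2).
Hypotheses (P_conv : ms_convergent P) (P_neq0 : P <> mszero) (P_at0 : P 0 = 0).
Variables (L : {additive {ffun 'I_n -> nat} -> R}).
Hypotheses (L_ge0 : forall a, 0 <= L a) (L_inj : injective L).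
Variables (Z : set (proj_line R)).
Hypothesis Z_nonconst : ~ is_constant (HL P L) -> Z = projective_zeros (HL P L).
Hypothesis Z_const : is_constant (HL P L) -> exists xi, Z = [set xi].
Variable f : fpseries R n.+2.
Hypothesis f_asympt : forall xi, Z xi ->
  asymptotic_series (mscomp P (blowup n xi)) (mscomp f (blowup n xi)).
Local Notation N := (lowest_degree (PL P L)).
Local Notation a := (mcat 0 (min_exponent P L) : mindex n.+2).

(** The hypothesis on [f] at [xi], with the functions replaced by their Taylor series. *)
Definition chart_expansion xi (rho : R) k (FK : fpseries R n.+2 * fpseries R n.+2) :=
  (forall v, mscomp f (blowup n xi) v =
     FK.1 v + msmul (mscomp (msexp P k) (blowup n xi)) FK.2 v) /\
  coef_bounded rho FK.1.

(** By finiteness of [Z], one radius serves all charts and all powers of [P]. *)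
Lemma common_radius : exists2 rho, 0 < rho &
  forall xi k, exists FK, Z xi -> chart_expansion xi rho k FK.
Proof.
have [I [e eZ]] := Z_finite P_neq0 L_ge0 L_inj Z_nonconst Z_const.
have [||M M1 eM] := @fin_uniform R I (fun i M => 0 < M /\
    (Z (e i) -> forall k, exists FK, chart_expansion (e i) M^-1 k FK)).
- move=> i M M' [M0 h] MM; have M'0 := lt_le_trans M0 MM; split=> // Zi k.
  have [FK [FKE FKb]] := h Zi k; exists FK; split=> //.
  by apply: coef_bounded_le FKb; rewrite ?invr_ge0 ?lef_pV2// ltW.
- move=> i; have [Zi|nZ] := pselect (Z (e i)); last by exists 1; split.
  have [rho [rho0 [g [gh _ gc]]]] := f_asympt Zi.
  exists (rho / 2)^-1; rewrite invr_gt0 invrK divr_gt0//; split=> // _ k.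
  have [H HE] := gc k; exists (taylor (g k), fun v => - H v); split; last first.
    exact: taylor_coef_bounded.
  move=> v; have := congr1 (fun F => F v) HE; rewrite /mssub /= => h.
  rewrite (mscomp_exp (@blowup_raising R n (e i))).
  rewrite (_ : (fun v => - H v) = fun v => - 1 * H v); last first.
    by apply/funext => v'; rewrite mulN1r.
  by rewrite msmulZr -h mulN1r opprB addrC subrK.
have M0 : 0 < M by exact: lt_le_trans ltr01 M1.
exists M^-1; first by rewrite invr_gt0.
move=> xi k; have [Zx|nZ] := pselect (Z xi); last by exists (f, f).
have [i ei] := eZ _ Zx; have [_] := eM i; rewrite ei => /(_ Zx k)[FK FKP].
by exists FK.
Qed.

(** The order of the choices matters.  The radius [s] of [v_1] is bounded by the
    radius of the given functions and fixed first; the constant [c] of the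
    division by the initial part depends on [s] but not on [T]; finally [T] is
    taken so large that the rest of [P] is a small perturbation and that the
    other radii are below those of the given functions.  None of this depends
    on [k]. *)
Lemma remainder_coef_bounded : exists2 r0 : R, 0 < r0 & forall k, exists q,
  coef_bounded r0 (fun m => f m - msmul (msexp P k) q m).
Proof.
have [rho rho0 FKex] := common_radius.
have [r r0 [MP PM]] := convergent_coef_bounded P_conv.
have [eps [del [del0 w0 delw Pw]]] := weight_gap P_neq0 L_ge0 L_inj.
set w := chart_weight L eps in w0 delw Pw.
have [I [e eZ]] := Z_finite P_neq0 L_ge0 L_inj Z_nonconst Z_const.
have wi0 : w (i0 n) = eps by rewrite /w i0_lshift chart_weight_l.
have wi1 : w (i1 n) = eps by rewrite /w i1_lshift chart_weight_l.
have [s [A [srho sepZ]]] := separated_exists eZ rho0 wi0 wi1 w0.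
have rZ := root_Z P_neq0 L_ge0 L_inj Z_nonconst.
have [c [D cD]] : exists c D, divisor Z s A w (init_part P L) (N%:R * eps + wt w a) c D.
  apply: (divisor_bihomogeneous sepZ) => //.
  - by rewrite mcat0 ffunE.
  - by rewrite mcat1 ffunE.
  - exact: init_neq0.
  - exact: init_bihomogeneous.
have c0 : 0 <= c by have [] := cD.
have A1 := sep_A sepZ; have A0 : 0 < A by exact: lt_le_trans ltr01 A1.
have MP0 : 0 <= MP.
  by apply: le_trans (PM 0); rewrite mulr_ge0 ?cmod_ge0 ?exprn_ge0// ltW.
pose B := c * (MP * 2 ^+ n.+2) + 1.
have B0 : 0 < B by rewrite ltr_wpDl// mulr_ge0// mulr_ge0// exprn_ge0.
pose kap := Num.min (r / A / 2) (Num.min (B^-1 / 2) (rho / A)).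
have kap0 : 0 < kap by rewrite !lt_min !divr_gt0// invr_gt0.
have [T T0 Tkap] := expR_small kap0 del0.
have k1 : kap <= r / A / 2 by rewrite /kap ge_min lexx.
have k2 : kap <= B^-1 / 2 by rewrite /kap !ge_min lexx orbT.
have k3 : kap <= rho / A by rewrite /kap !ge_min lexx !orbT.
have E0 := expR_ge0 (- T * del); move: Tkap E0; set E := expR _ => Tkap E0.
have Tdelta : A * E / r <= 1 / 2.
  rewrite ler_pdivrMr//; apply: le_trans (ler_wpM2l (ltW A0) (le_trans Tkap k1)) _.
  by rewrite le_eqVlt; apply/orP; left; apply/eqP; field; rewrite gt_eqF.
have small : c * (MP * E * 2 ^+ n.+2) <= 1 / 2.
  apply: (@le_trans _ _ (B * E)); last first.
    apply: le_trans (ler_wpM2l (ltW B0) (le_trans Tkap k2)) _.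
    by rewrite mulrA mulfV ?mul1r ?gt_eqF//; lra.
  by rewrite [MP * E * _]mulrAC [c * _]mulrA /B mulrDl mul1r lerDl.
have AE : A * E <= rho.
  apply: le_trans (ler_wpM2l (ltW A0) (le_trans Tkap k3)) _.
  by rewrite mulrCA mulfV ?mulr1 ?gt_eqF.
have wE i : expR (- T * w i) <= E by rewrite ler_expR !mulNr lerN2 ler_wpM2l.
have Er : E <= rho by apply: le_trans AE; rewrite ler_peMl.
have rad_rho xi i : rad s A w T xi i <= rho.
  rewrite /rad; case: ifP => _ //; case: ifP => _; last exact: le_trans (wE i) Er.
  apply: le_trans AE; apply: ler_pM; rewrite ?expR_ge0 ?wE//.
    by case: xi => [?|] /=; [exact: ler01|exact: ltW].
  by case: xi => [?|] /=.
have r_gt0 := rad_gt0 sepZ T.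
have PE : P = fun k => init_part P L k + rest_part P L k.
  by apply/funext => k; rewrite init_rest.
have restM p : cmod (rest_part P L p) * r ^+ mdeg p <= MP.
  by rewrite /rest_part; case: ifP => _ //; rewrite cmod0 mul0r.
have sumM p : cmod (init_part P L p + rest_part P L p) * r ^+ mdeg p <= MP.
  by rewrite init_rest.
have [xi0 Zxi0] := Z_inhabited P_neq0 L_ge0 L_inj Z_nonconst Z_const.
have [||J J1 Jr] := @fin_uniform R 'I_n.+2 (fun j J => 0 < J /\
    bdown xi0 (rad s A w T xi0) * J^-1 <= rad s A w T xi0 j).
- move=> j M M' [M0 LM] MM'; have M'0 := lt_le_trans M0 MM'; split=> //.
  apply: le_trans LM; rewrite ler_wpM2l ?lef_pV2//.
  exact: le_trans ler01 (bdown_ge1 _ (r_gt0 xi0)).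
- move=> j; have b0 := lt_le_trans ltr01 (bdown_ge1 xi0 (r_gt0 xi0)).
  exists (bdown xi0 (rad s A w T xi0) / rad s A w T xi0 j).
  by rewrite divr_gt0// invf_div mulrCA mulfV ?mulr1 ?gt_eqF.
have J0 : 0 < J by exact: lt_le_trans ltr01 J1.
exists J^-1; first by rewrite invr_gt0.
move=> k; have [FK FKE] := choice (fun xi => FKex xi k).
have [||M M1 eM] := @fin_uniform R I (fun i M => Z (e i) ->
    forall v, cmod ((FK (e i)).1 v) * rho ^+ mdeg v <= M).
- by move=> i M M' h MM Zi v; apply: le_trans MM; exact: h.
- move=> i; have [Zi|nZ] := pselect (Z (e i)); last by exists 0.
  by have [_ [M FM]] := FKE _ Zi; exists M.
have Fb : chart_bounded Z s A w T (fun xi => (FK xi).1).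
  exists M; first exact: le_trans ler01 M1.
  move=> xi Zxi v; have [i ei] := eZ _ Zxi.
  apply: le_trans (_ : cmod ((FK xi).1 v) * rho ^+ mdeg v <= M); last first.
    by have := eM i; rewrite ei => /(_ Zxi v).
  rewrite ler_wpM2l ?cmod_ge0// /Wt /mdeg -prodrXr; apply: ler_prod => j _.
  rewrite exprn_ge0 ?(ltW (r_gt0 _ _))//=.
  by rewrite lerXn2r ?nnegrE ?(ltW (r_gt0 _ _)) ?(ltW rho0).
have [|q [M' M'0 qM]] := @power_remainder _ _ Z s A eps w sepZ T r del T0 r0 del0 Tdelta
  delw (init_part P L) (rest_part P L) _ c MP D cD Pw restM small sumM k f
  (fun xi => (FK xi).1) (fun xi => (FK xi).2) _ Fb.
  by move=> xi Zxi v; rewrite -PE; have [+ _] := FKE _ Zxi; exact.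
exists q; exists M'; rewrite -PE in qM.
apply: (@chart_coef_bounded _ _ xi0 _ (r_gt0 xi0)) => [|j _|v].
- by rewrite invr_gt0.
- by have [] := Jr j.
- exact: qM.
Qed.

(** The remainders have geometrically bounded coefficients of uniform ratio, hence
    are the Taylor series of bounded holomorphic functions on one polydisc; they
    converge to [f] because [P] has no constant term. *)
Lemma asymptotic_series_blow_down : asymptotic_series P f.
Proof.
have [r0 r0_gt0 /choice[q qb]] := remainder_coef_bounded.
pose t := Num.min 1 (r0 / 4).
have t0 : 0 < t by rewrite lt_min ltr01 divr_gt0.
have t1 : t <= 1 by rewrite /t ge_min lexx.
have t4 : 4 * t <= r0.
  have : t <= r0 / 4 by rewrite /t ge_min lexx orbT.
  lra.
pose g k : fpseries R n.+2 := fun m => f m - msmul (msexp P k) (q k) m.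
have gP k : bounded_holomorphic (polydisc t) (psum (g k)) /\ taylor (psum (g k)) = g k.
  by have [M gM] := qb k; exact: (@taylor_psum _ _ (g k) r0 M).
exists t; split=> //; exists (fun k => psum (g k)); split.
- by move=> k; have [] := gP k.
- move=> M; exists M => // k /= Mk m mM; rewrite /mssub (proj2 (gP k)) /g.
  by rewrite msexp_order ?subr0 ?subrr//; exact: leq_trans mM Mk.
move=> k; exists (fun v => - 1 * q k v); apply/funext => m.
by rewrite /mssub (proj2 (gP k)) /g msmulZr mulN1r; ring.
Qed.

End Assembly.

Theorem theorem6p10 (R : realType) (n : nat)
    (P : fpseries R n.+2) (P_conv : ms_convergent P)
    (P_neq0 : P <> mszero) (P_at0 : P 0 = 0)
    (L : {additive {ffun 'I_n -> nat} -> R})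
    (L_ge0 : forall a, 0 <= L a) (L_inj : injective L)
    (Z : set (proj_line R))
    (Z_nonconst : ~ is_constant (HL P L) -> Z = projective_zeros (HL P L))
    (Z_const : is_constant (HL P L) -> exists xi, Z = [set xi])
    (f : fpseries R n.+2)
    (f_asympt : forall xi, Z xi ->
       asymptotic_series (mscomp P (blowup n xi)) (mscomp f (blowup n xi))) :
  asymptotic_series P f.
Proof.
exact: (asymptotic_series_blow_down P_conv P_neq0 P_at0 L_ge0 L_inj
  Z_nonconst Z_const f_asympt).
Qed.
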